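(* For every positive integer $k$, there is a polynomial-time $4$-approximation algorithm for the $(k,1)$-Flexible Graph Connectivity problem: given any feasible instance, it outputs a feasible edge-set whose cost is at most $4$ times the minimum cost of a feasible edge-set.
   Context: Let $p\ge1$, $q\ge0$ be integers. An instance of the $(p,q)$-Flexible Graph Connectivity problem $(p,q)$-FGC consists of an undirected connected graph $G=(V,E)$ (multiedges allowed, no self-loops), a partition $E=\mathscr{S}\,\dot\cup\,\mathscr{U}$ into safe edges and unsafe edges, and nonnegative costs $c:E\to\mathbb{R}_{\ge0}$. An edge-set $F\subseteq E$ (a sub-multiset of $E$) is feasible if for every $F'\subseteq\mathscr{U}$ with $|F'|\le q$, the subgraph $(V,F\setminus F')$ is $p$-edge connected. The goal is to minimize $c(F)=\sum_{e\in F}c_e$ over feasible $F$. Here $p=k$, $q=1$.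
   Formalization: Edge costs are taken to be nonnegative rationals, given by numerator and denominator in binary, rather than arbitrary nonnegative reals, since polynomial running time in the input size is undefined for costs that have no finite encoding. *)

(* Defs.v *)
From HB Require Import structures.
From mathcomp Require Import all_boot all_order all_algebra.

Set Implicit Arguments.
Unset Strict Implicit.
Unset Printing Implicit Defensive.

Import Order.TTheory GRing.Theory Num.Theory.

(* Multigraphs on vertex type V: parallel edges are distinct elements of E,
   so sub-multisets of the edges are sets F : {set E}. *)

Definition adjacent (V E : finType) (ends : E -> V * V) (F : {set E}) : rel V :=
  fun u v => [exists e in F, (ends e == (u, v)) || (ends e == (v, u))].

Definition connected (V E : finType) (ends : E -> V * V) (F : {set E}) : Prop :=
  forall u v : V, connect (adjacent ends F) u v.

Definition edge_connected (V E : finType) (ends : E -> V * V)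
    (p : nat) (F : {set E}) : Prop :=
  forall X : {set E}, X \subset F -> #|X| < p -> connected ends (F :\: X).

(* Costs are rational, so that an instance is a finite object with a bit size;
   an edge is unsafe when it is not in [safe]. *)
Record fgc_instance := FGCInstance {
  nV : nat;
  nE : nat;
  ends : 'I_nE -> 'I_nV * 'I_nV;
  safe : {set 'I_nE};
  ecost : 'I_nE -> rat;
  nV_gt0 : 0 < nV;
  ends_loopless : forall e, (ends e).1 != (ends e).2;
  ends_connected : connected ends [set: 'I_nE];
  ecost_ge0 : forall e, (0 <= ecost e)%R
}.

Arguments ends : clear implicits.
Arguments ecost : clear implicits.

Definition feasible (p q : nat) (I : fgc_instance)
    (F : {set 'I_(nE I)}) : Prop :=
  forall F' : {set 'I_(nE I)}, F' \subset ~: safe I -> #|F'| <= q ->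
    edge_connected (ends I) p (F :\: F').

Arguments feasible : clear implicits.

Definition cost (I : fgc_instance) (F : {set 'I_(nE I)}) : rat :=
  (\sum_(e in F) ecost I e)%R.

Arguments cost : clear implicits.

Definition optimal (p q : nat) (I : fgc_instance)
    (F : {set 'I_(nE I)}) : Prop :=
  feasible p q I F /\
  forall F' : {set 'I_(nE I)}, feasible p q I F' -> (cost I F <= cost I F')%R.

Arguments optimal : clear implicits.

(* Random access machine under the logarithmic cost criterion, programmed by
   structured programs.  A store consists of arrays of natural numbers of
   unbounded length; array names are static, indices are computed.  Every value
   read, written or computed is charged its binary length, so that running times
   are polynomially related to those of Turing machines. *)

Definition store := nat -> nat -> nat.

Definition update (s : store) (a i v : nat) : store :=
  fun b j => if (b == a) && (j == i) then v else s b j.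

Definition bitlen (n : nat) : nat := (trunc_log 2 n).+1.

Inductive binop := Add | Sub | Mul | Div.

Definition eval_op (o : binop) : nat -> nat -> nat :=
  match o with Add => addn | Sub => subn | Mul => muln | Div => divn end.

Inductive expr :=
  | Const of nat
  | Get of nat & expr
  | Op of binop & expr & expr.

Fixpoint eval (s : store) (e : expr) : nat :=
  match e with
  | Const n => n
  | Get a e => s a (eval s e)
  | Op o e1 e2 => eval_op o (eval s e1) (eval s e2)
  end.

Fixpoint eval_time (s : store) (e : expr) : nat :=
  bitlen (eval s e) +
  match e with
  | Const _ => 0
  | Get _ e => eval_time s e
  | Op _ e1 e2 => eval_time s e1 + eval_time s e2
  end.

Inductive prog :=
  | Skip
  | Set_ of nat & expr & expr
  | Seq of prog & prog
  | If of expr & prog & prog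
  | While of expr & prog.

(* [exec c s t s']: from store s, c halts after time t in store s'.
   Tests succeed on nonzero values. *)
Inductive exec : prog -> store -> nat -> store -> Prop :=
  | exec_Skip s : exec Skip s 1 s
  | exec_Set a e1 e2 s :
      exec (Set_ a e1 e2) s (eval_time s e1 + eval_time s e2).+1
        (update s a (eval s e1) (eval s e2))
  | exec_Seq c1 c2 s t1 s1 t2 s2 :
      exec c1 s t1 s1 -> exec c2 s1 t2 s2 -> exec (Seq c1 c2) s (t1 + t2) s2
  | exec_If e c1 c2 s t s' :
      exec (if eval s e != 0 then c1 else c2) s t s' ->
      exec (If e c1 c2) s (eval_time s e + t).+1 s'
  | exec_While_stop e c s :
      eval s e = 0 -> exec (While e c) s (eval_time s e).+1 s
  | exec_While_step e c s t1 s1 t2 s2 :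
      eval s e != 0 -> exec c s t1 s1 -> exec (While e c) s1 t2 s2 ->
      exec (While e c) s (eval_time s e + t1 + t2).+1 s2.

Definition encode (I : fgc_instance) : seq nat :=
  [:: nV I, nE I &
   flatten [seq [:: val (ends I e).1; val (ends I e).2; nat_of_bool (e \in safe I);
                    absz (numq (ecost I e)); absz (denq (ecost I e))]
           | e <- enum 'I_(nE I)]].

Definition input_size (I : fgc_instance) : nat :=
  \sum_(x <- encode I) bitlen x.

Definition input_store (I : fgc_instance) : store :=
  fun a i => if a == 0 then nth 0 (encode I) i else 0.

(* The output is the characteristic vector stored in array 1. *)
Definition output (I : fgc_instance) (s : store) : {set 'I_(nE I)} :=
  [set e : 'I_(nE I) | s 1 e != 0].

(* The program must halt within the time bound on every instance; its output is
   constrained on the instances that have a feasible edge-set. *)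
Definition polytime_approximation (alpha : rat) (p q : nat) (A : prog) : Prop :=
  exists c d : nat, forall I : fgc_instance,
  exists (t : nat) (s : store),
    [/\ exec A (input_store I) t s,
        t <= c * input_size I ^ d + c &
        (exists F : {set 'I_(nE I)}, feasible p q I F) ->
          feasible p q I (output I s) /\
          forall Fopt : {set 'I_(nE I)}, optimal p q I Fopt ->
            (cost I (output I s) <= alpha * cost I Fopt)%R].

(* Main.v *)
From HB Require Import structures.
From mathcomp Require Import all_boot all_order all_algebra.
From mathcomp Require Import zify ring.
From Stdlib Require Import FunctionalExtensionality.
Require Import Defs.

Set Implicit Arguments.
Unset Strict Implicit.
Unset Printing Implicit Defensive.

Import Order.TTheory GRing.Theory Num.Theory.

(** Replace every edge by two opposite arcs and fix a root.  A k-edge-connected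
    graph then contains k arc-disjoint spanning arborescences (Edmonds), so a
    minimum-cost packing of k arborescences, a minimum common basis of two
    matroids found by primal-dual weighted matroid intersection, costs at most
    twice the optimum, and the edges it uses form a k-edge-connected set H.

    What is left are the cuts of H with exactly k edges, one of them unsafe.
    These violated sets form an uncrossable family, which is covered with factor
    2 by the primal-dual method of Williamson, Goemans, Mihail and Vazirani,
    written here as a local-ratio argument: costs are doubled instead of halved
    so as to stay integral, and one edge is chosen per round.  Since k is fixed,
    violated sets are enumerated as components of H minus at most k edges.

    Polynomial time is obtained once and for all: programs whose loops are bounded
    by polynomials in the numbers of vertices and edges, and whose products have
    a bounded factor, run in polynomial time under the logarithmic cost. *)

(** * Programs with bounded loops *)

(** The factor 4 is 2 + 2: in the packing each edge of the optimum stands for two arcs, and the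
    cover is compared with the part of the optimum outside H, which must itself cover every violated
    set. Matroid intersection starts without a feasibility phase: artificial arcs out of the root,
    each heavier than any packing of real arcs, form a first common basis. All elements begin with
    that same weight and are lowered to their true weights one at a time, while a splitting of the
    weights over the two matroids certifies optimality throughout. Edmonds' theorem only supplies
    the packing to compare with; that H is k-edge-connected follows from the computed basis by
    counting arcs, so no arborescence is ever extracted from it. In the second stage reduced costs
    may double in every round, which is why lengths of values, and not values, are kept polynomial.
    Rational costs are scaled by the product of all denominators, whose length is at most the sum of
    theirs. *)

Inductive bnd := BC of nat | BV | BE | BA of bnd & bnd | BM of bnd & bnd.

Fixpoint bexpr (b : bnd) : expr :=
  match b with
  | BC n => Const n
  | BV => Get 0 (Const 0)
  | BE => Get 0 (Const 1)
  | BA b1 b2 => Op Add (bexpr b1) (bexpr b2)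
  | BM b1 b2 => Op Mul (bexpr b1) (bexpr b2)
  end.

Definition bval (b : bnd) (s : store) : nat := eval s (bexpr b).

(* Products are restricted to a factor that is a loop bound or an input entry:
   the bit length of every value then grows only additively along a run. *)
Inductive tx :=
  | TC of nat
  | TG of nat & tx
  | TAdd of tx & tx
  | TSub of tx & tx
  | TDiv of tx & tx
  | TB of bnd
  | TMB of tx & bnd
  | TMI of tx & tx.

Fixpoint texpr (e : tx) : expr :=
  match e with
  | TC n => Const n
  | TG a e => Get a (texpr e)
  | TAdd e1 e2 => Op Add (texpr e1) (texpr e2)
  | TSub e1 e2 => Op Sub (texpr e1) (texpr e2)
  | TDiv e1 e2 => Op Div (texpr e1) (texpr e2)
  | TB b => bexpr b
  | TMB e b => Op Mul (texpr e) (bexpr b)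
  | TMI e1 e2 => Op Mul (texpr e1) (Get 0 (texpr e2))
  end.

Inductive stmt :=
  | SSet of nat & tx & tx
  | SSeq of stmt & stmt
  | SIf of tx & stmt & stmt
  | SFor of nat & bnd & stmt.

Definition incr_var (v : nat) := SSet v (TC 0) (TAdd (TG v (TC 0)) (TC 1)).

Fixpoint code (c : stmt) : prog :=
  match c with
  | SSet a e1 e2 => Set_ a (texpr e1) (texpr e2)
  | SSeq c1 c2 => Seq (code c1) (code c2)
  | SIf e c1 c2 => If (texpr e) (code c1) (code c2)
  | SFor v b c => Seq (Set_ v (Const 0) (Const 0))
      (While (texpr (TSub (TB b) (TG v (TC 0))))
         (Seq (code c) (Set_ v (Const 0) (Op Add (Get v (Const 0)) (Const 1)))))
  end.

Definition incr_at (v : nat) (s : store) := update s v 0 (s v 0 + 1).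

Fixpoint run (c : stmt) (s : store) : store :=
  match c with
  | SSet a e1 e2 => update s a (eval s (texpr e1)) (eval s (texpr e2))
  | SSeq c1 c2 => run c2 (run c1 s)
  | SIf e c1 c2 => if eval s (texpr e) != 0 then run c1 s else run c2 s
  | SFor v b c =>
      iter (bval b s) (fun s' => incr_at v (run c s')) (update s v 0 0)
  end.

Fixpoint wr (c : stmt) (a : nat) : bool :=
  match c with
  | SSet b _ _ => a == b
  | SSeq c1 c2 => wr c1 a || wr c2 a
  | SIf _ c1 c2 => wr c1 a || wr c2 a
  | SFor v _ c => (a == v) || wr c a
  end.

(** The input array 0 is read-only and a loop body cannot touch its own counter. Loop bounds
    therefore keep their value during a run, and evaluating a bound once, as [run] does, agrees with
    the compiled [While], which evaluates it at every test. *)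
Fixpoint wf (c : stmt) : bool :=
  match c with
  | SSet a _ _ => a != 0
  | SSeq c1 c2 => wf c1 && wf c2
  | SIf _ c1 c2 => wf c1 && wf c2
  | SFor v _ c => [&& v != 0, ~~ wr c v & wf c]
  end.

Lemma run_frame c s a i : ~~ wr c a -> run c s a i = s a i.
Proof.
elim: c s => [b e1 e2|c1 IH1 c2 IH2|e c1 IH1 c2 IH2|v b c IH] s /=.
- by rewrite /update; case: eqP => // ->.
- by rewrite negb_or => /andP[h1 h2]; rewrite IH2 // IH1.
- by rewrite negb_or => /andP[h1 h2]; case: ifP; rewrite ?IH1 ?IH2.
- rewrite negb_or => /andP[av hc]; elim: (bval b s) => [|n IHn] /=.
    by rewrite /update (negPf av).
  by rewrite /incr_at /update (negPf av) /= IH.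
Qed.

Lemma wf_wr0 c : wf c -> ~~ wr c 0.
Proof.
elim: c => [b e1 e2|c1 IH1 c2 IH2|e c1 IH1 c2 IH2|v b c IH] /=.
- by rewrite eq_sym.
- by case/andP => /IH1 /negPf -> /IH2 /negPf ->.
- by case/andP => /IH1 /negPf -> /IH2 /negPf ->.
- by case/and3P => h _ /IH /negPf ->; rewrite orbF eq_sym.
Qed.

Lemma eval_bexpr_ext b s s' : (forall i, s 0 i = s' 0 i) -> bval b s = bval b s'.
Proof. by rewrite /bval => h; elim: b => //= b1 -> b2 ->. Qed.

Definition bounded L (s : store) := forall a i, s a i < 2 ^ L.

(** [Z] bounds every intermediate value of every loop bound. These predicates look only at array 0,
    so a check made on the initial store remains good along the whole run. *)
Fixpoint bok Z (b : bnd) (s : store) : bool :=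
  (bval b s <= Z) &&
  match b with BA b1 b2 | BM b1 b2 => bok Z b1 s && bok Z b2 s | _ => true end.

Fixpoint xok Z (e : tx) (s : store) : bool :=
  match e with
  | TC _ => true
  | TG _ e => xok Z e s
  | TAdd e1 e2 | TSub e1 e2 | TDiv e1 e2 | TMI e1 e2 => xok Z e1 s && xok Z e2 s
  | TB b => bok Z b s
  | TMB e b => xok Z e s && bok Z b s
  end.

Fixpoint sok Z (c : stmt) (s : store) : bool :=
  match c with
  | SSet _ e1 e2 => xok Z e1 s && xok Z e2 s
  | SSeq c1 c2 => sok Z c1 s && sok Z c2 s
  | SIf e c1 c2 => [&& xok Z e s, sok Z c1 s & sok Z c2 s]
  | SFor _ b c => bok Z b s && sok Z c s
  end.

Lemma bok_ext Z b s s' : (forall i, s 0 i = s' 0 i) -> bok Z b s = bok Z b s'.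
Proof.
move=> h; elim: b => [n|||b1 IH1 b2 IH2|b1 IH1 b2 IH2]; rewrite /= (eval_bexpr_ext _ h) //.
  by rewrite IH1 IH2.
by rewrite IH1 IH2.
Qed.

Lemma xok_ext Z e s s' : (forall i, s 0 i = s' 0 i) -> xok Z e s = xok Z e s'.
Proof.
move=> h; elim: e => //= [e1 -> e2 ->|e1 -> e2 ->|e1 -> e2 ->|b|e -> b|e1 -> e2 ->] //.
  exact: bok_ext.
by rewrite (bok_ext _ _ h).
Qed.

Lemma sok_ext Z c s s' : (forall i, s 0 i = s' 0 i) -> sok Z c s = sok Z c s'.
Proof.
move=> h; elim: c => /= [a e1 e2|c1 -> c2 ->|e c1 -> c2 ->|v b c ->] //.
- by rewrite !(xok_ext _ _ h).
- by rewrite !(xok_ext _ _ h).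
- by rewrite !(bok_ext _ _ h).
Qed.

Lemma bitlen_le v L : v < 2 ^ L -> bitlen v <= L.+1.
Proof.
rewrite /bitlen ltnS; case: v => [|v] h; first by rewrite trunc_log0.
rewrite leqNgt; apply/negP => hL.
have := trunc_logP (isT : 1 < 2) (ltn0Sn v).
apply/negP; rewrite -ltnNge; apply: (leq_trans h).
by rewrite leq_exp2l // ltnW.
Qed.

Lemma ltn_exp2id n : n < 2 ^ n. Proof. exact: ltn_expl. Qed.

Fixpoint bsize (b : bnd) : nat :=
  match b with BC _ => 1 | BV | BE => 3 | BA b1 b2 | BM b1 b2 => (bsize b1 + bsize b2).+1 end.

Lemma bexpr_bound Z b s : bok Z b s ->
  bval b s <= Z /\ eval_time s (bexpr b) <= bsize b * Z.+2.
Proof.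
have bl x : x <= Z -> bitlen x <= Z.+1.
  by move=> h; apply: bitlen_le; apply: leq_ltn_trans h (ltn_exp2id _).
have b0 : bitlen 0 = 1 by rewrite /bitlen trunc_log0.
have b1 : bitlen 1 = 1 by rewrite /bitlen trunc_log1.
rewrite /bval; elim: b => /= [n|||b1' IH1 b2' IH2|b1' IH1 b2' IH2]; rewrite /bval /=.
- by rewrite andbT => h; split=> //; have := bl _ h; lia.
- by rewrite andbT => h; split=> //; have := bl _ h; rewrite b0; lia.
- by rewrite andbT => h; split=> //; have := bl _ h; rewrite b1; lia.
- by case/and3P=> h /IH1[_ t1] /IH2[_ t2]; split=> //; have := bl _ h; lia.
- by case/and3P=> h /IH1[_ t1] /IH2[_ t2]; split=> //; have := bl _ h; lia.
Qed.

(** The growth [g * Z] does not depend on [L]: a product has one factor below [2 ^ Z], and a sum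
    lengthens a value by one bit, so lengths add up instead of doubling. *)
Lemma texpr_bound e : exists g, forall Z L s, 1 < Z -> bounded L s ->
  (forall i, s 0 i < 2 ^ Z) -> xok Z e s ->
  eval s (texpr e) < 2 ^ (L + g * Z) /\ eval_time s (texpr e) <= g * (L + g * Z).+1.
Proof.
have mono a b c : a < 2 ^ b -> b <= c -> a < 2 ^ c.
  by move=> h bc; apply: leq_trans h _; rewrite leq_exp2l.
elim: e => [n|a e [g IH]|e1 [g1 IH1] e2 [g2 IH2]|e1 [g1 IH1] e2 [g2 IH2]
           |e1 [g1 IH1] e2 [g2 IH2]|b|e [g IH] b|e1 [g1 IH1] e2 [g2 IH2]].
- exists n.+1 => Z L s Z1 _ _ _ /=.
  have h : n < 2 ^ (L + n.+1 * Z) by apply: mono (ltn_exp2id n) _; nia.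
  by split=> //; have := bitlen_le h; nia.
- exists g.+2 => Z L s Z1 bL b0 /= /(IH _ _ _ Z1 bL b0)[h1 h2].
  have h : s a (eval s (texpr e)) < 2 ^ (L + g.+2 * Z) by apply: mono (bL _ _) _; nia.
  by split=> //; have := bitlen_le h; nia.
- exists (g1 + g2 + 2) => Z L s Z1 bL b0 /= /andP[].
  move=> /(IH1 _ _ _ Z1 bL b0)[h1 t1] /(IH2 _ _ _ Z1 bL b0)[h2 t2].
  have h : eval s (texpr e1) + eval s (texpr e2) < 2 ^ (L + (g1 + g2 + 2) * Z).
    have m1 := mono _ _ (L + (g1 + g2) * Z) h1 ltac:(nia).
    have m2 := mono _ _ (L + (g1 + g2) * Z) h2 ltac:(nia).
    apply: (@mono _ (L + (g1 + g2) * Z).+1); last by nia.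
    by rewrite expnS; lia.
  by split=> //; have := bitlen_le h; nia.
- exists (g1 + g2 + 2) => Z L s Z1 bL b0 /= /andP[].
  move=> /(IH1 _ _ _ Z1 bL b0)[h1 t1] /(IH2 _ _ _ Z1 bL b0)[h2 t2].
  have h : eval s (texpr e1) - eval s (texpr e2) < 2 ^ (L + (g1 + g2 + 2) * Z).
    apply: leq_ltn_trans (leq_subr _ _) _; apply: mono h1 _; nia.
  by split=> //; have := bitlen_le h; nia.
- exists (g1 + g2 + 2) => Z L s Z1 bL b0 /= /andP[].
  move=> /(IH1 _ _ _ Z1 bL b0)[h1 t1] /(IH2 _ _ _ Z1 bL b0)[h2 t2].
  have h : eval s (texpr e1) %/ eval s (texpr e2) < 2 ^ (L + (g1 + g2 + 2) * Z).
    apply: leq_ltn_trans (leq_div _ _) _; apply: mono h1 _; nia.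
  by split=> //; have := bitlen_le h; nia.
- exists (bsize b).+2 => Z L s Z1 bL b0 /= /bexpr_bound[h1 h2]; split.
    apply: leq_ltn_trans h1 _; apply: mono (ltn_exp2id Z) _; nia.
  by apply: leq_trans h2 _; nia.
- exists (g + bsize b + 2) => Z L s Z1 bL b0 /= /andP[].
  move=> /(IH _ _ _ Z1 bL b0)[h1 t1] /bexpr_bound[h2 t2].
  have h : eval s (texpr e) * eval s (bexpr b) < 2 ^ (L + (g + bsize b + 2) * Z).
    apply: (@mono _ (L + g * Z + Z)); last by nia.
    rewrite expnD; apply: ltn_mul => //.
    by apply: leq_ltn_trans h2 (ltn_exp2id _).
  split=> //; have := bitlen_le h; nia.
- exists (g1 + g2 + 2) => Z L s Z1 bL b0 /= /andP[].
  move=> /(IH1 _ _ _ Z1 bL b0)[h1 t1] /(IH2 _ _ _ Z1 bL b0)[h2 t2].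
  have hs := b0 (eval s (texpr e2)).
  have h : eval s (texpr e1) * s 0 (eval s (texpr e2)) < 2 ^ (L + (g1 + g2 + 2) * Z).
    apply: (@mono _ (L + g1 * Z + Z)); last by nia.
    by rewrite expnD; apply: ltn_mul.
  have hb := bitlen_le hs.
  split=> //; have := bitlen_le h; nia.
Qed.

Lemma bounded_update L L' s a i v :
  bounded L s -> L <= L' -> v < 2 ^ L' -> bounded L' (update s a i v).
Proof.
move=> bL LL hv b j; rewrite /update; case: ifP => // _.
by apply: leq_trans (bL _ _) _; rewrite leq_exp2l.
Qed.

Lemma bounded_leq L L' s : bounded L s -> L <= L' -> bounded L' s.
Proof. by move=> bL LL a i; apply: leq_trans (bL _ _) _; rewrite leq_exp2l. Qed.

Lemma const_leq_exp c Z : 1 < Z -> c <= Z ^ c.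
Proof. by move=> Z1; apply/ltnW/ltn_expl. Qed.

(** The added length [Z ^ d] is free of [L], which makes the property stable under loops: [Z]
    iterations add at most [Z * Z ^ d] bits, where a factor on [L] would grow exponentially. *)
Definition halts_in (c : stmt) (d : nat) := forall Z L s, 1 < Z -> bounded L s ->
  (forall i, s 0 i < 2 ^ Z) -> sok Z c s ->
  exists t, [/\ exec (code c) s t (run c s), t <= L.+1 * Z ^ d
    & bounded (L + Z ^ d) (run c s)].

Lemma halts_in_leq c d d' : d <= d' -> halts_in c d -> halts_in c d'.
Proof.
move=> dd hc Z L s Z1 bL b0 ok; have [t [ex ht hb]] := hc Z L s Z1 bL b0 ok.
have hZ : Z ^ d <= Z ^ d' by rewrite leq_exp2l.
exists t; split=> //; first by apply: leq_trans ht _; rewrite leq_mul2l hZ orbT.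
by apply: bounded_leq hb _; rewrite leq_add2l.
Qed.

(** Constants are absorbed into the exponent, since [g <= Z ^ g] for [Z] at least 2. *)
Lemma quad_leq g L Z : 1 < Z -> g * (L + g * Z).+1 <= L.+1 * Z ^ (g + g + 2).
Proof.
move=> Z1; have h := const_leq_exp g Z1.
rewrite !expnD expnS expn1.
have h2 : 0 < Z ^ g by rewrite expn_gt0; lia.
move: (Z ^ g) h h2 => q h h2.
have : g * (L + g * Z).+1 <= q * (L + q * Z).+1.
  by apply: leq_mul => //; rewrite ltnS leq_add2l leq_mul2r h orbT.
move/leq_trans; apply.
have h3 : (L + q * Z).+1 <= L.+1 * (q * (Z * Z)).
  have p1 : 0 < q * Z by nia.
  have -> : L.+1 * (q * (Z * Z)) = L.+1 * (q * Z) * Z by lia.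
  move: (q * Z) p1 => p p1; have : L.+1 * p * 2 <= L.+1 * p * Z by rewrite leq_mul2l Z1 orbT.
  nia.
by apply: leq_trans (leq_mul (leqnn q) h3) _; lia.
Qed.

Lemma halts_SSet a e1 e2 : exists d, halts_in (SSet a e1 e2) d.
Proof.
have [g1 H1] := texpr_bound e1; have [g2 H2] := texpr_bound e2.
pose g := g1 + g2 + 1; exists (g + g + 2) => Z L s Z1 bL b0 /= /andP[ok1 ok2].
have [v1 t1] := H1 _ _ _ Z1 bL b0 ok1; have [v2 t2] := H2 _ _ _ Z1 bL b0 ok2.
eexists; split; first by constructor.
  apply: leq_trans _ (quad_leq g L Z1); rewrite /g; nia.
have hZ : g * Z <= Z ^ (g + g + 2).
  have h := const_leq_exp g Z1.
  apply: leq_trans (leq_mul h (leqnn Z)) _; rewrite -expnSr leq_exp2l //; lia.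
apply: bounded_update bL _ _; first by rewrite leq_addr.
apply: leq_trans v2 _; rewrite leq_exp2l // leq_add2l; apply: leq_trans hZ.
by rewrite leq_mul2r /g; apply/orP; right; lia.
Qed.

Lemma halts_SSeq c1 c2 d1 d2 : wf c1 ->
  halts_in c1 d1 -> halts_in c2 d2 -> halts_in (SSeq c1 c2) (d1 + d2 + 2).
Proof.
move=> w1 H1 H2 Z L s Z1 bL b0 /= /andP[ok1 ok2].
have [t1 [e1 l1 b1]] := H1 _ _ _ Z1 bL b0 ok1.
have fr i : run c1 s 0 i = s 0 i by apply: run_frame; apply: wf_wr0.
have b0' i : run c1 s 0 i < 2 ^ Z by rewrite fr.
have ok2' : sok Z c2 (run c1 s) by rewrite (@sok_ext _ _ _ s).
have [t2 [e2 l2 b2]] := H2 _ _ _ Z1 b1 b0' ok2'.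
have h1 : 0 < Z ^ d1 by rewrite expn_gt0; lia.
have h2 : 0 < Z ^ d2 by rewrite expn_gt0; lia.
rewrite !expnD expnS expn1; move: (Z ^ d1) (Z ^ d2) h1 h2 l1 l2 b1 b2 => p q h1 h2 l1 l2 b1 b2.
have h4 : 4 * (p * q) <= p * q * (Z * Z).
  by rewrite mulnC leq_mul2l; apply/orP; right; nia.
have h5 : p <= p * q by nia.
have h6 : q <= p * q by nia.
exists (t1 + t2); split; first by econstructor; eauto.
  apply: (@leq_trans (L.+1 * (4 * (p * q)))); last by rewrite leq_mul2l h4 orbT.
  apply: leq_trans (leq_add l1 l2) _; nia.
by apply: bounded_leq b2 _; nia.
Qed.

Lemma halts_SIf e c1 c2 d1 d2 :
  halts_in c1 d1 -> halts_in c2 d2 -> exists d, halts_in (SIf e c1 c2) d.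
Proof.
move=> H1 H2; have [g He] := texpr_bound e.
pose d := d1 + d2 + (g + g + 2); exists d.+2 => Z L s Z1 bL b0 /= /and3P[ok ok1 ok2].
have [_ te] := He _ _ _ Z1 bL b0 ok.
have H1' : halts_in c1 d by apply: halts_in_leq H1; rewrite /d; lia.
have H2' : halts_in c2 d by apply: halts_in_leq H2; rewrite /d; lia.
have te' : eval_time s (texpr e) <= L.+1 * Z ^ d.
  apply: leq_trans te _; apply: leq_trans (quad_leq g L Z1) _.
  by rewrite leq_mul2l leq_exp2l //= /d; lia.
have hq : 0 < Z ^ d by rewrite expn_gt0; lia.
have [t [ex lt bt]] : exists t, [/\ exec (if eval s (texpr e) != 0 then code c1 else code c2) s t
    (if eval s (texpr e) != 0 then run c1 s else run c2 s), t <= L.+1 * Z ^ d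
    & bounded (L + Z ^ d) (if eval s (texpr e) != 0 then run c1 s else run c2 s)].
  by case: ifP => _; [apply: H1' | apply: H2'].
exists (eval_time s (texpr e) + t).+1; split; first by constructor.
  have -> : L.+1 * Z ^ d.+2 = L.+1 * Z ^ d * (Z * Z) by rewrite !expnS; lia.
  have : 0 < L.+1 * Z ^ d by rewrite muln_gt0.
  move: (L.+1 * Z ^ d) te' lt => A a1 a2 A0.
  have : A * 4 <= A * (Z * Z) by rewrite leq_mul2l; apply/orP; right; nia.
  lia.
by apply: bounded_leq bt _; rewrite leq_add2l leq_exp2l //; lia.
Qed.

Lemma iter_incr_var v c n s : ~~ wr c v -> s v 0 = 0 ->
  iter n (fun s' => incr_at v (run c s')) s v 0 = n.
Proof.
move=> hv s0; elim: n => [|n IH] //=.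
by rewrite /incr_at /update !eqxx /= run_frame // IH addn1.
Qed.

Lemma halts_SFor v b c d : wf (SFor v b c) -> halts_in c d ->
  exists d', halts_in (SFor v b c) d'.
Proof.
move=> /= /and3P[v0 hv wc] Hc.
have [d1 Hi] := halts_SSet v (TC 0) (TAdd (TG v (TC 0)) (TC 1)).
have Hb := halts_SSeq wc Hc Hi; set d2 := d + d1 + 2 in Hb.
have [g He] := texpr_bound (TSub (TB b) (TG v (TC 0))).
pose D := d2 + (g + g + 2).
have {}Hb : halts_in (SSeq c (incr_var v)) D by apply: halts_in_leq Hb; rewrite /D; lia.
exists (D + D + 6) => Z L s Z1 bL b0 /= /andP[okb okc].
set f := fun s' => incr_at v (run c s'); set s0 := update s v 0 0; set N := bval b s.
have NZ : N <= Z by have [] := bexpr_bound okb.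
have bL0 : bounded L s0 by apply: bounded_update bL _ _; rewrite ?expn_gt0.
pose q := Z ^ D; have q0 : 0 < q by rewrite expn_gt0; lia.
have z0 i j : iter j f s0 0 i = s 0 i.
  elim: j => [|j IH] /=; rewrite /f /s0 /incr_at /update eq_sym (negPf v0) //=.
  by rewrite run_frame ?wf_wr0.
have vj j : iter j f s0 v 0 = j by apply: iter_incr_var => //; rewrite /s0 /update !eqxx.
(* After [j] iterations values have at most [L + j * q] bits; the next run of the body takes this
   length in the role of [L]. *)
have inv j : bounded (L + j * q) (iter j f s0) /\
    exists t, [/\ exec (Seq (code c) (code (incr_var v))) (iter j f s0) t (iter j.+1 f s0),
      t <= (L + j * q).+1 * q & bounded (L + j.+1 * q) (iter j.+1 f s0)].
  have step k : bounded (L + k * q) (iter k f s0) ->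
      exists t, [/\ exec (Seq (code c) (code (incr_var v))) (iter k f s0) t (iter k.+1 f s0),
      t <= (L + k * q).+1 * q & bounded (L + k.+1 * q) (iter k.+1 f s0)].
    move=> bk.
    have [||t [ex lt bt]] := Hb Z (L + k * q) (iter k f s0) Z1 bk.
    - by move=> i; rewrite z0.
    - by rewrite /= (@sok_ext _ _ _ s) // okc.
    exists t; split=> //; first by apply: bounded_leq bt _; rewrite -/q; lia.
  have bnd_iter : bounded (L + j * q) (iter j f s0).
    elim: j => [|j /step[t [_ _ //]]]; by rewrite mul0n addn0.
  by split=> //; apply: step.
(* One test and one body each cost at most [(L + N * q).+1 * q], the length being taken at its final
   value; the extra 1 is the overhead of [While]. *)
pose T := (L + N * q).+1 * q * 2 + 1.
have loop j : j <= N -> exists t, exec (While (texpr (TSub (TB b) (TG v (TC 0))))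
     (Seq (code c) (code (incr_var v)))) (iter (N - j) f s0) t (iter N f s0) /\ t <= j.+1 * T.
  have tst k : k <= N -> eval (iter k f s0) (texpr (TSub (TB b) (TG v (TC 0)))) = N - k /\
      eval_time (iter k f s0) (texpr (TSub (TB b) (TG v (TC 0)))) <= (L + N * q).+1 * q.
    move=> kN; split.
      by rewrite /= vj; congr (_ - _); apply: (@eval_bexpr_ext b _ s).
    have bk : bounded (L + N * q) (iter k f s0).
      by apply: bounded_leq (inv k).1 _; nia.
    have [||_] := He Z _ _ Z1 bk.
    - by move=> i; rewrite z0.
    - by rewrite /= (@bok_ext _ _ _ s) // okb.
    move/leq_trans; apply; apply: leq_trans (quad_leq g _ Z1) _.
    by rewrite leq_mul2l leq_exp2l // /D; lia.
  elim: j => [|j IH] jN.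
    have [ev tv] := tst N (leqnn N); rewrite subn0.
    eexists; split; first by apply: exec_While_stop; rewrite ev subnn.
    rewrite /T; lia.
  have [ev tv] := tst (N - j.+1) (leq_subr _ _).
  have [t2 [ex2 l2]] := IH (ltnW jN).
  have [_ [t1 [ex1 l1 _]]] := inv (N - j.+1).
  eexists; split.
    apply: exec_While_step; first by rewrite ev; lia.
      exact: ex1.
    by rewrite -subSn // subSS; exact: ex2.
  have : (L + (N - j.+1) * q).+1 * q <= (L + N * q).+1 * q.
    by rewrite leq_mul2r ltnS leq_add2l leq_mul2r leq_subr !orbT.
  rewrite /T; lia.
have [t [ex lt]] := loop N (leqnn N).
rewrite subnn in ex.

eexists; split; first by econstructor; [constructor | exact: ex].
  have -> : eval_time s (Const 0) = 1 by rewrite /= /bitlen trunc_log0.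
  have hT : T <= L.+1 * (q * q) * Z * 5.
    have h1 : (L + N * q).+1 <= L.+1 * (q * Z) * 1 + L.+1 by nia.
    have h2 : L.+1 <= L.+1 * (q * Z) by nia.
    have -> : L.+1 * (q * q) * Z * 5 = 5 * (L.+1 * (q * Z)) * q by lia.
    rewrite /T; move: (L + N * q).+1 (L.+1 * (q * Z)) h1 h2 => A C h1 h2.
    have h3 : A * q <= (C * q) * 2 by rewrite mulnAC leq_mul2r; apply/orP; right; lia.
    have : 0 < C * q by rewrite muln_gt0 q0 andbT; lia.
    lia.
  have -> : Z ^ (D + D + 6) = q * q * Z * (Z ^ 5) by rewrite /q !expnD (expnS Z 5) ; lia.
  have Z5 : 15 <= Z ^ 4 by apply: (@leq_trans (2 ^ 4)); rewrite // leq_exp2r.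
  rewrite (expnS Z 4); move: (Z ^ 4) Z5 => z4 Z5.
  have : t <= Z.+1 * (L.+1 * (q * q) * Z * 5).
    by apply: leq_trans lt _; apply: leq_mul; lia.
  have : 0 < L.+1 * (q * q) * Z by nia.
  have -> : L.+1 * (q * q * Z * (Z * z4)) = (L.+1 * (q * q) * Z) * (Z * z4) by lia.
  move: (L.+1 * (q * q) * Z) => C C0 tC.
  have : C * (Z * 15) <= C * (Z * z4) by rewrite !leq_mul2l Z5 !orbT.
  nia.
apply: bounded_leq (inv N).1 _; rewrite leq_add2l.
have -> : Z ^ (D + D + 6) = q * Z * (Z ^ (D + 5)).
  by rewrite /q -expnSr -expnD; congr (_ ^ _); lia.
have : 0 < Z ^ (D + 5) by rewrite expn_gt0; lia.
move: (Z ^ (D + 5)) => z z1; rewrite -mulnA (mulnC N) leq_mul2l; apply/orP; right; nia.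
Qed.

Lemma halts_stmt c : wf c -> exists d, halts_in c d.
Proof.
elim: c => [a e1 e2|c1 IH1 c2 IH2|e c1 IH1 c2 IH2|v b c IH] /=.
- by move=> _; apply: halts_SSet.
- case/andP=> w1 /IH2[d2 h2]; have [d1 h1] := IH1 w1.
  by exists (d1 + d2 + 2); apply: halts_SSeq.
- by case/andP=> /IH1[d1 h1] /IH2[d2 h2]; apply: halts_SIf h1 h2.
- by move=> w; case/and3P: (w) => _ _ /IH[d h]; apply: halts_SFor h.
Qed.

(** * A language with sums and parallel assignments *)

Inductive aop := OAdd | OSub | ODiv.

Definition aop_fun (o : aop) : nat -> nat -> nat :=
  match o with OAdd => addn | OSub => subn | ODiv => divn end.

(** Variables live in an environment outside the store, so that specifications of programs need not
    mention registers or counters. *)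
Inductive rx :=
  | XN of nat
  | XV of nat
  | XG of nat & rx
  | XOp of aop & rx & rx
  | XMB of rx & bnd
  | XMI of rx & rx
  | XIf of rx & rx & rx
  | XS of nat & bnd & rx.

Definition upd (env : nat -> nat) (x i : nat) : nat -> nat :=
  fun y => if y == x then i else env y.

Fixpoint ev (env : nat -> nat) (s : store) (e : rx) : nat :=
  match e with
  | XN n => n
  | XV x => env x
  | XG a e => s a (ev env s e)
  | XOp o e1 e2 => aop_fun o (ev env s e1) (ev env s e2)
  | XMB e b => ev env s e * bval b s
  | XMI e i => ev env s e * s 0 (ev env s i)
  | XIf e1 e2 e3 => if ev env s e1 != 0 then ev env s e2 else ev env s e3
  | XS x b e => \sum_(i < bval b s) ev (upd env x i) s e
  end.

Inductive rs :=
  | RSet of nat & rx & rx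
  | RPar of nat & nat & bnd & rx
  | RSeq of rs & rs
  | RIf of rx & rs & rs
  | RRep of nat & bnd & rs
  | RSkip.

Fixpoint rrun (env : nat -> nat) (c : rs) (s : store) : store :=
  match c with
  | RSet a e1 e2 => update s a (ev env s e1) (ev env s e2)
  | RPar x a b e =>
      fun a' j => if (a' == a) && (j < bval b s) then ev (upd env x j) s e else s a' j
  | RSeq c1 c2 => rrun env c2 (rrun env c1 s)
  | RIf e c1 c2 => if ev env s e != 0 then rrun env c1 s else rrun env c2 s
  | RRep x b c => iteri (bval b s) (fun i => rrun (upd env x i) c) s
  | RSkip => s
  end.

(* Arrays below [nuser] belong to the program; those above hold a buffer, the
   loop variables and the intermediate values of expressions. *)
Definition nuser := 60.
Definition tmpA := nuser.
Definition regV x := nuser.+1 + x.*2.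
Definition regT d := nuser.+2 + d.*2.

Fixpoint wfx (G : seq nat) (e : rx) : bool :=
  match e with
  | XN _ => true
  | XV x => x \in G
  | XG a e => (a < nuser) && wfx G e
  | XOp _ e1 e2 | XMI e1 e2 => wfx G e1 && wfx G e2
  | XMB e _ => wfx G e
  | XIf e1 e2 e3 => [&& wfx G e1, wfx G e2 & wfx G e3]
  | XS x _ e => (x \notin G) && wfx (x :: G) e
  end.

Fixpoint wfs (G : seq nat) (c : rs) : bool :=
  match c with
  | RSet a e1 e2 => [&& 0 < a, a < nuser, wfx G e1 & wfx G e2]
  | RPar x a _ e => [&& 0 < a, a < nuser, x \notin G & wfx (x :: G) e]
  | RSeq c1 c2 => wfs G c1 && wfs G c2
  | RIf e c1 c2 => [&& wfx G e, wfs G c1 & wfs G c2]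
  | RRep x _ c => (x \notin G) && wfs (x :: G) c
  | RSkip => true
  end.

Fixpoint rwr (c : rs) (a : nat) : bool :=
  match c with
  | RSet b _ _ | RPar _ b _ _ => a == b
  | RSeq c1 c2 | RIf _ c1 c2 => rwr c1 a || rwr c2 a
  | RRep _ _ c => rwr c a
  | RSkip => false
  end.

Lemma rframe env c s a i : ~~ rwr c a -> rrun env c s a i = s a i.
Proof.
elim: c env s => [b e1 e2|x b bd e|c1 IH1 c2 IH2|e c1 IH1 c2 IH2|x b c IH|] env s /=.
- by rewrite /update; case: eqP => // ->.
- by case: eqP.
- by rewrite negb_or => /andP[h1 h2]; rewrite IH2 // IH1.
- by rewrite negb_or => /andP[h1 h2]; case: ifP; rewrite ?IH1 ?IH2.
- by move=> h; elim: (bval b s) => [|n IHn] //=; rewrite IH.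
- by [].
Qed.

Lemma rep_ind (Inv : nat -> store -> Prop) env x b c s : Inv 0 s ->
  (forall i s', i < bval b s -> Inv i s' -> Inv i.+1 (rrun (upd env x i) c s')) ->
  Inv (bval b s) (rrun env (RRep x b c) s).
Proof.
move=> I0 IS /=; have: bval b s <= bval b s by [].
elim: {1 3 4}(bval b s) => [|n IH] //= h; apply: IS => //.
by apply: IH; apply: ltnW.
Qed.

Definition reg r := TG r (TC 0).
Definition setreg r e := SSet r (TC 0) e.

(** Stack discipline: the value ends in register [regT d], and registers of depth below [d] survive,
    so a second operand is compiled at depth [d.+1]. *)
Fixpoint cx (d : nat) (e : rx) : stmt :=
  match e with
  | XN n => setreg (regT d) (TC n)
  | XV x => setreg (regT d) (reg (regV x))
  | XG a e => SSeq (cx d e) (setreg (regT d) (TG a (reg (regT d))))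
  | XOp o e1 e2 => SSeq (SSeq (cx d e1) (cx d.+1 e2))
      (setreg (regT d) (match o with OAdd => TAdd | OSub => TSub | ODiv => TDiv end
                          (reg (regT d)) (reg (regT d.+1))))
  | XMB e b => SSeq (cx d e) (setreg (regT d) (TMB (reg (regT d)) b))
  | XMI e1 e2 => SSeq (SSeq (cx d e1) (cx d.+1 e2))
      (setreg (regT d) (TMI (reg (regT d)) (reg (regT d.+1))))
  | XIf e1 e2 e3 => SSeq (cx d e1) (SIf (reg (regT d)) (cx d e2) (cx d e3))
  | XS x b e => SSeq (setreg (regT d) (TC 0))
      (SFor (regV x) b (SSeq (cx d.+1 e)
         (setreg (regT d) (TAdd (reg (regT d)) (reg (regT d.+1))))))
  end.

(** A parallel assignment takes two loops, through the buffer [tmpA], because its right-hand sides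
    may read the array that is being assigned. *)
Fixpoint cs (c : rs) : stmt :=
  match c with
  | RSet a e1 e2 => SSeq (SSeq (cx 0 e1) (cx 1 e2)) (SSet a (reg (regT 0)) (reg (regT 1)))
  | RPar x a b e =>
      SSeq (SFor (regV x) b (SSeq (cx 0 e) (SSet tmpA (reg (regV x)) (reg (regT 0)))))
           (SFor (regV x) b (SSet a (reg (regV x)) (TG tmpA (reg (regV x)))))
  | RSeq c1 c2 => SSeq (cs c1) (cs c2)
  | RIf e c1 c2 => SSeq (cx 0 e) (SIf (reg (regT 0)) (cs c1) (cs c2))
  | RRep x b c => SFor (regV x) b (cs c)
  | RSkip => SSet tmpA (TC 0) (TC 0)
  end.

Lemma regTE d d' : (regT d == regT d') = (d == d').
Proof. rewrite /regT; lia. Qed.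
Lemma regVE d d' : (regV d == regV d') = (d == d').
Proof. rewrite /regV; lia. Qed.
Lemma regVT x d : (regV x == regT d) = false.
Proof. rewrite /regV /regT; lia. Qed.

(** Every survival statement about registers follows from this list of what a compiled expression
    may write; [G] holds the loop variables in scope. *)
Lemma wr_cx G d e a : wfx G e -> wr (cx d e) a ->
  (exists2 d', d <= d' & a = regT d') \/ (exists2 x, x \notin G & a = regV x).
Proof.
elim: e G d => [n|x|b e IH|o e1 IH1 e2 IH2|e IH b|e1 IH1 e2 IH2|e1 IH1 e2 IH2 e3 IH3|x b e IH] G d /=.
- by move=> _ /eqP ->; left; exists d.
- by move=> _ /eqP ->; left; exists d.
- by case/andP=> _ /IH h /orP[/h //|/eqP->]; left; exists d.
- case/andP=> /IH1 h1 /IH2 h2 /orP[/orP[/h1 //|/h2]|/eqP->]; last by left; exists d.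
  by case=> [[d' l ->]|]; [left; exists d' => //; apply: ltnW | right].
- by move=> /IH h /orP[/h //|/eqP->]; left; exists d.
- case/andP=> /IH1 h1 /IH2 h2 /orP[/orP[/h1 //|/h2]|/eqP->]; last by left; exists d.
  by case=> [[d' l ->]|]; [left; exists d' => //; apply: ltnW | right].
- by case/and3P=> /IH1 h1 /IH2 h2 /IH3 h3 /or3P[/h1|/h2|/h3].
- case/andP=> xG /IH h /or3P[/eqP->|/eqP->|/orP[/h|/eqP->]]; first by left; exists d.
  + by right; exists x.
  + case=> [[d' l ->]|[y yG ->]]; first by left; exists d' => //; apply: ltnW.
    by right; exists y => //; move: yG; rewrite inE negb_or => /andP[].
  + by left; exists d.
Qed.

Lemma wf_cx G d e : wfx G e -> wf (cx d e).
Proof.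
elim: e G d => [n|x|b e IH|o e1 IH1 e2 IH2|e IH b|e1 IH1 e2 IH2|e1 IH1 e2 IH2 e3 IH3|x b e IH] G d //=.
- by case/andP=> _ /IH ->.
- by case/andP=> /IH1 -> /IH2 ->.
- by move=> /IH ->.
- by case/andP=> /IH1 -> /IH2 ->.
- by case/and3P=> /IH1 -> /IH2 -> /IH3 ->.
- case/andP=> xG we; rewrite (IH (x :: G)) //= regVT orbF !andbT.
  apply/negP => /(wr_cx we)[[d' _ /eqP]|[y]]; first by rewrite regVT.
  by rewrite inE negb_or => /andP[/negPf yx _] /eqP; rewrite regVE eq_sym yx.
Qed.

Definition agree (s s' : store) := forall a i, a < nuser -> s a i = s' a i.

Lemma agree_bval s s' b : agree s s' -> bval b s = bval b s'.
Proof. by move=> h; apply: eval_bexpr_ext => i; apply: h. Qed.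

Lemma ev_agree G env env' s s' e : wfx G e -> agree s s' -> {in G, env =1 env'} ->
  ev env s e = ev env' s' e.
Proof.
move=> + ag; elim: e G env env' => [n|x|b e IH|o e1 IH1 e2 IH2|e IH b|e1 IH1 e2 IH2|e1 IH1 e2 IH2 e3 IH3|x b e IH] G env env' //=.
- by move=> xG h; apply: h.
- by case/andP=> ab /IH h /h ->; apply: ag.
- by case/andP=> /IH1 h1 /IH2 h2 hG; rewrite (h1 _ _ hG) (h2 _ _ hG).
- by move=> /IH h /h ->; rewrite (agree_bval b ag).
- by case/andP=> /IH1 h1 /IH2 h2 hG; rewrite (h1 _ _ hG) (h2 _ _ hG) ag.
- by case/and3P=> /IH1 h1 /IH2 h2 /IH3 h3 hG; rewrite (h1 _ _ hG) (h2 _ _ hG) (h3 _ _ hG).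
- case/andP=> xG /IH h hG; rewrite (agree_bval b ag); apply: eq_bigr => i _.
  apply: h => y; rewrite inE /upd; case: eqP => //= _; exact: hG.
Qed.

Lemma cx_agree G d e s : wfx G e -> agree s (run (cx d e) s).
Proof.
move=> we a i ha; rewrite run_frame //; apply/negP => /(wr_cx we)[[d' _]|[x _]];
  rewrite /regT /regV; lia.
Qed.

Lemma cx_var G d e s x : wfx G e -> x \in G -> run (cx d e) s (regV x) 0 = s (regV x) 0.
Proof.
move=> we xG; rewrite run_frame //; apply/negP => /(wr_cx we)[[d' _ /eqP]|[y yG /eqP]].
  by rewrite regVT.
by rewrite regVE => /eqP E; rewrite -E xG in yG.
Qed.

Lemma cx_reg G d d' e s : wfx G e -> d' < d -> run (cx d e) s (regT d') 0 = s (regT d') 0.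
Proof.
move=> we dd; rewrite run_frame //; apply/negP => /(wr_cx we)[[d2 h /eqP]|[y yG /eqP]].
  by rewrite regTE; lia.
by rewrite eq_sym regVT.
Qed.

Lemma cx_tmp G d e s i : wfx G e -> run (cx d e) s tmpA i = s tmpA i.
Proof.
move=> we; rewrite run_frame //; apply/negP => /(wr_cx we)[[d2 h]|[y yG]];
 rewrite /tmpA /regT /regV; lia.
Qed.

Lemma update_same s a i v : update s a i v a i = v.
Proof. by rewrite /update !eqxx. Qed.

Lemma update_diff s a i v b j : b != a -> update s a i v b j = s b j.
Proof. by rewrite /update => /negPf ->. Qed.

Definition envok (G : seq nat) (env : nat -> nat) (s : store) :=
  {in G, forall x, s (regV x) 0 = env x}.

Lemma envok_cx G env d e s : wfx G e -> envok G env s -> envok G env (run (cx d e) s).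
Proof. by move=> we h x xG; rewrite (cx_var _ _ we) // h. Qed.

(* Invariant rule for compiled loops; [v] counts the iterations. *)
Lemma for_ind (Inv : nat -> store -> Prop) v b c s : ~~ wr c v ->
  Inv 0 (update s v 0 0) ->
  (forall i s', i < bval b s -> s' v 0 = i -> Inv i s' ->
     Inv i.+1 (update (run c s') v 0 i.+1)) ->
  Inv (bval b s) (run (SFor v b c) s).
Proof.
move=> hv I0 IS /=; have: bval b s <= bval b s by [].
elim: {1 3 4}(bval b s) => [|n IH] //= h.
have hn : iter n (fun s' : store => incr_at v (run c s')) (update s v 0 0) v 0 = n.
  by apply: iter_incr_var => //; rewrite update_same.
rewrite {1}/incr_at run_frame // hn addn1.
by apply: IS => //; apply: IH; apply: ltnW.
Qed.

Lemma run_seq c1 c2 s : run (SSeq c1 c2) s = run c2 (run c1 s).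
Proof. by []. Qed.

Lemma notwr_cx x G d e : wfx (x :: G) e -> ~~ wr (cx d e) (regV x).
Proof.
move=> wc; apply/negP => /(wr_cx wc)[[d' _ /eqP]|[y yG /eqP]].
- by rewrite regVT.
- by rewrite regVE => /eqP E; rewrite -E inE eqxx in yG.
Qed.

Lemma cx_ok G env d e s : wfx G e -> envok G env s ->
  run (cx d e) s (regT d) 0 = ev env s e.
Proof.
elim: e G env d s => [n|x|b e IH|o e1 IH1 e2 IH2|e IH b|e1 IH1 e2 IH2|e1 IH1 e2 IH2 e3 IH3|x b e IH] G env d s.
- by move=> _ _ /=; rewrite update_same.
- by move=> /= xG h; rewrite update_same h.
- by move=> /= /andP[ab we] h; rewrite update_same (IH G env) // -(cx_agree d s we).
- move=> /= /andP[w1 w2] h; have h1 := envok_cx d w1 h.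
  have r1 : run (cx d.+1 e2) (run (cx d e1) s) (regT d) 0 = ev env s e1.
    by rewrite (cx_reg _ w2) // (IH1 G env).
  have r2 : run (cx d.+1 e2) (run (cx d e1) s) (regT d.+1) 0 = ev env s e2.
    rewrite (IH2 G env) //; apply: (ev_agree w2) => //.
    by move=> a i ha; rewrite -(cx_agree d s w1).
  by case: o; rewrite update_same /= r1 r2.
- move=> /= we h; rewrite update_same (IH G env) //; congr (_ * _).
  by apply: eval_bexpr_ext => i; rewrite -(cx_agree d s we).
- move=> /= /andP[w1 w2] h; have h1 := envok_cx d w1 h.
  rewrite update_same (cx_reg _ w2) // (IH1 G env) // (IH2 G env) //.
  rewrite (@ev_agree G env env _ s) //; first by rewrite -(cx_agree d.+1 _ w2) // -(cx_agree d _ w1).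
  by move=> a i ha; rewrite -(cx_agree d s w1).
- move=> /= /and3P[w1 w2 w3] h; have h1 := envok_cx d w1 h.
  have ag : agree (run (cx d e1) s) s by move=> a i ha; rewrite -(cx_agree d s w1).
  rewrite (IH1 G env) //; case: ifP => _.
    by rewrite (IH2 G env) //; apply: (ev_agree w2).
  by rewrite (IH3 G env) //; apply: (ev_agree w3).
- move=> wX h; case/andP: (wX) => xG we.
  rewrite [cx d _]/= [ev _ _ _]/=; set body := SSeq _ (setreg _ (TAdd _ _)).
  rewrite run_seq -[run (setreg _ _) s]/(update s (regT d) 0 0); set s1 := update s _ _ _.
  have nwr : ~~ wr body (regV x).
    by rewrite /= negb_or (notwr_cx _ we) regVT.
  have -> : bval b s = bval b s1.
    by apply: eval_bexpr_ext => i; rewrite /s1 update_diff.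
  (* Register [regT d] accumulates the partial sum; it survives the evaluation of the summand at
     depth [d.+1]. *)
  pose Inv i s' := [/\ agree s s', envok G env s' &
    s' (regT d) 0 = \sum_(j < i) ev (upd env x j) s e].
  suff [_ _ ->] : Inv (bval b s1) (run (SFor (regV x) b body) s1) by [].
  have upV v s' : agree s s' -> envok G env s' -> agree s (update s' (regV x) 0 v) /\
       envok G env (update s' (regV x) 0 v).
    move=> ag en; split.
      by move=> a i ha; rewrite update_diff ?ag // /regV; lia.
    move=> y yG; rewrite update_diff ?en // regVE; apply: contraNneq xG => <- //.
  apply: for_ind => //.
    have ag1 : agree s s1 by move=> a i ha; rewrite /s1 update_diff // /regT; lia.
    have en1 : envok G env s1 by move=> y yG; rewrite /s1 update_diff ?regVT // h.
    have [ag2 en2] := upV 0 _ ag1 en1; split=> //.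
    by rewrite big_ord0 update_diff ?/s1 ?update_same // eq_sym regVT.
  move=> i s' _ vi [ag en sm].
  have we' : wfx (x :: G) e by [].
  have en' : envok (x :: G) (upd env x i) s'.
    move=> y; rewrite inE /upd; case: eqP => [->|_] //=; exact: en.
  have agr : agree s (run (cx d.+1 e) s') by move=> a j ha; rewrite -(cx_agree d.+1 _ we') ?ag.
  rewrite [run body s']/=; set s2 := run (cx d.+1 e) s'.
  have ag3 : agree s (update s2 (regT d) 0 (s2 (regT d) 0 + s2 (regT d.+1) 0)).
    by move=> a j ha; rewrite update_diff ?agr // /regT; lia.
  have en3 : envok G env (update s2 (regT d) 0 (s2 (regT d) 0 + s2 (regT d.+1) 0)).
    move=> y yG; rewrite update_diff ?regVT // /s2 (cx_var _ _ we') ?en //.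
    by rewrite inE yG orbT.
  have [ag4 en4] := upV i.+1 _ ag3 en3; split=> //.
  rewrite update_diff ?update_same; last by rewrite eq_sym regVT.
  rewrite big_ord_recr /= /s2 (cx_reg _ we') // sm; congr (_ + _).
  by rewrite (IH (x :: G) (upd env x i)) //; apply: (ev_agree we') => // a j ha; rewrite -ag.
Qed.

Lemma wr_cs G c a : wfs G c -> wr (cs c) a ->
  [\/ exists d, a = regT d, a = tmpA, (exists2 x, x \notin G & a = regV x) | 0 < a < nuser].
Proof.
have hx H d e : wfx H e -> wr (cx d e) a ->
  [\/ exists d, a = regT d, a = tmpA, (exists2 x, x \notin H & a = regV x) | 0 < a < nuser].
  by move=> w /(wr_cx w)[[d' _ ->]|]; [constructor 1; exists d' | constructor 3].
elim: c G => [b e1 e2|x b bd e|c1 IH1 c2 IH2|e c1 IH1 c2 IH2|x b c IH|] G /=.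
- case/and4P=> b0 bn w1 w2 /orP[/orP[/(hx G)|/(hx G)]|/eqP->]; try exact.
  by constructor 4; rewrite b0.
- case/and4P=> b0 bn xG we /orP[/or3P[/eqP->|/(hx (x :: G)) h|/eqP->]|/orP[]/eqP->].
  + by constructor 3; exists x.
  + case: (h we); try by [constructor 1|constructor 2|constructor 4].
    by case=> y; rewrite inE negb_or => /andP[_ yG] ->; constructor 3; exists y.
  + by constructor 2.
  + by constructor 3; exists x.
  + by constructor 4; rewrite b0.
- by case/andP=> /IH1 h1 /IH2 h2 /orP[].
- by case/and3P=> we /IH1 h1 /IH2 h2 /or3P[/(hx G)||]; [apply|..].
- case/andP=> xG /IH h /orP[/eqP->|/h]; first by constructor 3; exists x.
  case; try by [constructor 1|constructor 2|constructor 4].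
  by case=> y; rewrite inE negb_or => /andP[_ yG] ->; constructor 3; exists y.
- by move=> _ /eqP ->; constructor 2.
Qed.

Lemma cs_var G c s x : wfs G c -> x \in G -> run (cs c) s (regV x) 0 = s (regV x) 0.
Proof.
move=> wc xG; rewrite run_frame //; apply/negP => /(wr_cs wc)[[d /eqP]||[y yG /eqP]|].
- by rewrite regVT.
- rewrite /regV /tmpA; lia.
- by rewrite regVE => /eqP E; rewrite -E xG in yG.
- rewrite /regV; lia.
Qed.

Lemma notwr_cs x G c : wfs (x :: G) c -> ~~ wr (cs c) (regV x).
Proof.
move=> wc; apply/negP => /(wr_cs wc)[[d /eqP]||[y yG /eqP]|].
- by rewrite regVT.
- rewrite /regV /tmpA; lia.
- by rewrite regVE => /eqP E; rewrite -E inE eqxx in yG.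
- rewrite /regV; lia.
Qed.

Lemma wf_cs G c : wfs G c -> wf (cs c).
Proof.
elim: c G => [b e1 e2|x b bd e|c1 IH1 c2 IH2|e c1 IH1 c2 IH2|x b c IH|] G /=.
- by case/and4P=> b0 bn w1 w2; rewrite (wf_cx 0 w1) (wf_cx 1 w2) -lt0n b0.
- case/and4P=> b0 bn xG we; rewrite (wf_cx 0 we) -lt0n b0 (negPf (notwr_cx 0 we)) /=.
  by rewrite !andbT; move: bn; rewrite /regV /tmpA; lia.
- by case/andP=> /IH1 -> /IH2 ->.
- by case/and3P=> we /IH1 -> /IH2 ->; rewrite (wf_cx 0 we).
- by case/andP=> xG wc; rewrite (notwr_cs wc) (IH _ wc).
- by [].
Qed.

(** A simulation on the user arrays only: the compiled program leaves its buffer, counters and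
    temporaries behind in the others. *)
Lemma cs_ok G env c s s2 : wfs G c -> envok G env s -> agree s s2 ->
  agree (run (cs c) s) (rrun env c s2).
Proof.
elim: c G env s s2 => [b e1 e2|x b bd e|c1 IH1 c2 IH2|e c1 IH1 c2 IH2|x b c IH|] G env s s2.
- move=> /= /and4P[b0 bn w1 w2] h ag; have h1 := envok_cx 0 w1 h.
  have ag1 : agree (run (cx 0 e1) s) s by move=> a i ha; rewrite -(cx_agree 0 s w1).
  have r1 : run (cx 1 e2) (run (cx 0 e1) s) (regT 0) 0 = ev env s2 e1.
    by rewrite (cx_reg _ w2) // (cx_ok 0 w1 h); apply: (ev_agree w1).
  have r2 : run (cx 1 e2) (run (cx 0 e1) s) (regT 1) 0 = ev env s2 e2.
    rewrite (cx_ok 1 w2 h1); apply: (ev_agree w2) => // a i ha.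
    by rewrite ag1 // ag.
  move=> a i ha; rewrite r1 r2 /update; case: ifP => // _.
  by rewrite -(cx_agree 1 _ w2) // -(cx_agree 0 _ w1) // ag.
- move=> wc h ag; case/and4P: (wc) => b0 bn xG we; rewrite [cs _]/=.
  rewrite run_seq [rrun _ _ _]/=.
  set body1 := SSeq (cx 0 e) _; set s1 := run (SFor (regV x) bd body1) s.
  have upV v s' : agree s s' -> envok G env s' -> agree s (update s' (regV x) 0 v) /\
       envok G env (update s' (regV x) 0 v).
    move=> ag' en; split.
      by move=> a i ha; rewrite update_diff ?ag' // /regV; lia.
    move=> y yG; rewrite update_diff ?en // regVE; apply: contraNneq xG => <- //.
  have [A1 T1] : agree s s1 /\ (forall j, j < bval bd s -> s1 tmpA j = ev (upd env x j) s e).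
    pose Inv i s' := [/\ agree s s', envok G env s' &
      forall j, j < i -> s' tmpA j = ev (upd env x j) s e].
    suff [] : Inv (bval bd s) s1 by [].
    apply: for_ind.
    - by rewrite /= (negPf (notwr_cx 0 we)) /= /regV /tmpA; lia.
    - by have [? ?] := upV 0 s (fun _ _ _ => erefl) h; split.
    move=> i s' _ vi [ag' en sm] /=; set s3 := run (cx 0 e) s'.
    have en' : envok (x :: G) (upd env x i) s'.
      move=> y; rewrite inE /upd; case: eqP => [->|_] //=; exact: en.
    have vx : s3 (regV x) 0 = i by rewrite /s3 (cx_var _ _ we) ?inE ?eqxx.
    have vt : s3 (regT 0) 0 = ev (upd env x i) s e.
      rewrite /s3 (cx_ok 0 we en'); apply: (ev_agree we) => // a j ha; by rewrite -ag'.
    rewrite vx vt.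
    have ag4 : agree s (update s3 tmpA i (ev (upd env x i) s e)).
      move=> a j ha; rewrite update_diff /s3 -?(cx_agree 0 _ we) ?ag' // /tmpA; lia.
    have en4 : envok G env (update s3 tmpA i (ev (upd env x i) s e)).
      move=> y yG; rewrite update_diff; last by rewrite /tmpA /regV; lia.
      by rewrite /s3 (cx_var _ _ we) ?en // inE yG orbT.
    have [ag5 en5] := upV i.+1 _ ag4 en4; split=> // j; rewrite ltnS leq_eqVlt => hj.
    rewrite update_diff; last by rewrite /tmpA /regV; lia.
    rewrite /update eqxx /=; case: eqP hj => [-> //|_ /= hj].
    by rewrite /s3 (cx_tmp _ _ _ we) sm.
  set body2 := SSet b _ _.
  have be : bval bd s = bval bd s1 by apply: agree_bval.
  (* The second loop copies the buffer, so everything is expressed through [s1], where the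
     right-hand sides have all been evaluated. *)
  pose Inv2 i s' := [/\ forall j, s' tmpA j = s1 tmpA j &
    forall a j, a < nuser -> s' a j = if (a == b) && (j < i) then s1 tmpA j else s1 a j].
  have [_ F] : Inv2 (bval bd s1) (run (SFor (regV x) bd body2) s1).
    apply: for_ind.
    - by rewrite /= /regV; lia.
    - split=> [j|a j ha]; rewrite ?andbF update_diff // /regV /tmpA; lia.
    move=> i s' _ vi [st su] /=; rewrite vi; split=> [j|a j ha].
      rewrite update_diff; last by rewrite /regV /tmpA; lia.
      by rewrite update_diff ?st // /tmpA; lia.
    rewrite update_diff; last by rewrite /regV; lia.
    rewrite /update st su //; have [->|ab] //= := eqVneq a b.
    rewrite ltnS [j <= i]leq_eqVlt; case: (eqVneq j i) => [->|] //=.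
  move=> a i ha; rewrite F // -be -(agree_bval bd ag); case: ifP => [/andP[_ hi]|_].
    by rewrite T1 //; apply: (ev_agree we).
  by rewrite -A1 // ag.
- move=> /= /andP[w1 w2] h ag; apply: (IH2 G) => //; last exact: IH1 G env s s2 w1 h ag.
  by move=> x xG; rewrite (cs_var _ w1) // h.
- move=> /= /and3P[we w1 w2] h ag; rewrite (cx_ok 0 we h) (ev_agree we ag (env' := env)) //.
  have ag' : agree (run (cx 0 e) s) s2 by move=> a i ha; rewrite -(cx_agree 0 s we) ?ag.
  by have h' := envok_cx 0 we h; case: ifP => _; [apply: (IH1 G)|apply: (IH2 G)].
- move=> /= /andP[xG wc] h ag.
  pose Inv i s' := envok G env s' /\ agree s' (iteri i (fun i => rrun (upd env x i) c) s2).
  rewrite -(agree_bval b ag).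
  suff [] : Inv (bval b s) (run (SFor (regV x) b (cs c)) s) by [].
  have upV v s' : envok G env s' -> envok G env (update s' (regV x) 0 v).
    by move=> en y yG; rewrite update_diff ?en // regVE; apply: contraNneq xG => <- //.
  apply: for_ind; first exact: notwr_cs wc.
    split; first exact: upV.
    by move=> a i ha; rewrite update_diff ?ag // /regV; lia.
  move=> i s' _ vi [en ag'].
  have en' : envok (x :: G) (upd env x i) s'.
    move=> y; rewrite inE /upd; case: eqP => [->|_] //=; exact: en.
  split.
    by apply: upV => y yG; rewrite (cs_var _ wc) ?en // inE yG orbT.
  move=> a j ha; rewrite update_diff; last by rewrite /regV; lia.
  exact: (IH (x :: G)).
- by move=> _ _ ag a i ha; rewrite /= update_diff ?ag // /tmpA; lia.
Qed.

(** * Polynomial time *)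

Lemma bok_leq Z Z' b s : Z <= Z' -> bok Z b s -> bok Z' b s.
Proof.
move=> ZZ; elim: b => [n|||b1 IH1 b2 IH2|b1 IH1 b2 IH2] /= /andP[h1].
- by rewrite (leq_trans h1).
- by rewrite (leq_trans h1).
- by rewrite (leq_trans h1).
- by case/andP=> /IH1 -> /IH2 ->; rewrite (leq_trans h1).
- by case/andP=> /IH1 -> /IH2 ->; rewrite (leq_trans h1).
Qed.

Lemma xok_leq Z Z' e s : Z <= Z' -> xok Z e s -> xok Z' e s.
Proof.
move=> ZZ; elim: e => //= [e1 IH1 e2 IH2|e1 IH1 e2 IH2|e1 IH1 e2 IH2|b|e IH b|e1 IH1 e2 IH2].
1-3,6: by case/andP=> /IH1 -> /IH2 ->.
- exact: bok_leq.
- by case/andP=> /IH -> /(bok_leq ZZ).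
Qed.

Lemma sok_leq Z Z' c s : Z <= Z' -> sok Z c s -> sok Z' c s.
Proof.
move=> ZZ; elim: c => /= [a e1 e2|c1 IH1 c2 IH2|e c1 IH1 c2 IH2|v b c IH].
- by case/andP=> /(xok_leq ZZ) -> /(xok_leq ZZ).
- by case/andP=> /IH1 -> /IH2.
- by case/and3P=> /(xok_leq ZZ) -> /IH1 -> /IH2.
- by case/andP=> /(bok_leq ZZ) -> /IH.
Qed.

Definition small S (s : store) := s 0 0 <= S /\ s 0 1 <= S.

Lemma bok_poly b : exists d, forall S s, small S s -> bok (S.+2 ^ d) b s.
Proof.
elim: b => [n|||b1 [d1 IH1] b2 [d2 IH2]|b1 [d1 IH1] b2 [d2 IH2]].
- exists n => S s _ /=; rewrite andbT /bval /=; exact: const_leq_exp.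
- by exists 1 => S s [h _] /=; rewrite andbT /bval /= expn1; apply: leq_trans h _; lia.
- by exists 1 => S s [_ h] /=; rewrite andbT /bval /= expn1; apply: leq_trans h _; lia.
- exists (d1 + d2).+1 => S s sm /=.
  have h1 : S.+2 ^ d1 <= S.+2 ^ (d1 + d2) by rewrite leq_exp2l // leq_addr.
  have h2 : S.+2 ^ d2 <= S.+2 ^ (d1 + d2) by rewrite leq_exp2l // leq_addl.
  have h3 : S.+2 ^ (d1 + d2) <= S.+2 ^ (d1 + d2).+1 by rewrite leq_exp2l.
  rewrite (bok_leq _ (IH1 _ _ sm)) ?(leq_trans h1) // (bok_leq _ (IH2 _ _ sm)) ?(leq_trans h2) //.
  have [v1 _] := bexpr_bound (IH1 _ _ sm); have [v2 _] := bexpr_bound (IH2 _ _ sm).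
  rewrite !andbT /bval /= -/(bval b1 s) -/(bval b2 s) expnS.
  move: (S.+2 ^ (d1 + d2)) (S.+2 ^ d1) (S.+2 ^ d2) h1 h2 v1 v2 => *; nia.
- exists (d1 + d2) => S s sm /=.
  have h1 : S.+2 ^ d1 <= S.+2 ^ (d1 + d2) by rewrite leq_exp2l // leq_addr.
  have h2 : S.+2 ^ d2 <= S.+2 ^ (d1 + d2) by rewrite leq_exp2l // leq_addl.
  rewrite (bok_leq h1 (IH1 _ _ sm)) (bok_leq h2 (IH2 _ _ sm)).
  have [v1 _] := bexpr_bound (IH1 _ _ sm); have [v2 _] := bexpr_bound (IH2 _ _ sm).
  by rewrite !andbT /bval /= -/(bval b1 s) -/(bval b2 s) expnD leq_mul.
Qed.

Lemma ok_join (P Q : nat -> store -> bool) :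
  (forall Z Z' s, Z <= Z' -> P Z s -> P Z' s) -> (forall Z Z' s, Z <= Z' -> Q Z s -> Q Z' s) ->
  (exists d, forall S s, small S s -> P (S.+2 ^ d) s) ->
  (exists d, forall S s, small S s -> Q (S.+2 ^ d) s) ->
  exists d, forall S s, small S s -> P (S.+2 ^ d) s && Q (S.+2 ^ d) s.
Proof.
move=> mP mQ [d1 h1] [d2 h2]; exists (d1 + d2) => S s sm.
rewrite (mP _ _ _ _ (h1 _ _ sm)) ?(mQ _ _ _ _ (h2 _ _ sm)) //.
  by rewrite leq_exp2l // leq_addl.
by rewrite leq_exp2l // leq_addr.
Qed.

Lemma xok_poly e : exists d, forall S s, small S s -> xok (S.+2 ^ d) e s.
Proof.
elim: e => [n|a e IH|e1 IH1 e2 IH2|e1 IH1 e2 IH2|e1 IH1 e2 IH2|b|e IH b|e1 IH1 e2 IH2] /=.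
- by exists 0.
- exact: IH.
1-3,6: by apply: (@ok_join (xok^~ e1) (xok^~ e2)) => // Z Z' s; apply: xok_leq.
- exact: bok_poly.
- apply: (@ok_join (xok^~ e) (bok^~ b)) => //; last exact: bok_poly.
    by move=> Z Z' s; apply: xok_leq.
  by move=> Z Z' s; apply: bok_leq.
Qed.

Lemma sok_poly c : exists d, forall S s, small S s -> sok (S.+2 ^ d) c s.
Proof.
elim: c => /= [a e1 e2|c1 IH1 c2 IH2|e c1 IH1 c2 IH2|v b c IH].
- apply: (@ok_join (xok^~ e1) (xok^~ e2)); try exact: xok_poly.
    by move=> Z Z' s; apply: xok_leq.
  by move=> Z Z' s; apply: xok_leq.
- by apply: (@ok_join (sok^~ c1) (sok^~ c2)) => // Z Z' s; apply: sok_leq.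
- apply: (@ok_join (xok^~ e) (fun Z s => sok Z c1 s && sok Z c2 s)).
  + by move=> Z Z' s; apply: xok_leq.
  + by move=> Z Z' s h /andP[/(sok_leq h) -> /(sok_leq h)].
  + exact: xok_poly.
  + by apply: (@ok_join (sok^~ c1) (sok^~ c2)) => // Z Z' s; apply: sok_leq.
- apply: (@ok_join (bok^~ b) (sok^~ c)) => //; last exact: bok_poly.
    by move=> Z Z' s; apply: bok_leq.
  by move=> Z Z' s; apply: sok_leq.
Qed.

(** The number of vertices is written in binary, so a loop over vertices might be exponential in the
    input size. Connectivity excludes this: with two or more vertices, each one is an end of some
    edge. *)
Lemma connected_card (V E : finType) (nd : E -> V * V) :
  connected nd [set: E] -> #|V| <= 2 * #|E| + 1.
Proof.
move=> conn; have [V1|V1] := leqP #|V| 1; first lia.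
suff: #|V| <= #|{: E * bool}| by rewrite card_prod card_bool; lia.
pose f (x : E * bool) := if x.2 then (nd x.1).1 else (nd x.1).2.
suff fs v : exists x, f x = v.
  rewrite -cardsT; have -> : [set: V] = f @: [set: E * bool].
    apply/setP=> v; rewrite inE; symmetry; apply/imsetP.
    by have [x <-] := fs v; exists x; rewrite ?inE.
  by rewrite -[X in _ <= X]cardsT; apply: leq_imset_card.
have [u uv] : exists u, u != v.
  have : 0 < #|[set~ v]| by rewrite cardsC1; lia.
  by case/card_gt0P=> u; rewrite !inE; exists u.
have /connectP[[|w p] /=] := conn v u; first by move=> _ E0; rewrite E0 eqxx in uv.
case/andP=> /existsP[e /andP[_ /orP[]/eqP h]] _ _.
  by exists (e, true); rewrite /f /= h.
by exists (e, false); rewrite /f /= h.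
Qed.

Lemma encode_entry (I : fgc_instance) i : nth 0 (encode I) i < 2 ^ input_size I.
Proof.
rewrite /input_size; have [h|h] := ltnP i (size (encode I)); last by rewrite nth_default // expn_gt0.
have: bitlen (nth 0 (encode I) i) <= \sum_(x <- encode I) bitlen x.
  by rewrite (big_nth 0) big_mkord (bigD1 (Ordinal h)) //= leq_addr.
move=> hb; have hl := trunc_log_ltn (nth 0 (encode I) i) (isT : 1 < 2).
by apply: leq_trans hl _; rewrite leq_exp2l.
Qed.

Lemma size_encode (I : fgc_instance) : size (encode I) = 2 + 5 * nE I.
Proof.
rewrite /encode /= size_flatten /shape -map_comp /=.
rewrite (eq_map (g := fun=> 5)) // sumnE big_map big_const_seq count_predT size_enum_ord.
by rewrite iter_addn addn0.
Qed.

Lemma input_small (I : fgc_instance) : small (input_size I) (input_store I).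
Proof.
have h : 2 + 5 * nE I <= input_size I.
  rewrite -size_encode -sum1_size; apply: leq_sum => x _; by rewrite /bitlen.
have := connected_card (@ends_connected I); rewrite !card_ord.
by rewrite /small /input_store /=; lia.
Qed.

Definition env0 : nat -> nat := fun=> 0.

Theorem compiled_program (c : rs) : wfs [::] c -> exists A : prog,
  exists cc d : nat, forall I : fgc_instance, exists (t : nat) (s : store),
    [/\ exec A (input_store I) t s, t <= cc * input_size I ^ d + cc &
        forall a i, a < nuser -> s a i = rrun env0 c (input_store I) a i].
Proof.
move=> wc; exists (code (cs c)).
have [d1 hd1] := halts_stmt (wf_cs wc); have [d2 hd2] := sok_poly (cs c).
(* The base 3 comes from [S + 2 <= 3 * S] for positive [S]; when [S] is 0 the additive constant
   alone suffices. *)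
exists (3 ^ ((d2.+1 * d1).+1)), ((d2.+1 * d1).+1) => I.
set S := input_size I; pose Z := S.+2 ^ d2.+1.
have Z1 : 1 < Z by apply: (@leq_trans (S.+2 ^ 1)); rewrite // leq_exp2l.
have b0 : bounded S (input_store I).
  by move=> a i; rewrite /input_store; case: ifP => _; rewrite ?expn_gt0 // encode_entry.
have SZ : S <= Z by apply: (@leq_trans (S.+2 ^ 1)); [rewrite expn1; lia | rewrite leq_exp2l].
have [||t [ex ht _]] := hd1 Z S (input_store I) Z1 b0.
- by move=> i; apply: leq_trans (b0 0 i) _; rewrite leq_exp2l.
- apply: (@sok_leq (S.+2 ^ d2)); first by rewrite leq_exp2l.
  exact/hd2/input_small.
exists t, (run (cs c) (input_store I)); split=> //.
  apply: leq_trans ht _; rewrite /Z -expnM.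
  apply: (@leq_trans (S.+2 ^ (d2.+1 * d1).+1)); first by rewrite expnS leq_mul2r; apply/orP; right; lia.
  set D := (d2.+1 * d1).+1; have [->|S0] := posnP S.
    by apply: leq_trans (leq_addl _ _); rewrite leq_exp2r.
  apply: leq_trans (leq_addr _ _); rewrite -expnMn leq_exp2r //; lia.
by move=> a i ha; apply: (cs_ok wc).
Qed.

(** * Matroids and weighted matroid intersection *)

Section Matroid.

Variable T : finType.
Implicit Types (I J B : {set T}) (x y z t : T).

Record matroid := Matroid {
  indep :> {set T} -> bool;
  indep_sub : forall I J, I \subset J -> indep J -> indep I;
  indep_aug : forall I J, indep I -> indep J -> #|I| < #|J| ->
    exists2 y, y \in J :\: I & indep (y |: I) }.

Definition exch I x y := y |: (I :\ x).

Lemma card_exch I x y : x \in I -> y \notin I -> #|exch I x y| = #|I|.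
Proof.
move=> xI yI; rewrite cardsU1 !inE negb_and yI orbT (cardsD1 x I) xI.
by [].
Qed.

Variable M : matroid.

(** If [y |: (J :\ x)] is independent, it can be augmented from the larger [z |: J]. The new element
    cannot be [x], as this would produce the dependent set [y |: J], so it is [z]. *)
Lemma exch_common J z x y : z \notin J -> x \in J -> y \notin J -> y != z ->
  M (z |: J) -> ~~ M (y |: J) -> M (exch (z |: J) x y) = M (y |: (J :\ x)).
Proof.
move=> zJ xJ yJ yz MK nM; have zx : z != x by apply: contraNneq zJ => ->.
have eE : exch (z |: J) x y = z |: (y |: (J :\ x)).
  apply/setP=> t; rewrite !inE.
  by case: (eqVneq t z) => [->|tz] //=; rewrite zx orbT.
apply/idP/idP => h; first by apply: indep_sub h; rewrite eE subsetU1.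
have [|w] := indep_aug h MK.
  by rewrite !cardsU1 !inE (negPf zJ) (negPf yJ) andbF /= (cardsD1 x J) xJ.
rewrite !inE negb_or negb_and negbK => /andP[/andP[wy /orP[/eqP wx|wJ]]].
  rewrite wx => _ h2; case/negP: nM; apply: indep_sub h2.
  apply/subsetP=> t; rewrite !inE; case: (eqVneq t x) => //= _.
case/orP=> [/eqP -> |wJ2]; last by rewrite wJ2 in wJ.
by rewrite eE.
Qed.

(** By [exch_common] both exchanges amount to the same condition on [J = I :\ x1]. Thus the swap
    [(x1, y1)] does not affect whether [(x, y)] is possible, as long as [y] could not replace
    [x1]. *)
Lemma exch_after I x1 y1 x y : M I -> x1 \in I -> y1 \notin I -> M (exch I x1 y1) ->
  y \notin I -> y != y1 -> ~~ M (exch I x1 y) -> x \in I -> x != x1 ->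
  M (exch (exch I x1 y1) x y) = M (exch I x y).
Proof.
move=> MI x1I y1I M1 yI yy1 nM xI xx1.
have xJ : x \in I :\ x1 by rewrite !inE xx1.
have yJ : y \notin I :\ x1 by rewrite !inE negb_and yI orbT.
have e1 : M (exch (exch I x1 y1) x y) = M (y |: (I :\ x1 :\ x)).
  by apply: exch_common => //; rewrite !inE negb_and y1I orbT.
rewrite e1; symmetry; rewrite -{1}(setD1K x1I); apply: exch_common => //.
- by rewrite !inE eqxx.
- by apply: contraNneq yI => ->.
- by rewrite setD1K.
Qed.

Definition exs I (ps : seq (T * T)) := foldl (fun I p => exch I p.1 p.2) I ps.

Definition swapable I (ps : seq (T * T)) :=
  [&& all (fun p => (p.1 \in I) && (p.2 \notin I)) ps, uniq (map fst ps) & uniq (map snd ps)].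

Lemma swapable_cons I p ps : swapable I (p :: ps) -> swapable (exch I p.1 p.2) ps.
Proof.
case/and3P=> /= /andP[_ al] /andP[n1 u1] /andP[n2 u2]; apply/and3P; split=> //.
apply/allP=> q qps; have /andP[q1 q2] := allP al q qps.
rewrite !inE negb_or negb_and q1 q2 !orbT !andbT; apply/andP; split.
  by apply/orP; right; apply: contraNneq n1 => <-; apply: map_f.
by apply: contraNneq n2 => <-; apply: map_f.
Qed.

(** The pairwise hypothesis says that the exchange matrix is triangular. By [exch_after] the first
    swap leaves its other entries unchanged, and the induction goes on with the smaller matrix. *)
Lemma exs_indep ps I : M I -> swapable I ps -> all (fun p => M (exch I p.1 p.2)) ps ->
  pairwise (fun p q => ~~ M (exch I p.1 q.2)) ps -> M (exs I ps).
Proof.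
elim: ps I => //= p ps IH I MI sw /andP[Mp al] /andP[np pw].
have /and3P[/= /andP[/andP[p1 p2] alI] /andP[n1 u1] /andP[n2 u2]] := sw.
have key q q' : q \in ps -> q' \in ps ->
    M (exch (exch I p.1 p.2) q.1 q'.2) = M (exch I q.1 q'.2).
  move=> qps qps'; have /andP[q1 _] := allP alI q qps; have /andP[_ q2] := allP alI q' qps'.
  apply: exch_after => //.
  - by apply: contraNneq n2 => <-; apply: map_f.
  - exact: (allP np).
  - by apply: contraNneq n1 => <-; apply: map_f.
apply: IH => //; first exact: swapable_cons.
  by apply/allP=> q qps; rewrite key // (allP al).
apply: (@sub_in_pairwise _ (mem ps) (fun p q => ~~ M (exch I p.1 q.2))) pw; last by apply/allP.
by move=> q q' qps qps' /=; rewrite key.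
Qed.

Lemma mem_exs ps I z : swapable I ps ->
  (z \in exs I ps) = (z \in I) && (z \notin map fst ps) || (z \in map snd ps).
Proof.
elim: ps I => [|p ps IH] I sw /=; first by rewrite andbT orbF.
rewrite IH ?swapable_cons // !inE.
case/and3P: sw => /= /andP[/andP[p1 p2] alI] /andP[n1 u1] /andP[n2 u2].
have [->|zp] /= := eqVneq z p.2; last by case: (z \in I); case: eqP => //=; rewrite ?andbF.
rewrite orbT; case: (boolP (p.2 \in map fst ps)) => //= /mapP[q qps E].
by have /andP[q1 _] := allP alI q qps; rewrite -E (negPf p2) in q1.
Qed.

Lemma card_exs ps I : swapable I ps -> #|exs I ps| = #|I|.
Proof.
elim: ps I => //= p ps IH I sw; rewrite IH ?swapable_cons // card_exch //.
  by case/and3P: sw => /= /andP[/andP[]].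
by case/and3P: sw => /= /andP[/andP[]].
Qed.

Definition wt (w : T -> int) B : int := (\sum_(t in B) w t)%R.

Lemma wt_exch w B x y : x \in B -> y \notin B -> (wt w (exch B x y) = wt w B - w x + w y)%R.
Proof.
move=> xB yB; rewrite /wt big_setU1 /=; last by rewrite !inE negb_and yB orbT.
by rewrite (big_setD1 x xB) /=; lia.
Qed.

Definition locopt (w : T -> int) B := forall x y, x \in B -> y \notin B -> M (exch B x y) -> (w x <= w y)%R.

(** Let [x] be heaviest in [B :\: B']. Some [y] of [B' :\: B] can replace it in [B], so
    [w x <= w y], and some [z] of [B :\: B'] can replace [y] in [B'], with [w z <= w x]. This last
    exchange moves [B'] towards [B] without increasing its weight. *)
Lemma locopt_min w B B' : M B -> locopt w B -> M B' -> #|B'| = #|B| -> (wt w B <= wt w B')%R.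
Proof.
move=> MB lo; have [n] := ubnP #|B' :\: B|; elim: n B' => // n IH B' hn MB' cB.
have [B0|] := set_0Vmem (B :\: B').
  have -> // : B' = B; apply/esym/eqP; rewrite eqEcard cB leqnn andbT.
  by rewrite -setD_eq0 B0.
case=> x0 x0in.
case: (@arg_maxP _ _ _ x0 (fun t => t \in B :\: B') w x0in) => x /setDP[xB xB'] xmax.
have [||y] := @indep_aug M (B :\ x) B' _ MB'.
- by apply: indep_sub MB; apply: subsetDl.
- by rewrite cB (cardsD1 x B) xB.
rewrite !inE negb_and negbK => /andP[/orP[/eqP->|yB] yB']; first by rewrite yB' in xB'.
move=> /(lo _ _ xB yB) wxy.
have [||z] := @indep_aug M (B' :\ y) B _ MB.
- by apply: indep_sub MB'; apply: subsetDl.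
- by rewrite -cB (cardsD1 y B') yB'.
rewrite !inE negb_and negbK => /andP[/orP[/eqP->|zB'] zB]; first by rewrite zB in yB.
move=> Mz; have wzx : (w z <= w x)%R by apply: xmax; rewrite !inE zB'.
have hlt : #|exch B' y z :\: B| < n.
  rewrite ltnS in hn; apply: leq_trans hn; apply: proper_card; apply/properP; split.
    apply/subsetP=> t; rewrite !inE => /andP[tB /orP[/eqP tz|/andP[_ ->]]]; last by rewrite tB.
    by rewrite tz zB in tB.
  exists y; rewrite !inE ?yB ?yB' //= eqxx /= orbF.
  by apply: contraNneq yB => ->.
have hc : #|exch B' y z| = #|B| by rewrite card_exch.
apply: le_trans (IH _ hlt Mz hc) _.
by rewrite wt_exch // -addrA gerDl addrC subr_le0 (le_trans wzx).
Qed.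

Lemma min_locopt w B : M B ->
  (forall B', M B' -> #|B'| = #|B| -> (wt w B <= wt w B')%R) -> locopt w B.
Proof.
move=> MB mn x y xB yB Me; have := mn _ Me (card_exch xB yB).
by rewrite wt_exch //; lia.
Qed.

(* Sorting the pairs by decreasing weight and then by level makes the exchange
   matrix triangular, so all the swaps can be made at once. *)
Lemma exs_locopt w ps I (lvl : T * T -> nat) : M I -> locopt w I -> swapable I ps ->
  all (fun p => M (exch I p.1 p.2)) ps -> (forall p, p \in ps -> w p.1 = w p.2) ->
  (forall p q, p \in ps -> q \in ps -> p != q -> lvl p <= lvl q -> w p.1 = w q.2 ->
     ~~ M (exch I p.1 q.2)) ->
  M (exs I ps) /\ locopt w (exs I ps).
Proof.
move=> MI lo sw al eqw hl.
pose r (p q : T * T) := (w q.1 < w p.1)%R || (w q.1 == w p.1) && (lvl p <= lvl q).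
have rT : total r by move=> p q; rewrite /r; case: (ltgtP (w p.1) (w q.1)) => //= _; apply: leq_total.
have rTr : transitive r by move=> q p s; rewrite /r; lia.
pose qs := sort r ps.
have mq p : (p \in qs) = (p \in ps) by rewrite mem_sort.
have uqs : uniq qs by rewrite sort_uniq; apply: map_uniq; case/and3P: sw => _ h _; exact: h.
have swq : swapable I qs.
  case/and3P: sw => a1 a2 a3; apply/and3P; split.
  - by apply/allP=> p; rewrite mq; apply: (allP a1).
  - by rewrite (perm_uniq (s2 := map fst ps)) // perm_map // perm_sort.
  - by rewrite (perm_uniq (s2 := map snd ps)) // perm_map // perm_sort.
have E : exs I ps = exs I qs.
  apply/setP=> z; rewrite !mem_exs //; congr (_ && ~~ _ || _).
    by apply: perm_mem; rewrite perm_map // perm_sym perm_sort.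
  by apply: perm_mem; rewrite perm_map // perm_sym perm_sort.
have Mq : M (exs I ps).
  rewrite E; apply: exs_indep => //; first by apply/allP=> p; rewrite mq; apply: (allP al).
  have pr : pairwise r qs by rewrite -sorted_pairwise // sort_sorted.
  have pd : pairwise (fun p q => p != q) qs by rewrite -uniq_pairwise.
  have prd : pairwise [rel p q | r p q && (p != q)] qs by rewrite pairwise_relI pr.
  apply: (@sub_in_pairwise _ (mem ps) [rel p q | r p q && (p != q)]) prd; last first.
    by apply/allP=> p; rewrite mq.
  move=> p q pps qps /= /andP[/orP[lt|/andP[/eqP eqpq hlv]] pq]; last first.
    by apply: (hl p q) => //; rewrite -eqpq eqw.
  (* Exchanging [p.1] for the strictly lighter [q.2] would contradict local optimality; the levels
     matter for equal weights only. *)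
  apply/negP=> h; have /andP[p1 _] : (p.1 \in I) && (p.2 \notin I) by case/and3P: sw => /allP/(_ p pps).
  have /andP[_ q2] : (q.1 \in I) && (q.2 \notin I) by case/and3P: sw => /allP/(_ q qps).
  by have := lo _ _ p1 q2 h; rewrite -(eqw q) // leNgt lt.
(* The two elements of a pair have equal weight, so the total is still minimal, and this gives local
   optimality back. *)
split=> //; apply: min_locopt => // B' MB' cB.
have -> : wt w (exs I ps) = wt w I.
  have cl : forall J, swapable J ps -> wt w (exs J ps) = wt w J.
    elim: ps eqw {al hl sw qs mq uqs swq E Mq cB} => //= p ps IH eqw J sw.
    rewrite IH ?swapable_cons //; last by move=> q qps; apply: eqw; rewrite inE qps orbT.
    case/and3P: sw => /= /andP[/andP[p1 p2] _] _ _.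
    by rewrite wt_exch // (eqw p) ?mem_head //; lia.
  exact: cl.
by apply: locopt_min => //; rewrite cB card_exs.
Qed.

(** An element already in the basis can thus be brought down to its true weight at once. *)
Lemma locopt_lower w w' B e : e \in B -> (forall t, t != e -> w' t = w t) -> (w' e <= w e)%R ->
  locopt w B -> locopt w' B.
Proof.
move=> eB ww we lo x y xB yB Me; have := lo x y xB yB Me.
rewrite (ww y); last by apply: contraNneq yB => ->.
by have [->|xe] := eqVneq x e; [apply: le_trans | rewrite ww].
Qed.

End Matroid.

(** * Weight splittings and the exchange graph of two matroids *)

Section Intersection.

Variables (T : finType) (M1 M2 : matroid T).
Implicit Types (B : {set T}) (w : T -> int) (e x y t u v : T).

(** A weight splitting in the sense of Frank: by [valid_min] it certifies that [B] is optimal for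
    [w1 + w2] among the common independent sets of its size. *)
Definition valid B w1 w2 :=
  [/\ M1 B, M2 B, locopt M1 w1 B & locopt M2 w2 B].

(** Arcs out of [B] stand for exchanges in [M2] and arcs into [B] for exchanges in [M1], so that an
    alternating cycle prescribes one set of swaps for each matroid. The [slack] of an arc is the
    weight lost in its exchange. *)
Definition arc B u v := if u \in B then (v \notin B) && M2 (exch B u v)
                        else (v \in B) && M1 (exch B v u).

Definition slack B w1 w2 u v : int :=
  (if u \in B then w2 v - w2 u else w1 u - w1 v)%R.

Definition tight B w1 w2 u v := arc B u v && (slack B w1 w2 u v == 0%R).

Lemma slack_ge0 B w1 w2 u v : valid B w1 w2 -> arc B u v -> (0 <= slack B w1 w2 u v)%R.
Proof.
case=> m1 m2 l1 l2; rewrite /arc /slack; case: ifP => [uB /andP[vB h]|uB /andP[vB h]].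
  by have := l2 _ _ uB vB h; lia.
by have := l1 _ _ vB (negbT uB) h; lia.
Qed.

Lemma valid_min B w1 w2 B' : valid B w1 w2 -> M1 B' -> M2 B' -> #|B'| = #|B| ->
  (wt (fun t => w1 t + w2 t) B <= wt (fun t => w1 t + w2 t) B')%R.
Proof.
case=> m1 m2 l1 l2 n1 n2 c; rewrite /wt !big_split /=.
by apply: lerD; [apply: (locopt_min m1 l1) | apply: (locopt_min m2 l2)].
Qed.

Lemma valid_lower B w1 w2 w1' e : e \in B -> (forall t, t != e -> w1' t = w1 t) ->
  (w1' e <= w1 e)%R -> valid B w1 w2 -> valid B w1' w2.
Proof. by move=> eB ww we [m1 m2 l1 l2]; split=> //; exact: (locopt_lower eB ww we l1). Qed.

Definition reach B w1 w2 e := [set v | connect (tight B w1 w2) e v].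

(** The basis keeps its size, so an augmentation is a tight cycle through the new element [e], not a
    path from sources to sinks. *)
Definition closing B w1 w2 e := [exists x in reach B w1 w2 e, (x \in B) && tight B w1 w2 x e].

Section Shift.

Variables (B : {set T}) (w1 w2 : T -> int) (e : T) (delta : int).
Hypothesis vB : valid B w1 w2.
Hypothesis eB : e \notin B.
Let R := reach B w1 w2 e.
Definition leaving u v := [&& u \in R, (v \notin R) || (v == e) & arc B u v].
Hypothesis delta0 : (0 <= delta)%R.
Hypothesis deltaP : forall u v, leaving u v -> (delta <= slack B w1 w2 u v)%R.

(** The two changes cancel except at [e], where the total weight drops by [delta]. Arcs ending at
    [e] count as leaving because [w2] is not raised there. *)
Definition shift1 t : int := (w1 t - (if t \in R then delta else 0))%R.
Definition shift2 t : int := (w2 t + (if (t \in R) && (t != e) then delta else 0))%R.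

Lemma shift_valid : valid B shift1 shift2.
Proof.
have [m1 m2 l1 l2] := vB; split=> // x y xB yB h; rewrite /shift1 /shift2.
- have := l1 _ _ xB yB h; case: ifP => xR; case: ifP => yR //; try lia.
  have /deltaP : leaving y x by rewrite /leaving yR xR /arc (negPf yB) xB h.
  by rewrite /slack (negPf yB); lia.
- have := l2 _ _ xB yB h.
  have -> : x != e by apply: contraNneq eB => <-.
  rewrite andbT; case: ifP => xR; case: ifP => // [/andP[yR ye]|/negbT]; try lia.
  rewrite negb_and negbK => yR.
  have /deltaP : leaving x y by rewrite /leaving xR yR /arc xB yB h.
  by rewrite /slack xB; lia.
Qed.

Lemma shift_slack u v : u \in R -> arc B u v ->
  slack B shift1 shift2 u v = (slack B w1 w2 u v - (if (v \in R) && (v != e) then 0 else delta))%R.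
Proof.
move=> uR; rewrite /arc /slack /shift1 /shift2 uR; case: ifP => uB /andP[hv _].
  have -> : u != e by apply: contraNneq eB => <-.
  by case: ((v \in R) && (v != e)) => /=; lia.
have -> : v != e by apply: contraNneq eB => <-.
by rewrite andbT; case: ifP => _; lia.
Qed.

Lemma shift_reach : R \subset reach B shift1 shift2 e.
Proof.
apply/subsetP=> v; rewrite inE => /connectP[p]; rewrite inE.
suff H u : u \in R -> connect (tight B shift1 shift2) e u ->
    path (tight B w1 w2) u p -> connect (tight B shift1 shift2) e (last u p).
  by move=> hp ->; apply: H => //; rewrite inE.
elim: p u => //= x p IH u uR cu /andP[tux hp].
have xR : x \in R by move: uR; rewrite !inE => uR; apply: connect_trans uR (connect1 tux).
apply: IH => //; have [->|xe] := eqVneq x e; first exact: connect0.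
apply: connect_trans cu (connect1 _); move: tux; rewrite /tight => /andP[a s].
by rewrite a shift_slack // xR xe subr0.
Qed.

(** The arc that determines [delta] becomes tight: if it ends at [e] it closes a cycle, otherwise
    its end joins the reachable set. *)
Lemma shift_grow u v : leaving u v -> slack B w1 w2 u v = delta ->
  closing B shift1 shift2 e \/ R \proper reach B shift1 shift2 e.
Proof.
case/and3P=> uR vR a sl.
have tg : tight B shift1 shift2 u v.
  rewrite /tight a shift_slack // sl; case: ifP => [/andP[h1 h2]|_]; last by rewrite subrr.
  by rewrite h1 (negPf h2) in vR.
have uR' := subsetP shift_reach u uR.
case/orP: vR => [vR|/eqP ve].
  right; apply/properP; split; first exact: shift_reach.
  exists v => //; move: uR'; rewrite !inE => h; exact: connect_trans h (connect1 tg).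
left; apply/existsP; exists u; rewrite uR' -ve tg andbT /=.
by move: a; rewrite /arc ve; case: ifP => //; rewrite (negPf eB).
Qed.

End Shift.

Section Augment.

Variables (B : {set T}) (w1 w2 : T -> int) (e : T) (lv : T -> nat) (s : nat) (z : nat -> T).
Hypothesis vB : valid B w1 w2.
Hypothesis s0 : 0 < s.
Hypothesis z0 : z 0 = e.
Hypothesis zB : forall i, i < s.*2 -> (z i \in B) = odd i.
Hypothesis zlv : forall i, i < s.*2 -> lv (z i) = i.
Hypothesis ztight : forall i, i.+1 < s.*2 -> tight B w1 w2 (z i) (z i.+1).
Hypothesis zclose : tight B w1 w2 (z s.*2.-1) e.
Hypothesis nolong : forall i v, i < s.*2 -> tight B w1 w2 (z i) v -> lv v <= i.+1.
Hypothesis nocloser : forall i, i < s.*2.-1 -> ~~ tight B w1 w2 (z i) e.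

Definition toggled := [set t | (t \in B) (+) (t \in [seq z i | i <- iota 0 s.*2])].

(** The cycle starts at [e] and alternates between outside and inside of [B]. In [M1] an inner
    element leaves for its predecessor, in [M2] for its successor, so the last one leaves for [e].
    The hypotheses [nolong] and [nocloser] say that the cycle is shortest. *)
Let ps1 := [seq (z i.*2.+1, z i.*2) | i <- iota 0 s].
Let y2 i := if i.+1 == s then e else z i.+1.*2.
Let ps2 := [seq (z i.*2.+1, y2 i) | i <- iota 0 s].

Let z_inj i j : i < s.*2 -> j < s.*2 -> z i = z j -> i = j.
Proof. by move=> hi hj h; rewrite -(zlv hi) -(zlv hj) h. Qed.

Let odd_mem i : i < s -> z i.*2.+1 \in B.
Proof. by move=> h; rewrite zB /= ?odd_double //; lia. Qed.
Let even_mem i : i < s -> z i.*2 \notin B.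
Proof. by move=> h; rewrite zB ?odd_double //; lia. Qed.
Let y2_mem i : i < s -> y2 i \notin B.
Proof.
by move=> h; rewrite /y2; case: ifP => hi; [rewrite -z0 (even_mem (i := 0)) | apply: even_mem; lia].
Qed.

Let uniq_odd : uniq [seq z i.*2.+1 | i <- iota 0 s].
Proof.
rewrite map_inj_in_uniq ?iota_uniq // => i j; rewrite !mem_iota /= !add0n => hi hj /z_inj h.
by have := h ltac:(lia) ltac:(lia); lia.
Qed.

Let sw1 : swapable B ps1.
Proof.
apply/and3P; split.
- apply/allP=> p /mapP[i]; rewrite mem_iota /= add0n => hi ->.
  by rewrite /= odd_mem // even_mem.
- by rewrite /ps1 -map_comp; exact: uniq_odd.
- rewrite /ps1 -map_comp map_inj_in_uniq ?iota_uniq // => i j.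
  rewrite !mem_iota /= !add0n => hi hj /z_inj h.
  by have := h ltac:(lia) ltac:(lia); lia.
Qed.

Let sw2 : swapable B ps2.
Proof.
apply/and3P; split.
- apply/allP=> p /mapP[i]; rewrite mem_iota /= add0n => hi ->.
  by rewrite /= odd_mem // y2_mem.
- by rewrite /ps2 -map_comp; exact: uniq_odd.
- rewrite /ps2 -map_comp map_inj_in_uniq ?iota_uniq // => i j.
  rewrite !mem_iota /= !add0n /y2 -z0 => hi hj.
  case: ifP => h1; case: ifP => h2 h; first lia.
  + by have := @z_inj 0 j.+1.*2 ltac:(lia) ltac:(lia) h; lia.
  + by have := @z_inj i.+1.*2 0 ltac:(lia) ltac:(lia) h; lia.
  + by have := @z_inj i.+1.*2 j.+1.*2 ltac:(lia) ltac:(lia) h; lia.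
Qed.

Let mem_zs t : (t \in [seq z i | i <- iota 0 s.*2]) =
  (t \in map fst ps1) || (t \in map snd ps1).
Proof.
rewrite /ps1 -!map_comp; apply/mapP/orP => [[i]|].
  rewrite mem_iota /= add0n => hi ->; rewrite -(odd_double_half i); case: (odd i).
    by left; apply/mapP; exists i./2; rewrite ?mem_iota //=; lia.
  by right; apply/mapP; exists i./2; rewrite ?mem_iota //=; lia.
case=> /mapP[i]; rewrite mem_iota /= add0n => hi ->.
  by exists i.*2.+1; rewrite // mem_iota; lia.
by exists i.*2; rewrite // mem_iota; lia.
Qed.

Let snd2 : map snd ps2 =i map snd ps1.
Proof.
move=> t; rewrite /ps1 /ps2 -!map_comp; apply/mapP/mapP => -[i]; rewrite mem_iota /= add0n => hi ->.
  rewrite /y2; case: ifP => h; first by exists 0; rewrite ?mem_iota.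
  by exists i.+1; rewrite // mem_iota; lia.
case: i hi => [|i] hi; last first.
  exists i; first by rewrite mem_iota; lia.
  by rewrite /y2; case: ifP => //; lia.
by exists s.-1; [rewrite mem_iota; lia | rewrite /y2 prednK // eqxx].
Qed.

Let toggled1 : toggled = exs B ps1.
Proof.
apply/setP=> t; rewrite inE mem_exs // mem_zs.
have h1 : t \in map fst ps1 -> t \in B.
  by case/mapP=> p pin ->; case/and3P: sw1 => /allP/(_ p pin)/andP[].
have h2 : t \in map snd ps1 -> t \notin B.
  by case/mapP=> p pin ->; case/and3P: sw1 => /allP/(_ p pin)/andP[].
case: (t \in map fst ps1) (t \in map snd ps1) (t \in B) h1 h2 => [] [] [] //= h1 h2.
all: by try (by have := h1 isT); try (by have := h2 isT).
Qed.

Let toggled2 : toggled = exs B ps2.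
Proof.
rewrite toggled1; apply/setP=> t; rewrite !mem_exs // snd2; congr (_ && ~~ _ || _).
by rewrite /ps1 /ps2 -!map_comp.
Qed.

Lemma augment_valid : valid toggled w1 w2.
Proof.
have [m1 m2 l1 l2] := vB.
have [M1' L1'] : M1 (exs B ps1) /\ locopt M1 w1 (exs B ps1).
  apply: (@exs_locopt _ M1 w1 ps1 B (fun p => s.*2 - lv p.1)) => //.
  - apply/allP=> p /mapP[i]; rewrite mem_iota /= add0n => hi -> /=.
    have /andP[] := @ztight i.*2 ltac:(lia).
    by rewrite /arc (negPf (even_mem hi)) => /andP[].
  - move=> p /mapP[i]; rewrite mem_iota /= add0n => hi -> /=.
    have /andP[_] := @ztight i.*2 ltac:(lia).
    by rewrite /slack (negPf (even_mem hi)); lia.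
  - move=> p q /mapP[i]; rewrite mem_iota /= add0n => hi -> /mapP[j].
    rewrite mem_iota /= add0n => hj -> /= ne.
    rewrite !zlv; [|lia|lia] => hlv ew; apply/negP=> h.
    have ij : i <> j by move=> E; rewrite E eqxx in ne.
    have : tight B w1 w2 (z j.*2) (z i.*2.+1).
      by rewrite /tight /arc /slack (negPf (even_mem hj)) odd_mem // h ew subrr eqxx.
    by move/nolong; rewrite zlv; lia.
have [M2' L2'] : M2 (exs B ps2) /\ locopt M2 w2 (exs B ps2).
  have tg i : i < s -> tight B w1 w2 (z i.*2.+1) (y2 i).
    move=> hi; rewrite /y2; case: ifP => [/eqP h|h]; last by apply: ztight; lia.
    by have := zclose; rewrite -h doubleS.
  apply: (@exs_locopt _ M2 w2 ps2 B (fun p => lv p.1)) => //.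
  - apply/allP=> p /mapP[i]; rewrite mem_iota /= add0n => hi -> /=.
    by have /andP[] := tg i hi; rewrite /arc odd_mem // => /andP[].
  - move=> p /mapP[i]; rewrite mem_iota /= add0n => hi -> /=.
    by have /andP[_] := tg i hi; rewrite /slack odd_mem //; lia.
  - move=> p q /mapP[i]; rewrite mem_iota /= add0n => hi -> /mapP[j].
    rewrite mem_iota /= add0n => hj -> /= ne.
    rewrite !zlv; [|lia|lia] => hlv ew; apply/negP=> h.
    have ij : i <> j by move=> E; rewrite E eqxx in ne.
    have tij : tight B w1 w2 (z i.*2.+1) (y2 j).
      by rewrite /tight /arc /slack odd_mem // y2_mem // h ew subrr eqxx.
    move: tij; rewrite /y2; case: ifP => [_ |hj' /nolong]; last by rewrite zlv; lia.
    by apply/negP; apply: nocloser; lia.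
by split; [rewrite toggled1 | rewrite toggled2 | rewrite toggled1 | rewrite toggled2].
Qed.

Lemma card_toggled : #|toggled| = #|B|.
Proof. by rewrite toggled1 card_exs. Qed.

Lemma mem_toggled : e \in toggled.
Proof.
rewrite inE -z0 zB /=; last lia.
by apply: map_f; rewrite mem_iota; lia.
Qed.

End Augment.
End Intersection.

(** * The two matroids of an arborescence packing *)

Section LinearMatroid.

Variables (K : fieldType) (W : vectType K) (T : finType) (vec : T -> W).
Implicit Types (I J : {set T}).

Definition sp (I : {set T}) := (\sum_(t in I) <[vec t]>)%VS.
Definition linindep (I : {set T}) := \dim (sp I) == #|I|.

Lemma dim_sp I : \dim (sp I) <= #|I|.
Proof.
apply: leq_trans (dimv_leq_sum _ _ _) _; rewrite -sum1_card.
by apply: leq_sum => t _; rewrite dim_vline leq_b1.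
Qed.

Lemma mem_sp I t : t \in I -> vec t \in sp I.
Proof. by move=> tI; rewrite memvE; apply: (sumv_sup t). Qed.

Lemma sp_sub I (U : {vspace W}) : (forall t, t \in I -> vec t \in U) -> (sp I <= U)%VS.
Proof. by move=> h; apply/subv_sumP => t tI; rewrite -memvE h. Qed.

Lemma linindep_sub (I J : {set T}) : I \subset J -> linindep J -> linindep I.
Proof.
move=> sIJ /eqP dJ; rewrite /linindep eqn_leq dim_sp /=.
have : (sp J <= sp I + sp (J :\: I))%VS.
  apply: sp_sub => t tJ; case: (boolP (t \in I)) => tI.
    by apply: (subvP (addvSl _ _)); apply: mem_sp.
  by apply: (subvP (addvSr _ _)); apply: mem_sp; rewrite !inE tI.
move/dimvS; rewrite dJ => /leq_trans/(_ (dimv_add_leqif _ _)) h.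
have := dim_sp (J :\: I); rewrite cardsD (setIidPr sIJ).
have := subset_leq_card sIJ; lia.
Qed.

Lemma linindep_add I t : linindep I -> t \notin I -> linindep (t |: I) = (vec t \notin sp I).
Proof.
move=> /eqP lI tI; rewrite /linindep cardsU1 tI.
have s1 : (sp I <= sp (t |: I))%VS.
  by apply: sp_sub => u uI; apply: mem_sp; rewrite !inE uI orbT.
have [le eqi] := dimv_leqif_sup s1.
have d2 := dim_sp (t |: I); rewrite cardsU1 tI in d2.
have -> : (vec t \in sp I) = (sp (t |: I) <= sp I)%VS.
  apply/idP/idP => h.
    by apply: sp_sub => u; rewrite !inE => /orP[/eqP->|] // uI; apply: mem_sp.
  by apply: (subvP h); apply: mem_sp; rewrite !inE eqxx.
rewrite -eqi lI; move: le d2; rewrite lI; lia.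
Qed.

Lemma linindep_aug (I J : {set T}) : linindep I -> linindep J -> #|I| < #|J| ->
  exists2 y, y \in J :\: I & linindep (y |: I).
Proof.
move=> lI /eqP lJ IJ; have [/existsP[y /andP[yJ ly]]|] :=
  boolP [exists y in J :\: I, linindep (y |: I)]; first by exists y.
rewrite negb_exists => /forallP h; suff: (sp J <= sp I)%VS.
  by move/dimvS; rewrite lJ (eqP lI) leqNgt IJ.
apply: sp_sub => t tJ; case: (boolP (t \in I)) => tI; first exact: mem_sp.
by have := h t; rewrite !inE tI tJ /= linindep_add // negbK.
Qed.

Definition linear_matroid := Matroid linindep_sub linindep_aug.

End LinearMatroid.

Section ColouredForests.

Variables (C V T : finType) (co : T -> C) (tl hd : T -> V).
Implicit Types (I B : {set T}).

Definition dl (c : C) (v : V) : {ffun C * V -> rat^o} := [ffun p => (p == (c, v))%:R%R].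
(** Incidence vectors, with one copy of the vertex space per colour: independence means that every
    colour class is a forest. In this linear form the augmentation axiom comes from dimensions. *)
Definition avec (t : T) : {ffun C * V -> rat^o} := (dl (co t) (hd t) - dl (co t) (tl t))%R.

Definition forests : matroid T := linear_matroid avec.

Definition adjc (I : {set T}) (c : C) (u v : V) :=
  [exists t in I, (co t == c) &&
     ((tl t == u) && (hd t == v) || (tl t == v) && (hd t == u))].

Lemma connect_span I c u v : connect (adjc I c) u v -> (dl c v - dl c u)%R \in sp avec I.
Proof.
case/connectP=> p; elim: p u => [|w p IH] u /=; first by move=> _ ->; rewrite subrr mem0v.
case/andP=> /existsP[t /andP[tI /andP[/eqP tc h]]] hp hl.
have -> : (dl c v - dl c u = (dl c v - dl c w) + (dl c w - dl c u))%R by rewrite addrA subrK.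
apply: memvD; first exact: IH hp hl.
have tm := mem_sp avec tI; rewrite /avec tc in tm.
case/orP: h => /andP[/eqP h1 /eqP h2]; rewrite h1 h2 in tm => //.
by rewrite -opprB memvN.
Qed.

(** If the ends of [y] are not connected, let [S] be the component of its tail. Summing the
    coordinates of [S] in the colour of [y] is a functional that vanishes on the vectors of [I],
    whose arcs do not leave [S], but not on that of [y]. *)
Lemma span_connect I y : (avec y \in sp avec I) = connect (adjc I (co y)) (tl y) (hd y).
Proof.
apply/idP/idP; last exact: connect_span.
apply: contraTT => nc; apply/negP => /memv_sumP[u hu eu].
pose S := [set w | connect (adjc I (co y)) (tl y) w].
pose phi (f : {ffun C * V -> rat^o}) : rat := (\sum_(w in S) f (co y, w))%R.
have phid c v : phi (dl c v) = ((c == co y) && (v \in S))%:R%R.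
  rewrite /phi; have [->|cy] := eqVneq c (co y); last first.
    by rewrite big1 // => w _; rewrite ffunE xpair_eqE eq_sym (negPf cy).
  case: (boolP (v \in S)) => vS /=.
    rewrite (bigD1 v) //= ffunE eqxx big1 ?addr0 // => w /andP[_ wv].
    by rewrite ffunE xpair_eqE (negPf wv) andbF.
  rewrite big1 // => w wS; rewrite ffunE xpair_eqE; case: eqP => // _.
  by case: eqP => // E; rewrite -E wS in vS.
have phiB f g : phi (f - g)%R = (phi f - phi g)%R.
  by rewrite /phi -sumrB; apply: eq_bigr => w _; rewrite !ffunE.
have : phi (avec y) = (\sum_(t in I) phi (u t))%R.
  rewrite eu /phi exchange_big /=; apply: eq_bigr => w _; by rewrite sum_ffunE.
rewrite big1 => [|t tI].
  rewrite /avec phiB !phid !eqxx /= !inE connect0 (negPf nc) sub0r => /eqP.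
  by rewrite oppr_eq0 oner_eq0.
have /vlineP[a ->] := hu t tI.
have -> : phi (a *: avec t)%R = (a * phi (avec t))%R.
  by rewrite /phi mulr_sumr; apply: eq_bigr => w _; rewrite ffunE.
rewrite /avec phiB !phid; case: eqP => //= [tc|_]; last by rewrite subrr mulr0.
suff -> : (hd t \in S) = (tl t \in S) by rewrite subrr mulr0.
have cs : connect_sym (adjc I (co y)).
  apply: sym_connect_sym => p q; apply: eq_existsb => z; congr [&& _, _ & _].
  by rewrite orbC.
rewrite !inE; apply: same_connect_r => //; apply: connect1.
by apply/existsP; exists t; rewrite tI tc !eqxx /= orbT.
Qed.

Lemma forests0 : forests set0.
Proof. by rewrite /= /linindep /sp big_set0 dimv0 cards0. Qed.

Lemma forests_exch B x y : forests B -> x \in B -> y \notin B ->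
  forests (exch B x y) = ~~ connect (adjc (B :\ x) (co y)) (tl y) (hd y).
Proof.
move=> fB xB yB; rewrite -span_connect; apply: linindep_add.
  by apply: linindep_sub fB; apply: subsetDl.
by rewrite !inE negb_and yB orbT.
Qed.

Lemma forests_add B y : forests B -> y \notin B ->
  ~~ connect (adjc B (co y)) (tl y) (hd y) -> forests (y |: B).
Proof. by move=> fB yB; rewrite -span_connect => h; rewrite /forests /= linindep_add. Qed.

(** These vectors lie in the span of the differences [dl c v - dl c s0], where [v] runs over the
    elements of [S] other than [s0]. *)
Lemma forests_inside B (S : {set V}) : forests B -> S != set0 ->
  #|[set t in B | (tl t \in S) && (hd t \in S)]| <= #|C| * #|S|.-1.
Proof.
move=> fB /set0Pn[s0 s0S]; set A := [set t in B | _].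
have lA : linindep avec A.
  by apply: linindep_sub fB; apply/subsetP=> t; rewrite inE => /andP[].
rewrite -(eqP lA).
pose P := [set p : C * V | p.2 \in S :\ s0].
pose U := (\sum_(p in P) <[dl p.1 p.2 - dl p.1 s0]>)%VS.
have memU c v : v \in S -> (dl c v - dl c s0)%R \in U.
  move=> vS; have [->|vs] := eqVneq v s0; first by rewrite subrr mem0v.
  by rewrite memvE; apply: (sumv_sup (c, v)); rewrite // !inE vs vS.
have /dimvS/leq_trans : (sp avec A <= U)%VS.
  apply: sp_sub => t; rewrite inE => /and3P[_ h1 h2].
  have -> : avec t = ((dl (co t) (hd t) - dl (co t) s0) - (dl (co t) (tl t) - dl (co t) s0))%R.
    by rewrite opprB addrA subrK.
  by apply: memvB; apply: memU.
apply; apply: leq_trans (dimv_leq_sum _ _ _) _.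
apply: (@leq_trans #|P|).
  by rewrite -sum1_card; apply: leq_sum => p _; rewrite dim_vline leq_b1.
have -> : P = setX [set: C] (S :\ s0) by apply/setP=> p; rewrite !inE.
by rewrite cardsX cardsT (cardsD1 s0 S) s0S.
Qed.

Lemma adjc_stay I c (U : {set V}) u v :
  (forall t, t \in I -> co t = c -> (tl t \in U) = (hd t \in U)) ->
  u \in U -> connect (adjc I c) u v -> v \in U.
Proof.
move=> h uU cuv; suff <- : (u \in U) = (v \in U) by [].
apply: closed_connect cuv => p q /existsP[t /andP[tI /andP[/eqP tc]]].
by case/orP=> /andP[/eqP <- /eqP <-]; rewrite h.
Qed.

End ColouredForests.

Section InDegree.

Variables (V T : finType) (K : eqType) (cl : T -> K) (hd : T -> V) (cap : V -> nat).
Implicit Types (I J : {set T}).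
Hypothesis cl_hd : forall t u, cl t = cl u -> hd t = hd u.

Definition indeg (I : {set T}) v := #|[set t in I | hd t == v]|.

(** The classes will be arcs, so that no arc serves two colours, and [cap] the in-degrees of a
    packing. A class determines its head, so the constraints are laminar. *)
Definition capindep (I : {set T}) :=
  [forall t in I, forall u in I, (cl t == cl u) ==> (t == u)] && [forall v, indeg I v <= cap v].

Lemma capindepP I : reflect ((forall t u, t \in I -> u \in I -> cl t = cl u -> t = u) /\
  (forall v, indeg I v <= cap v)) (capindep I).
Proof.
apply: (iffP andP) => [[/forall_inP h1 /forallP h2]|[h1 h2]]; split=> //.
- by move=> t u tI uI /eqP e; apply/eqP; apply: (implyP ((forall_inP (h1 t tI)) u uI)).
- apply/forall_inP=> t tI; apply/forall_inP=> u uI; apply/implyP=> /eqP e; apply/eqP; exact: h1.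
- exact/forallP.
Qed.

Lemma capindep_sub (I J : {set T}) : I \subset J -> capindep J -> capindep I.
Proof.
move=> /subsetP s /capindepP[h1 h2]; apply/capindepP; split=> [t u tI uI|v].
  by apply: h1; apply: s.
apply: leq_trans (h2 v); apply: subset_leq_card; apply/subsetP=> t; rewrite !inE.
by case/andP=> /s -> ->.
Qed.

Lemma capindep_add I y : capindep I -> y \notin I ->
  capindep (y |: I) = [forall z in I, cl z != cl y] && (indeg I (hd y) < cap (hd y)).
Proof.
move=> /capindepP[h1 h2] yI.
have cnt v : indeg (y |: I) v = (hd y == v) + indeg I v.
  rewrite /indeg; case: eqP => [<-|hv].
    have -> : [set t in y |: I | hd t == hd y] = y |: [set t in I | hd t == hd y].
      by apply/setP=> t; rewrite !inE; case: (eqVneq t y) => // ->; rewrite eqxx.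
    by rewrite cardsU1 !inE (negPf yI).
  rewrite add0n; apply: eq_card => t; rewrite !inE.
  by case: (eqVneq t y) => // ->; rewrite (introF eqP hv) !andbF.
apply/capindepP/andP => [[g1 g2]|[/forall_inP g1 g2]]; split.
- apply/forall_inP=> z zI; apply: contraNneq yI => e.
  by rewrite -(g1 z y) // !inE ?zI ?eqxx ?orbT.
- by have := g2 (hd y); rewrite cnt eqxx.
- move=> t u; rewrite !inE => /orP[/eqP->|tI] /orP[/eqP->|uI] //.
  + by move=> e; have := g1 u uI; rewrite e eqxx.
  + by move=> e; have := g1 t tI; rewrite e eqxx.
  + exact: h1.
- by move=> v; rewrite cnt; case: eqP => [<- //|_]; apply: h2.
Qed.

(** At some vertex [v] the set [J] has more elements than [I]. If all their classes occurred in [I]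
    at [v], matching classes would inject these elements of [J] into those of [I]. *)
Lemma capindep_aug (I J : {set T}) : capindep I -> capindep J -> #|I| < #|J| ->
  exists2 y, y \in J :\: I & capindep (y |: I).
Proof.
move=> cI /capindepP[j1 j2] IJ.
have sumE (A : {set T}) : #|A| = \sum_v indeg A v.
  rewrite -sum1_card (partition_big hd xpredT) //=; apply: eq_bigr => v _.
  by rewrite sum1dep_card.
have [/existsP[v lv]|/existsPn h] := boolP [exists v, indeg I v < indeg J v]; last first.
  suff : #|J| <= #|I| by rewrite leqNgt IJ.
  by rewrite !sumE; apply: leq_sum => v _; rewrite leqNgt h.
pose Jv := [set t in J | hd t == v]; pose Iv := [set t in I | hd t == v].
have [/existsP[y /andP[yJ ny]]|/existsPn h] :=
  boolP [exists y in Jv, [forall z in Iv, cl z != cl y]].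
  move: yJ; rewrite inE => /andP[yJ /eqP yv].
  have yI : y \notin I.
    apply/negP=> yI; have := forall_inP ny y; rewrite inE yI yv eqxx /= => /(_ isT).
    by rewrite eqxx.
  exists y; first by rewrite inE yI.
  rewrite capindep_add //; apply/andP; split.
    apply/forall_inP=> z zI; apply/negP=> /eqP e.
    by have := forall_inP ny z; rewrite inE zI (cl_hd e) yv !eqxx /= e eqxx => /(_ isT).
  by rewrite yv; apply: leq_trans lv (j2 v).
pose g (y : T) := odflt y [pick z in Iv | cl z == cl y].
have gP y : y \in Jv -> g y \in Iv /\ cl (g y) = cl y.
  move=> yJ; rewrite /g; case: pickP => [z /andP[zI /eqP e]|nz] //=.
  have := h y; rewrite yJ /= => /forall_inPn[z zI]; rewrite negbK => e.
  by have := nz z; rewrite zI e.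
suff : #|Jv| <= #|Iv| by rewrite leqNgt lv.
rewrite -(card_in_imset (f := g) (D := mem Jv)).
  apply: subset_leq_card; apply/subsetP=> _ /imsetP[y yJ ->]; exact: (gP y yJ).1.
move=> y z yJ zJ e; have := (gP y yJ).2; rewrite e (gP z zJ).2 => e2.
move: yJ zJ; rewrite !inE => /andP[yJ _] /andP[zJ _]; exact: j1.
Qed.

Definition indegrees := Matroid capindep_sub capindep_aug.

End InDegree.

Section Rooted.

Variables (C V T : finType) (K : eqType) (co : T -> C) (tl hd : T -> V) (cl : T -> K) (r : V).
Implicit Types (B : {set T}).
Hypothesis cl_hd : forall t u, cl t = cl u -> hd t = hd u.

Definition root_cap v := if v == r then 0 else #|C|.

(** At most [#|C|] times [#|S|.-1] elements lie inside [S], and at most [#|C|] times [#|~: S|.-1]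
    have their head outside, as the root has capacity 0. The sizes leave at least [#|C|] elements
    entering [S]. *)
Lemma common_basis_enters B (S : {set V}) :
  forests co tl hd B -> capindep cl hd root_cap B -> #|B| = #|C| * #|V|.-1 ->
  S != set0 -> r \notin S -> #|C| <= #|[set t in B | (hd t \in S) && (tl t \notin S)]|.
Proof.
move=> fB /capindepP[_ cB] cardB S0 rS.
have h1 := forests_inside fB S0.
pose X := [set t in B | hd t \in S].
have XE : #|X| = #|[set t in B | (tl t \in S) && (hd t \in S)]| +
    #|[set t in B | (hd t \in S) && (tl t \notin S)]|.
  rewrite -(cardsID [set t | tl t \in S] X); congr (_ + _); apply: eq_card => t; rewrite !inE.
    by case: (t \in B); case: (hd t \in S); case: (tl t \in S).
  by case: (t \in B); case: (hd t \in S); case: (tl t \in S).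
have cX : #|B| = #|X| + #|[set t in B | hd t \notin S]|.
  rewrite -(cardsID [set t | hd t \in S] B); congr (_ + _); apply: eq_card => t; rewrite !inE //.
  by rewrite andbC.
have h2 : #|[set t in B | hd t \notin S]| <= #|C| * (#|~: S|.-1).
  rewrite -sum1_card (partition_big hd (mem (~: S))) /=; last by move=> t; rewrite !inE => /andP[].
  apply: (@leq_trans (\sum_(v in ~: S) root_cap v)).
    apply: leq_sum => v vS; apply: leq_trans (cB v).
    rewrite sum1dep_card; apply: subset_leq_card; apply/subsetP=> t; rewrite !inE.
    by case/andP=> /andP[-> _] ->.
  rewrite (bigD1 r) ?inE //= /root_cap eqxx add0n.
  rewrite (eq_bigr (fun=> #|C|)) => [|v /andP[_ /negPf -> //]].
  rewrite sum_nat_const mulnC leq_mul2l; apply/orP; right.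
  rewrite (cardsD1 r (~: S)) !inE rS /=.
  by apply: subset_leq_card; apply/subsetP=> v; rewrite unfold_in !inE andbC.
have S1 : 0 < #|S| by rewrite card_gt0.
have S2 : 0 < #|~: S| by rewrite card_gt0; apply/set0Pn; exists r; rewrite inE.
have S3 : #|S| + #|~: S| = #|V| by rewrite cardsC.
have : #|V|.-1 = #|~: S|.-1 + #|S|.-1 + 1 by lia.
rewrite XE in cX; move: cardB; rewrite cX => + e; rewrite e !mulnDr; lia.
Qed.

End Rooted.

(** * Packing arborescences *)

Section Edmonds.

Variables (V A : finType) (tl hd : A -> V) (r : V).
Implicit Types (D : {set A}) (S U X Y : {set V}).

Definition enter D S := [set a in D | (hd a \in S) && (tl a \notin S)].
Definition rooted k D := forall S, S != set0 -> r \notin S -> k <= #|enter D S|.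

Inductive arbo : {set V} -> {set A} -> Prop :=
  | arbo0 : arbo [set r] set0
  | arboS U A' a : arbo U A' -> tl a \in U -> hd a \notin U -> arbo (hd a |: U) (a |: A').

Lemma arbo_facts U A' : arbo U A' -> [/\ r \in U,
  (forall a, a \in A' -> [/\ tl a \in U, hd a \in U & hd a != r]),
  {in A' &, injective hd} & #|A'|.+1 = #|U|].
Proof.
elim=> [|U' A'' a _ [rU h inj c] tU hU]; first by split=> [|a|a|]; rewrite ?inE ?cards0 ?cards1.
have aA : a \notin A'' by apply/negP => /h[_ hh _]; rewrite hh in hU.
split.
- by rewrite !inE rU orbT.
- move=> b; rewrite !inE => /orP[/eqP->|/h[-> -> ->]]; last by rewrite !orbT.
  by rewrite tU eqxx orbT; split=> //; apply: contraNneq hU => ->.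
- move=> b b'; rewrite !inE => /orP[/eqP->|hb] /orP[/eqP->|hb'] //.
  + by move=> e; have [_ + _] := h _ hb'; rewrite -e (negPf hU).
  + by move=> e; have [_ + _] := h _ hb; rewrite e (negPf hU).
  + exact: inj.
- by rewrite !cardsU1 aA hU -c.
Qed.

Lemma enter_submod D X Y :
  #|enter D (X :&: Y)| + #|enter D (X :|: Y)| <= #|enter D X| + #|enter D Y|.
Proof.
have cE S : #|enter D S| = \sum_(a in D) ((hd a \in S) && (tl a \notin S)).
  rewrite -sum1_card big_mkcond [RHS]big_mkcond /=; apply: eq_bigr => a _; rewrite inE.
  by case: (a \in D) => //=; case: (_ && _).
rewrite !cE -!big_split /=; apply: leq_sum => a _; rewrite !inE.
by case: (hd a \in X); case: (hd a \in Y); case: (tl a \in X); case: (tl a \in Y).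
Qed.

(** The argument of Lovasz for Edmonds' theorem: an arborescence is grown arc by arc, while the
    remaining arcs still enter every set without the root at least [k] times. *)
Lemma rooted_peel k D : rooted k.+1 D ->
  exists A' : {set A}, [/\ A' \subset D, arbo [set: V] A' & rooted k (D :\: A')].
Proof.
move=> rD.
suff H n U (A' : {set A}) : #|~: U| <= n -> arbo U A' -> A' \subset D -> rooted k (D :\: A') ->
    exists A' : {set A}, [/\ A' \subset D, arbo [set: V] A' & rooted k (D :\: A')].
  apply: (H _ _ _ (leqnn _) arbo0); first by rewrite sub0set.
  by move=> S S0 rS; rewrite setD0; apply: ltnW; apply: rD.
elim: n U A' => [|n IH] U A' hn aU sA rk.
  have UT : U = [set: V] by apply/setP=> v; move: hn; rewrite leqn0 cards_eq0 => /eqP/setP/(_ v); rewrite !inE => /negbFE.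
  by exists A'; rewrite -{1}UT.
have [UT|UT] := eqVneq U [set: V]; first by exists A'; rewrite -{1}UT.
have [rU fA _ _] := arbo_facts aU.
have nU v : v \notin U -> v \in ~: U by rewrite inE.
set D' := D :\: A'.
have noA (S : {set V}) : S \subset ~: U -> enter D' S = enter D S.
  move=> /subsetP sS; apply/setP=> a; rewrite !inE; case: (boolP (a \in A')) => //= /fA[_ hU _].
  by case: (boolP (hd a \in S)) => [/sS|]; rewrite ?inE ?hU // andbF.
(* A critical set has no entering arc to spare and is not contained in [U]. The whole vertex set
   stands in when there is none. *)
pose crit X := [&& r \notin X, #|enter D' X| == k & X :\: U != set0].
pose P X := (X == [set: V]) || crit X.
have PT : P [set: V] by rewrite /P eqxx.
case: (arg_minnP (fun X : {set V} => #|X|) PT) => X PX Xmin.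
have XU : X :\: U != set0.
  case/orP: PX => [/eqP->|/and3P[] //]; rewrite setTD -setCT; apply: contra UT => /eqP h.
  by apply/eqP; rewrite -[U]setCK h setCK.
have rXU : r \notin X :\: U by rewrite inE rU.
have big : k < #|enter D' (X :\: U)|.
  by rewrite noA ?rD //; apply/subsetP=> v; rewrite !inE => /andP[].
(* More arcs enter [X :\: U] than [X], so one of them starts in [X :&: U]. *)
have [a aD [hX hU tX tU]] : exists2 a, a \in D' & [/\ hd a \in X, hd a \notin U, tl a \in X & tl a \in U].
  have [a] : exists a, a \in enter D' (X :\: U) :\: enter D' X.
    apply/set0Pn; case/orP: PX => [/eqP XT|/and3P[rX /eqP ck _]].
      have -> : enter D' X = set0 by apply/setP=> a; rewrite XT !inE !andbF.
      by rewrite setD0 -card_gt0; apply: leq_ltn_trans big.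
    apply/eqP=> /eqP; rewrite setD_eq0 => /subset_leq_card; rewrite ck leqNgt.
    by rewrite big.
  rewrite in_setD => /andP[nX]; rewrite !inE => /and3P[/andP[aA aD] /andP[hU hX] tXU].
  move: nX; rewrite !inE aA aD hX /= negbK => tX.
  by exists a; rewrite ?inE ?aA //; split=> //; move: tXU; rewrite tX andbT negbK.
(* If losing [a] harmed some [Y], then [Y] would be entered by exactly [k] arcs, and by
   submodularity [X :&: Y] would be critical, yet smaller than [X] since it misses the tail of
   [a]. *)
have step : rooted k (D :\: (a |: A')).
  move=> Y Y0 rY; have kY := rk Y Y0 rY.
  have YE : enter (D :\: (a |: A')) Y = enter D' Y :\ a.
    apply/setP=> b; rewrite !inE negb_or; case: (b == a) => //=.
  rewrite YE; have [aY|aY] := boolP (a \in enter D' Y); last first.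
    by rewrite (setDidPl _) // disjoint_sym disjoints1.
  have := cardsD1 a (enter D' Y); rewrite aY add1n => cY.
  have [gt|le] := ltnP k #|enter D' Y|; first by rewrite -ltnS -cY.
  have ck : #|enter D' Y| = k by apply/eqP; rewrite eqn_leq le.
  move: (aY); rewrite !inE => /and3P[_ hY tY].
  have Pm : P (X :&: Y).
    rewrite /P /crit; apply/orP; right; apply/and3P; split.
    - by rewrite inE negb_and rY orbT.
    - have XY0 : X :&: Y != set0 by apply/set0Pn; exists (hd a); rewrite inE hX hY.
      have rXY : r \notin X :&: Y by rewrite inE negb_and rY orbT.
      have k1 := rk _ XY0 rXY.
      rewrite eqn_leq k1 andbT; case/orP: PX => [/eqP XT|/and3P[rX /eqP cX _]].
        by rewrite XT setTI ck.
      have k2 : k <= #|enter D' (X :|: Y)|.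
        by apply: rk; [apply/set0Pn; exists (hd a); rewrite inE hX | rewrite inE negb_or rX].
      by have := enter_submod D' X Y; rewrite cX ck; move: k2; clear; lia.
    - by apply/set0Pn; exists (hd a); rewrite !inE hX hY hU.
  have := Xmin _ Pm; rewrite leqNgt; case/negP; apply: proper_card.
  by apply/properP; split; [apply: subsetIl | exists (tl a); rewrite // inE negb_and tY orbT].
apply: (IH (hd a |: U) (a |: A')) => //.
- rewrite -ltnS; apply: leq_trans hn; apply: proper_card; apply/properP; split.
    by rewrite setCS subsetU1.
  by exists (hd a); rewrite !inE ?hU // eqxx.
- exact: arboS.
- by rewrite subUset sA andbT sub1set; move: aD; rewrite inE => /andP[].
Qed.

Lemma rooted_packing k D : rooted k D -> exists f : nat -> {set A},
  (forall i, i < k -> f i \subset D /\ arbo [set: V] (f i)) /\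
  (forall i j a, i < k -> j < k -> a \in f i -> a \in f j -> i = j).
Proof.
elim: k D => [|k IH] D rD; first by exists (fun=> set0).
have [A' [sA aA rA]] := rooted_peel rD; have [f [f1 f2]] := IH _ rA.
exists (fun i => if i == k then A' else f i); split=> [i ik|i j a ik jk].
  case: eqP => [//|/eqP ne]; have [s h] := f1 i ltac:(lia); split=> //.
  by apply: subset_trans s _; apply: subsetDl.
have out l b : l < k -> b \in f l -> b \notin A'.
  by move=> lk bf; have [/subsetP/(_ b bf)] := f1 l lk; rewrite inE => /andP[].
case: (eqVneq i k) => [->|ne]; case: (eqVneq j k) => [->|nj] // h1 h2.
- by have := out j a ltac:(lia) h2; rewrite h1.
- by have := out i a ltac:(lia) h1; rewrite h2.
- by apply: (f2 i j a) => //; lia.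
Qed.

End Edmonds.

(** * From packed arborescences to a common basis *)

Section CommonBasis.

Variables (V A T : finType) (K : eqType) (k : nat).
Variables (tlA hdA : A -> V) (r : V) (co : T -> 'I_k) (tl hd : T -> V) (cl : T -> K).
Variable emb : A -> 'I_k -> T.
Hypothesis cl_hd : forall t u, cl t = cl u -> hd t = hd u.
Hypothesis emb_tl : forall a i, tl (emb a i) = tlA a.
Hypothesis emb_hd : forall a i, hd (emb a i) = hdA a.
Hypothesis emb_co : forall a i, co (emb a i) = i.
Hypothesis emb_cl : forall a b i j, cl (emb a i) = cl (emb b j) -> a = b.

Lemma forests_arbo U A' (I : {set T}) i : arbo tlA hdA r U A' -> forests co tl hd I ->
  (forall t, t \in I -> co t != i) -> forests co tl hd (I :|: [set emb a i | a in A']).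
Proof.
move=> aU fI nI; elim: aU => [|U' A'' a aU fU tU hU]; first by rewrite imset0 setU0.
have [_ fA _ _] := arbo_facts aU.
rewrite imsetU1 setUCA; apply: forests_add => //.
  rewrite !inE negb_or; apply/andP; split.
    by apply/negP => /nI; rewrite emb_co eqxx.
  apply/imsetP=> -[b bA E]; have e : a = b by apply: (@emb_cl _ _ i i); rewrite E.
  by have [_ + _] := fA b bA; rewrite -e (negPf hU).
apply/negP => /adjc_stay => /(_ U'); rewrite emb_tl emb_hd (negPf hU) => h.
apply: notF; apply: h => // t; rewrite emb_co !inE => /orP[/nI/eqP //|/imsetP[b bA ->] _].
by rewrite emb_tl emb_hd; have [-> -> _] := fA b bA.
Qed.

(** The [i]-th arborescence of a packing receives colour [i]. Each arc of [D] is used at most once,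
    whence the bound on the weight. *)
Lemma common_basis_exists D (w : T -> nat) (wA : A -> nat) :
  rooted tlA hdA r k D -> (forall a i, w (emb a i) = wA a) ->
  exists B : {set T}, [/\ forests co tl hd B, capindep cl hd (@root_cap 'I_k V r) B,
    #|B| = k * #|V|.-1, (forall t, t \in B -> exists a i, t = emb a i)
    & \sum_(t in B) w t <= \sum_(a in D) wA a].
Proof.
move=> rD wE; have [f [f1 f2]] := rooted_packing rD.
pose Q := [set p : A * 'I_k | p.1 \in f p.2].
pose B := [set emb p.1 p.2 | p in Q].
have embI : {in Q &, injective (fun p : A * 'I_k => emb p.1 p.2)}.
  move=> [a i] [b j] /= _ _ E.
  by congr (_, _); [apply: (@emb_cl _ _ i j); rewrite E | rewrite -(emb_co a i) E emb_co].
have QE (F : A * 'I_k -> nat) : \sum_(p in Q) F p = \sum_(i < k) \sum_(a in f i) F (a, i).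
  rewrite [RHS]pair_big_dep /=.
  rewrite (reindex_onto (fun p : 'I_k * A => (p.2, p.1)) (fun p => (p.2, p.1))) /=; last by case.
  by apply: eq_big => [[i a]|[i a] _] //=; rewrite inE /= eqxx andbT.
exists B; split.
(* Colour classes are added one at a time, so that [forests_arbo] meets a colour not yet present. *)
- have H n : n <= k -> forests co tl hd [set emb p.1 p.2 | p in [set p : A * 'I_k | (p.1 \in f p.2) && (p.2 < n)]].
    elim: n => [|n IH] nk.
      have -> : [set p : A * 'I_k | (p.1 \in f p.2) && (p.2 < 0)] = set0.
        by apply/setP=> p; rewrite !inE ltn0 andbF.
      by rewrite imset0; apply: forests0.
    pose i := Ordinal nk.
    have -> : [set emb p.1 p.2 | p in [set p : A * 'I_k | (p.1 \in f p.2) && (p.2 < n.+1)]] =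
       [set emb p.1 p.2 | p in [set p : A * 'I_k | (p.1 \in f p.2) && (p.2 < n)]] :|:
       [set emb a i | a in f n].
      apply/setP=> t; rewrite in_setU; apply/imsetP/orP.
        case=> -[a j]; rewrite inE /= ltnS leq_eqVlt => /andP[aj /orP[/eqP jn|jn]] ->.
          have <- : j = i by apply: val_inj.
          by right; apply/imsetP; exists a => //; rewrite -jn.
        by left; apply/imsetP; exists (a, j); rewrite ?inE /= ?aj.
      case=> /imsetP[].
        case=> a j; rewrite inE /= => /andP[aj jn] ->; exists (a, j) => //.
        by rewrite inE /= aj ltnS ltnW.
      by move=> a an ->; exists (a, i); rewrite // inE /= an ltnS leqnn.
    have [_ ar] := f1 n nk; apply: (forests_arbo ar); first exact: IH (ltnW nk).
    move=> t /imsetP[[a j]]; rewrite inE /= => /andP[_ jn] ->.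
    by rewrite emb_co; apply: contraTneq jn => ->; rewrite /= ltnn.
  have Qk : Q = [set p : A * 'I_k | (p.1 \in f p.2) && (p.2 < k)].
    by apply/setP=> p; rewrite !inE ltn_ord andbT.
  by rewrite /B Qk; apply: H.
- apply/capindepP; split.
    move=> t u /imsetP[[a i]]; rewrite inE /= => ai -> /imsetP[[b j]]; rewrite inE /= => bj -> /emb_cl e.
    by rewrite -e in bj *; congr emb; apply: val_inj; apply: (f2 i j a).
  move=> v; rewrite /root_cap card_ord /indeg; case: eqP => [->|_].
    rewrite leqn0 cards_eq0; apply/eqP/setP=> t; rewrite !inE; apply/negP.
    case/andP=> /imsetP[[a i]]; rewrite inE /= => ai ->; rewrite emb_hd => /eqP e.
    by have [_ ar] := f1 i (ltn_ord i); have [_ /(_ a ai)[_ _]] := arbo_facts ar; rewrite e eqxx.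
  rewrite -[X in _ <= X]card_ord -(card_in_imset (f := co)); first exact: max_card.
  move=> t u; rewrite !inE => /andP[/imsetP[[a i]]]; rewrite inE /= => ai -> ha.
  case/andP=> /imsetP[[b j]]; rewrite inE /= => bj -> hb; rewrite !emb_co => e.
  rewrite -e in bj *; move: ha hb; rewrite !emb_hd => /eqP ha /eqP hb.
  have [_ ar] := f1 i (ltn_ord i); have [_ _ inj _] := arbo_facts ar.
  by rewrite (inj a b) // ha.
- rewrite card_in_imset // -sum1_card QE (eq_bigr (fun=> #|V|.-1)) => [|i _].
    by rewrite sum_nat_const card_ord.
  rewrite sum1_card; have [_ ar] := f1 i (ltn_ord i); have [_ _ _] := arbo_facts ar.
  by rewrite cardsT => <-.
- by move=> t /imsetP[[a i] _ ->]; exists a, i.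
- rewrite big_imset //= QE (exchange_big_dep xpredT) //=.
  rewrite (bigID (mem D)) /= [X in _ + X]big1 ?addn0 => [|a aD].
    apply: leq_sum => a aD; have [/existsP[i ai]|/existsPn h] := boolP [exists i : 'I_k, a \in f i].
      rewrite (bigD1 i) //= big1 ?addn0 ?wE // => j /andP[aj ji].
      by case/eqP: ji; apply: val_inj; apply: (f2 j i a).
    by rewrite big1 // => i ai; have := h i; rewrite ai.
  by rewrite big1 // => i ai; have [/subsetP/(_ a ai)] := f1 i (ltn_ord i); rewrite (negPf aD).
Qed.

End CommonBasis.

(** * Cuts and uncrossable families *)

Section Cuts.

Variables (V E : finType) (nd : E -> V * V).
Implicit Types (S X Y C : {set V}) (F J O H : {set E}) (e f : E).

Definition cr S e := ((nd e).1 \in S) (+) ((nd e).2 \in S).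
Definition cut F S := [set e in F | cr S e].

Lemma in_cut F S e : (e \in cut F S) = (e \in F) && cr S e.
Proof. by rewrite inE. Qed.

Lemma crC S e : cr (~: S) e = cr S e.
Proof. by rewrite /cr !inE addNb addbN negbK. Qed.

Lemma cutC F S : cut F (~: S) = cut F S.
Proof. by apply/setP=> e; rewrite !in_cut crC. Qed.

Lemma connected_cutP F :
  connected nd F <-> (forall S, S != set0 -> S != setT -> cut F S != set0).
Proof.
split=> [conn S /set0Pn[u uS] ST|h u v].
  apply/eqP=> c0; case/negP: ST; apply/eqP/setP=> v; rewrite inE.
  suff <- : (u \in S) = (v \in S) by [].
  apply: (@closed_connect _ (adjacent nd F)); last exact: conn.
  move=> p q /existsP[e /andP[eF he]]; apply/eqP/negPn/negP => ne.
  have : e \in cut F S.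
    rewrite in_cut eF /cr; case/orP: he => /eqP -> /=;
    by move: ne; case: (p \in S); case: (q \in S).
  by rewrite c0 inE.
pose S := [set w | connect (adjacent nd F) u w].
have uS : u \in S by rewrite inE.
have [ST|ST] := eqVneq S setT; first by have := in_setT v; rewrite -ST inE.
have [|e] := set0Pn _ (h S _ ST); first by apply/set0Pn; exists u.
rewrite in_cut => /andP[eF]; rewrite /cr !inE.
case E1 : (nd e) => [p q] /=.
have pq : adjacent nd F p q by apply/existsP; exists e; rewrite eF E1 eqxx.
have qp : adjacent nd F q p by apply/existsP; exists e; rewrite eF E1 eqxx orbT.
case: (boolP (connect _ u p)) => [cp|ncp]; case: (boolP (connect _ u q)) => [cq|ncq] //= _.
  by rewrite (connect_trans cp (connect1 pq)) in ncq.
by rewrite (connect_trans cq (connect1 qp)) in ncp.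
Qed.

Lemma edge_connected_cutP p F :
  edge_connected nd p F <-> (forall S, S != set0 -> S != setT -> p <= #|cut F S|).
Proof.
split=> [ec S S0 ST|h X XF Xp].
  rewrite leqNgt; apply/negP => lt.
  have sub : cut F S \subset F by apply/subsetP=> e; rewrite inE => /andP[].
  have /connected_cutP/(_ S S0 ST)/set0Pn[e] := ec _ sub lt.
  by rewrite !inE; case: (e \in F); case: (cr S e).
apply/connected_cutP => S S0 ST.
have -> : cut (F :\: X) S = cut F S :\: X by apply/setP=> e; rewrite !inE andbA.
apply/eqP=> e0; have := h S S0 ST; rewrite leqNgt; case/negP.
apply: leq_ltn_trans Xp; apply: subset_leq_card.
by rewrite -setD_eq0 e0.
Qed.

Lemma cut_sum F S : #|cut F S| = \sum_(e in F) cr S e.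
Proof.
rewrite -sum1_card big_mkcond [RHS]big_mkcond /=; apply: eq_bigr => e _; rewrite inE.
by case: (e \in F) => //=; case: (cr S e).
Qed.

Lemma cut_submod F X Y :
  #|cut F (X :&: Y)| + #|cut F (X :|: Y)| <= #|cut F X| + #|cut F Y|.
Proof.
rewrite !cut_sum -!big_split /=; apply: leq_sum => e _; rewrite /cr !inE.
by case: (_ \in X); case: (_ \in Y); case: (_ \in X); case: (_ \in Y).
Qed.

Lemma cut_posimod F X Y :
  #|cut F (X :\: Y)| + #|cut F (Y :\: X)| <= #|cut F X| + #|cut F Y|.
Proof.
rewrite !cut_sum -!big_split /=; apply: leq_sum => e _; rewrite /cr !inE.
by case: (_ \in X); case: (_ \in Y); case: (_ \in X); case: (_ \in Y).
Qed.

Implicit Types Fam : {set {set V}}.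

(** Closure under complement is part of the notion: the cuts do not distinguish the two sides of a
    set, and the degree bound below recurses into both. *)
Definition uncrossable Fam := [/\ set0 \notin Fam, (forall S, S \in Fam -> ~: S \in Fam) &
  forall X Y, X \in Fam -> Y \in Fam -> (X :&: Y \in Fam /\ X :|: Y \in Fam) \/
                                (X :\: Y \in Fam /\ Y :\: X \in Fam)].

Definition mins Fam := [set C in Fam | [forall S in Fam, (S \subset C) ==> (S == C)]].
Definition covers J Fam := forall S, S \in Fam -> cut J S != set0.
Definition witnessed J Fam := forall e, e \in J -> exists2 S, S \in Fam & cut J S = [set e].
Definition inside J S := [set e in J | ((nd e).1 \in S) && ((nd e).2 \in S)].

Lemma minsP Fam C : reflect (C \in Fam /\ forall S, S \in Fam -> S \subset C -> S = C) (C \in mins Fam).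
Proof.
rewrite inE; apply: (iffP andP) => -[CF h]; split=> //.
  by move=> S SF SC; apply/eqP; apply: (implyP (forall_inP h S SF)).
by apply/forall_inP=> S SF; apply/implyP=> SC; rewrite (h S).
Qed.

Lemma mins_below Fam S : S \in Fam -> exists2 C, C \in mins Fam & C \subset S.
Proof.
move=> SF; pose P C := (C \in Fam) && (C \subset S).
have PS : P S by rewrite /P SF subxx.
case: (arg_minnP (fun C : {set V} => #|C|) PS) => C /andP[CF CS] Cmin.
exists C => //; apply/minsP; split=> // X XF XC; apply/eqP; rewrite eqEcard XC.
by apply: Cmin; rewrite /P XF (subset_trans XC).
Qed.

(** Uncrossing [C] with [S] yields a member inside [C], either [C :&: S] or [C :\: S], and
    minimality makes it equal to [C]. *)
Lemma mins_side Fam C S : uncrossable Fam -> C \in mins Fam -> S \in Fam ->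
  (C \subset S) \/ (C \subset ~: S).
Proof.
move=> [_ _ unc] /minsP[CF Cmin] SF; case: (unc C S CF SF) => -[h _].
  by left; apply/setIidPl; apply: Cmin => //; apply: subsetIl.
right; rewrite -disjoints_subset; apply/setDidPl; apply: Cmin => //; apply: subsetDl.
Qed.

Lemma mins_disjoint Fam C D v : uncrossable Fam -> C \in mins Fam -> D \in mins Fam ->
  v \in C -> v \in D -> C = D.
Proof.
move=> unc Cm Dm vC vD; have [CF _] := minsP _ _ Cm; have [DF Dmin] := minsP _ _ Dm.
case: (mins_side unc Cm DF) => [CD|/subsetP/(_ v vC)]; first exact: Dmin.
by rewrite inE vD.
Qed.

Section Split.

Variables (Fam : {set {set V}}) (J : {set E}) (S : {set V}) (e : E).
Hypotheses (unc : uncrossable Fam) (cov : covers J Fam) (wit : witnessed J Fam).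
Hypotheses (SF : S \in Fam) (cS : cut J S = [set e]).

(** [restr] and [Jout] are what remains after contracting [S]: the members that do not separate
    vertices of [S], and the edges of [J] not inside [S]. *)
Definition nosplit (T : {set V}) := (S \subset T) || (S \subset ~: T).
Definition restr := [set T in Fam | nosplit T].
Definition Jout := J :\: inside J S.

Let nosplitC T : nosplit T -> nosplit (~: T).
Proof. by rewrite /nosplit setCK orbC. Qed.

Let nosplitI T U : nosplit T -> nosplit U -> nosplit (T :&: U).
Proof.
rewrite /nosplit setCI subsetI => /orP[a|a] /orP[b|b]; first by rewrite a b.
- by rewrite (subset_trans b (subsetUr _ _)) orbT.
- by rewrite (subset_trans a (subsetUl _ _)) orbT.
- by rewrite (subset_trans a (subsetUl _ _)) orbT.
Qed.

Let in_restr T : (T \in restr) = (T \in Fam) && nosplit T.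
Proof. by rewrite inE. Qed.

Lemma restr_uncrossable : uncrossable restr.
Proof.
have [F0 FC FU] := unc; split.
- by rewrite in_restr (negPf F0).
- by move=> T; rewrite !in_restr => /andP[/FC -> /nosplitC].
- move=> X Y; rewrite !in_restr => /andP[XF Xn] /andP[YF Yn].
  case: (FU X Y XF YF) => -[-> ->] /=; [left | right].
    split; first exact: nosplitI.
    by rewrite -[X :|: Y]setCK setCU; apply: nosplitC; apply: nosplitI; apply: nosplitC.
  by rewrite !setDE; split; apply: nosplitI => //; apply: nosplitC.
Qed.

Lemma cut_Jout T : T \in restr -> cut Jout T = cut J T.
Proof.
rewrite in_restr => /andP[_ nT]; apply/setP=> f; rewrite !inE.
case: (f \in J) => //=; rewrite ?andbF // andbT.
case: (boolP (cr T f)) => cf; rewrite ?andbF // andbT; apply/negP => /andP[h1 h2].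
case/orP: nT => /subsetP s; move: cf; rewrite /cr; have := s _ h1; have := s _ h2; rewrite ?inE.
  by move=> -> ->.
by move=> /negPf -> /negPf ->.
Qed.

Lemma restr_covers : covers Jout restr.
Proof. by move=> T TR; rewrite cut_Jout //; apply: cov; move: TR; rewrite in_restr => /andP[]. Qed.

Lemma restr_self : S \in restr.
Proof. by rewrite in_restr SF /nosplit subxx. Qed.

(** A witness [T] of [f] may split [S], so it is replaced by [T :|: S] or [T :\: S]. After
    uncrossing, the two cut sizes sum to at most 2 and both members are covered, so a single edge
    crosses the new set, and it is [f], whose ends lie outside [S]. *)
Lemma restr_witnessed : witnessed Jout restr.
Proof.
move=> f fJ; have [fe|fe] := eqVneq f e.
  by exists S; [exact: restr_self | rewrite cut_Jout ?restr_self // cS fe].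
have [fJ' fin] : f \in J /\ ~~ (((nd f).1 \in S) && ((nd f).2 \in S)).
  by move: fJ; rewrite !inE; case: (f \in J); rewrite ?andbF //= andbT.
have fcS : cr S f = false.
  by apply: contraNF fe => h; rewrite -in_set1 -cS in_cut fJ'.
have [f1 f2] : (nd f).1 \notin S /\ (nd f).2 \notin S.
  by move: fin fcS; rewrite /cr; case: (_ \in S); case: (_ \in S) => //= _.
have [T TF cT] := wit fJ'.
have fT : cr T f by have := set11 f; rewrite -cT in_cut => /andP[].
have one (X Y : {set V}) : X \in Fam -> Y \in Fam -> #|cut J X| + #|cut J Y| <= 2 -> cr Y f ->
    cut J Y = [set f].
  move=> XF YF le fY; have : 0 < #|cut J X| by rewrite card_gt0 cov.
  have fcY : f \in cut J Y by rewrite in_cut fJ'.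
  move=> h; have : #|cut J Y| <= 1 by move: h le; clear; lia.
  by move/card_le1_eqP => h1; apply/setP=> g; rewrite inE; apply/idP/eqP => [gY|->//]; apply: h1.
have two : #|cut J T| + #|cut J S| = 2 by rewrite cT cS !cards1.
have [_ _ FU] := unc; case: (FU T S TF SF) => -[h1 h2].
  exists (T :|: S); first by rewrite in_restr h2 /nosplit subsetUr.
  rewrite cut_Jout; last by rewrite in_restr h2 /nosplit subsetUr.
  apply: one h1 h2 _ _; first by rewrite -two cut_submod.
  by move: fT; rewrite /cr !inE (negPf f1) (negPf f2) !orbF.
have TS : T :\: S \in restr.
  rewrite in_restr h1 /nosplit; apply/orP; right; apply/subsetP=> v vS.
  by rewrite !inE vS.
exists (T :\: S) => //; rewrite cut_Jout //.
apply: one h2 h1 _ _; first by rewrite addnC -two cut_posimod.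
by move: fT; rewrite /cr !inE (negPf f1) (negPf f2).
Qed.

Lemma restr_mins : mins restr = S |: [set C in mins Fam | C \subset ~: S].
Proof.
have [F0 _ _] := unc.
apply/setP=> C; rewrite in_setU1 [X in _ = _ || X]in_set; apply/idP/idP.
  move=> /minsP[]; rewrite in_restr => /andP[CF /orP[sC|sC]] Cmin.
    by rewrite (Cmin S restr_self sC) eqxx.
  have Cs : C \subset ~: S by rewrite -[C]setCK setCS.
  apply/orP; right; rewrite Cs andbT; apply/minsP; split=> // X XF XC; apply: Cmin => //.
  have sX : S \subset ~: X by apply: subset_trans sC _; rewrite setCS.
  by rewrite in_restr XF /nosplit sX orbT.
case/orP=> [/eqP->|/andP[/minsP[CF Cmin] Cs]]; apply/minsP; split.
- exact: restr_self.
- move=> X; rewrite in_restr => /andP[XF /orP[SX XS|SX XS]].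
    by apply/eqP; rewrite eqEsubset XS.
  case/negP: F0; suff <- : X = set0 by [].
  apply/setP=> v; rewrite inE; apply/negP=> vX.
  by have := subsetP SX v (subsetP XS v vX); rewrite inE vX.
- by rewrite in_restr CF /nosplit orbC -setCS setCK Cs.
- by move=> X; rewrite in_restr => /andP[XF _]; apply: Cmin.
Qed.

Lemma restr_sum : \sum_(C in mins restr) #|cut Jout C| =
  1 + \sum_(C in mins Fam | C \subset ~: S) #|cut J C|.
Proof.
have [F0 _ _] := unc.
have nS : S \notin [set C in mins Fam | C \subset ~: S].
  rewrite in_set; apply/negP=> /andP[_ /subsetP s]; case/negP: F0; suff <- : S = set0 by [].
  by apply/setP=> v; rewrite inE; apply/negP=> vS; have := s v vS; rewrite inE vS.
rewrite restr_mins big_setU1 //= cut_Jout ?restr_self // cS cards1; congr (_ + _).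
rewrite [LHS]big_mkcond [RHS]big_mkcond; apply: eq_bigr => C _.
rewrite [C \in [set _ in _ | _]]in_set; case: ifP => // /andP[Cm Cs]; rewrite cut_Jout //.
have : C \in mins restr by rewrite restr_mins in_setU1 in_set Cm Cs orbT.
by case/minsP.
Qed.

Lemma restr_card : #|mins restr| = 1 + \sum_(C in mins Fam | C \subset ~: S) 1.
Proof.
have [F0 _ _] := unc.
have nS : S \notin [set C in mins Fam | C \subset ~: S].
  rewrite in_set; apply/negP=> /andP[_ /subsetP s]; case/negP: F0; suff <- : S = set0 by [].
  by apply/setP=> v; rewrite inE; apply/negP=> vS; have := s v vS; rewrite inE vS.
by rewrite restr_mins cardsU1 nS sum1dep_card.
Qed.

End Split.

(* Both sides of a witness set inherit the hypotheses, so the bound follows by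
   splitting along witness sets until the cover is a star. *)
Lemma mins_degree_bound Fam J : uncrossable Fam -> covers J Fam -> witnessed J Fam -> J != set0 ->
  \sum_(C in mins Fam) #|cut J C| + 2 <= 2 * #|mins Fam|.
Proof.
have [n] := ubnP #|J|; elim: n Fam J => // n IH Fam J Jn unc cov wit J0.
have [F0 FC FU] := unc.
pose goodS S := [&& S \in Fam, #|cut J S| == 1, inside J S != set0 & inside J (~: S) != set0].
(* A witness set with edges of [J] on both sides splits the instance. The two bounds add up, since
   each contraction contributes just one extra minimal set, of degree 1. *)
have [/existsP[S /and4P[SF /cards1P[e cS] in1 in2]]|/existsPn nogood] := boolP [exists S, goodS S].
  have cS' : cut J (~: S) = [set e] by rewrite cutC.
  have small (X : {set V}) : inside J X != set0 -> #|Jout J X| < n.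
    move=> /set0Pn[f fin]; rewrite ltnS in Jn; apply: leq_trans Jn; apply: proper_card.
    apply/properP; split; first exact: subsetDl.
    by exists f; [move: fin; rewrite inE => /andP[] | rewrite inE fin].
  have ne (X : {set V}) : cut J X = [set e] -> Jout J X != set0.
    move=> cX; have : e \in cut J X by rewrite cX inE.
    rewrite in_cut => /andP[eJ ec]; apply/set0Pn; exists e; rewrite !inE eJ andbT /=.
    by move: ec; rewrite /cr; case: (_ \in X); case: (_ \in X).
  have h1 := IH _ _ (small _ in1) (restr_uncrossable S unc) (restr_covers cov)
    (restr_witnessed unc cov wit SF cS) (ne _ cS).
  have h2 := IH _ _ (small _ in2) (restr_uncrossable (~: S) unc) (restr_covers cov)
    (restr_witnessed unc cov wit (FC _ SF) cS') (ne _ cS').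
  move: h1 h2; rewrite (restr_sum unc SF cS) (restr_sum unc (FC _ SF) cS').
  rewrite (restr_card unc SF) (restr_card unc (FC _ SF)) setCK.
  rewrite [\sum_(C in mins Fam) _](bigID (fun C : {set V} => C \subset S)) /=.
  rewrite -[#|mins Fam|]sum1_card [\sum_(C in mins Fam) 1](bigID (fun C : {set V} => C \subset S)) /=.
  have sd (f : {set V} -> nat) : \sum_(C in mins Fam | ~~ (C \subset S)) f C =
      \sum_(C in mins Fam | C \subset ~: S) f C.
    apply: eq_bigl => C; case: (boolP (C \in mins Fam)) => //= Cm.
    apply/idP/idP => [nC|Cs]; first by case: (mins_side unc Cm SF) => // h; rewrite h in nC.
    apply/negP=> CS; case/negP: F0; suff <- : C = set0 by case/minsP: Cm.
    apply/setP=> v; rewrite inE; apply/negP=> vC; have := subsetP Cs v vC.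
    by rewrite inE (subsetP CS v vC).
  rewrite !sd; move: (\sum_(C in mins Fam | C \subset ~: S) #|cut J C|)
    (\sum_(C in mins Fam | C \subset S) #|cut J C|)
    (\sum_(C in mins Fam | C \subset ~: S) 1) (\sum_(C in mins Fam | C \subset S) 1).
  by clear; lia.
(* Otherwise one side of every witness set spans no edge of [J], and a minimal member inside that
   side is crossed by this edge only: a leaf of the star. *)
have sideP e : e \in J -> exists C, [/\ C \in mins Fam, cut J C = [set e] &
    exists2 S, S \in Fam & C \subset S].
  move=> eJ; have [S SF cS] := wit e eJ.
  have [S' [SF' cS' in0]] : exists S', [/\ S' \in Fam, cut J S' = [set e] & inside J S' = set0].
    have := nogood S; rewrite /goodS SF cS cards1 eqxx /= negb_and !negbK.
    by case/orP=> /eqP h; [exists S | exists (~: S); split; rewrite ?FC ?cutC].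
  have [C Cm CS] := mins_below SF'; exists C; split=> //; last by exists S'.
  have [CF _] := minsP _ _ Cm.
  have all1 g : g \in cut J C -> g = e.
    rewrite in_cut => /andP[gJ gC]; apply/eqP; rewrite -in_set1 -cS' in_cut gJ /=.
    have : g \notin inside J S' by rewrite in0 inE.
    rewrite inE gJ /= /cr; move: gC; rewrite /cr.
    case a1 : ((nd g).1 \in C); case a2 : ((nd g).2 \in C) => //= _.
      by rewrite (subsetP CS _ a1) /=; case: (_ \in S').
    by rewrite (subsetP CS _ a2) andbT; case: (_ \in S').
  have [g gC] := set0Pn _ (cov C CF); have ge := all1 g gC.
  by apply/setP=> x; rewrite inE; apply/idP/eqP => [/all1 //|->]; rewrite -ge.
pose fc e := odflt set0 [pick C in mins Fam | cut J C == [set e]].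
have fcP e : e \in J -> fc e \in mins Fam /\ cut J (fc e) = [set e].
  move=> eJ; rewrite /fc; case: pickP => [C /andP[Cm /eqP cC] //|h].
  by have [C [Cm cC _]] := sideP e eJ; have := h C; rewrite Cm cC eqxx.
have fcI : {in J &, injective fc}.
  move=> e g eJ gJ h; have := (fcP e eJ).2; rewrite h (fcP g gJ).2 => /setP/(_ g).
  by rewrite !inE eqxx => /esym/eqP.
pose L := fc @: J.
have LS : L \subset mins Fam by apply/subsetP=> _ /imsetP[e eJ ->]; case: (fcP e eJ).
have cL : #|L| = #|J| by rewrite card_in_imset.
have sL : \sum_(C in L) #|cut J C| = #|J|.
  rewrite big_imset //= -sum1_card; apply: eq_bigr => e eJ.
  by rewrite (fcP e eJ).2 cards1.
have sumE (f : {set V} -> nat) : \sum_(C in mins Fam) f C =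
    \sum_(C in L) f C + \sum_(C in mins Fam :\: L) f C.
  rewrite (bigID (mem L)) /=; congr (_ + _); apply: eq_bigl => C; rewrite !inE -/(C \in mins Fam).
    by case: (boolP (C \in L)) => [/(subsetP LS)|]; rewrite ?andbF // andbT inE.
  by rewrite andbC.
(* Every edge has one end in its leaf, so it crosses at most one of the remaining minimal sets,
   these being disjoint. *)
have sR : \sum_(C in mins Fam :\: L) #|cut J C| <= #|J|.
  have -> : \sum_(C in mins Fam :\: L) #|cut J C| = \sum_(e in J) \sum_(C in mins Fam :\: L) cr C e.
    by rewrite exchange_big /=; apply: eq_bigr => C _; rewrite cut_sum.
  rewrite -sum1_card; apply: leq_sum => e eJ.
  have [Fm cF] := fcP e eJ.
  have fe : cr (fc e) e by have := set11 e; rewrite -cF in_cut => /andP[].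
  have uq C D : C \in mins Fam :\: L -> D \in mins Fam :\: L -> cr C e -> cr D e -> C = D.
    have out X v : X \in mins Fam :\: L -> v \in X -> v \notin fc e.
      rewrite inE => /andP[XL Xm] vX; apply/negP=> vf; case/negP: XL.
      by rewrite (mins_disjoint unc Xm Fm vX vf); apply: imset_f.
    move=> Cm Dm cC cD; have CM : C \in mins Fam by move: Cm; rewrite inE => /andP[].
    have DM : D \in mins Fam by move: Dm; rewrite inE => /andP[].
    move: fe cC cD; rewrite /cr.
    case a1 : ((nd e).1 \in fc e); case a2 : ((nd e).2 \in fc e) => //= _.
      case c1 : ((nd e).1 \in C); first by have := out _ _ Cm c1; rewrite a1.
      case d1 : ((nd e).1 \in D); first by have := out _ _ Dm d1; rewrite a1.
      by move=> /= h1 h2; apply: (mins_disjoint unc CM DM h1 h2).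
    case c1 : ((nd e).2 \in C); first by have := out _ _ Cm c1; rewrite a2.
    case d1 : ((nd e).2 \in D); first by have := out _ _ Dm d1; rewrite a2.
    by rewrite !addbF => h1 h2; apply: (mins_disjoint unc CM DM h1 h2).
  have [/existsP[C /andP[Cm cC]]|/existsPn h] := boolP [exists C in mins Fam :\: L, cr C e].
    rewrite (bigD1 C) //= big1 => [|D /andP[Dm DC]]; first by rewrite addn0 leq_b1.
    by case: (boolP (cr D e)) => // cD; rewrite (uq D C) ?eqxx in DC.
  by rewrite big1 // => D Dm; have := h D; rewrite Dm /= => /negPf ->.
have cE : #|mins Fam| = #|L| + #|mins Fam :\: L| by rewrite -!sum1_card sumE.
have J1 : 0 < #|J| by rewrite card_gt0.
rewrite sumE sL cE cL; have [R0|R0] := eqVneq (mins Fam :\: L) set0; last first.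
  have : 0 < #|mins Fam :\: L| by rewrite card_gt0.
  by move: sR; clear; lia.
rewrite R0 big_set0 cards0 !addn0.
(* If all minimal sets are leaves, two of them are needed; they come from a minimal member inside a
   set and one inside its complement. *)
suff : 1 < #|J| by clear; lia.
rewrite -cL.
have LE : L = mins Fam by apply/eqP; rewrite eqEsubset LS -setD_eq0 R0 eqxx.
have [e eJ] := set0Pn _ J0; have [S SF _] := wit e eJ.
have [C Cm CS] := mins_below SF; have [D Dm DS] := mins_below (FC _ SF).
have CD : C != D.
  apply: contraNneq F0 => h; suff <- : C = set0 by case/minsP: Cm.
  apply/setP=> v; rewrite inE; apply/negP=> vC; have := subsetP CS v vC; rewrite h in vC.
  by have := subsetP DS v vC; rewrite inE => /negPf ->.
have : [set C; D] \subset L by rewrite LE subUset !sub1set Cm.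
by move/subset_leq_card; rewrite cards2 CD.
Qed.

Definition mdeg Fam e := #|[set C in mins Fam | cr C e]|.

Lemma sum_mdeg Fam J : \sum_(e in J) mdeg Fam e = \sum_(C in mins Fam) #|cut J C|.
Proof.
under [RHS]eq_bigr => C _ do rewrite cut_sum.
rewrite exchange_big /=; apply: eq_bigr => e _.
rewrite /mdeg -sum1_card big_mkcond [RHS]big_mkcond /=; apply: eq_bigr => C _; rewrite inE.
by case: (C \in mins Fam) => //=; case: (cr C e).
Qed.

(** Both sides are compared with the number of minimal members: the degree bound limits the left
    one, and any cover meets each minimal member. *)
Lemma mdeg_cover Fam J O : uncrossable Fam -> covers J Fam -> witnessed J Fam -> covers O Fam ->
  \sum_(e in J) mdeg Fam e <= 2 * \sum_(e in O) mdeg Fam e.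
Proof.
move=> unc cJ wJ cO; have [->|J0] := eqVneq J set0; first by rewrite big_set0.
have h : #|mins Fam| <= \sum_(e in O) mdeg Fam e.
  rewrite sum_mdeg -sum1_card; apply: leq_sum => C /minsP[CF _].
  by rewrite card_gt0; apply: cO.
have := mins_degree_bound unc cJ wJ J0; rewrite -sum_mdeg; move: h; clear; lia.
Qed.

(** This is how the program reads degrees: [mid] labels a vertex by the minimal member containing
    it, with 0 for none. *)
Lemma mdegE Fam (mid : V -> nat) e : uncrossable Fam ->
  (forall v, reflect (exists2 C, C \in mins Fam & v \in C) (mid v != 0)) ->
  (forall C u v, C \in mins Fam -> u \in C -> mid u = mid v <-> v \in C) ->
  mdeg Fam e = if mid (nd e).1 == mid (nd e).2 then 0
               else (mid (nd e).1 != 0) + (mid (nd e).2 != 0).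
Proof.
move=> unc h1 h2; set a := (nd e).1; set b := (nd e).2; rewrite /mdeg.
have half (u v : V) : mid u != mid v ->
    #|[set C in mins Fam | (u \in C) && (v \notin C)]| = (mid u != 0).
  move=> ne; case: h1 => [[C Cm uC]|no].
    have vC : v \notin C by apply: contra ne => /(h2 C u v Cm uC) ->.
    rewrite (_ : [set _ in _ | _] = [set C]) ?cards1 //; apply/setP=> D; rewrite inE [RHS]inE.
    apply/idP/eqP => [/and3P[Dm uD _]|->]; last by rewrite Cm uC.
    exact: mins_disjoint unc Dm Cm uD uC.
  apply/eqP; rewrite cards_eq0; apply/eqP/setP=> D; rewrite [RHS]inE inE; apply/negP=> /and3P[Dm uD _].
  by case: no; exists D.
case: eqP => [ab|/eqP ab].
  apply/eqP; rewrite cards_eq0; apply/eqP/setP=> C; rewrite [RHS]inE inE; apply/negP=> /andP[Cm].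
  rewrite /cr -/a -/b; case aC : (a \in C); case bC : (b \in C) => //= _.
    by have /(h2 C a b Cm aC) := ab; rewrite bC.
  by have /(h2 C b a Cm bC) := esym ab; rewrite aC.
rewrite -(half a b) // -(half b a); last by rewrite eq_sym.
rewrite -cardsUI (_ : [set _ in _ | _] :&: _ = set0) ?cards0 ?addn0.
  apply: eq_card => C; rewrite !inE /cr -/a -/b.
  by case: (a \in C); case: (b \in C); rewrite ?andbF ?andbT ?orbF.
apply/setP=> C; rewrite !inE; by case: (a \in C); case: (b \in C); rewrite ?andbF.
Qed.

Lemma mdeg_le2 Fam e : uncrossable Fam -> mdeg Fam e <= 2.
Proof.
move=> unc; pose g v := [set C in mins Fam | v \in C].
have g1 v : #|g v| <= 1.
  apply/card_le1_eqP => C D; rewrite in_set => /andP[Cm vC]; rewrite in_set => /andP[Dm vD].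
  exact: mins_disjoint unc Dm Cm vD vC.
apply: (@leq_trans #|g (nd e).1 :|: g (nd e).2|).
  apply: subset_leq_card; apply/subsetP=> C; rewrite in_set => /andP[Cm]; rewrite in_setU ![_ \in g _]in_set Cm /cr.
  by case: (_ \in C); case: (_ \in C).
by apply: leq_trans (leq_card_setU _ _).1 _; have := g1 (nd e).1; have := g1 (nd e).2; clear; lia.
Qed.

(** Twice the cost splits into [c'] and [rho] times the degree. The degree part has ratio 2 by
    [mdeg_cover], the other part by hypothesis. Passing from [J0] to [J1] loses nothing, because
    [e0] is free under [c']. *)
Lemma local_ratio_step Fam (c c' : E -> nat) rho J0 J1 e0 J' O :
  uncrossable Fam -> J1 = e0 |: J0 -> c' e0 = 0 ->
  (forall e, e \in (J' :|: O) :\: J0 -> c' e + rho * mdeg Fam e = 2 * c e) ->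
  covers (J' :\: J0) Fam -> witnessed (J' :\: J0) Fam -> covers (O :\: J0) Fam ->
  \sum_(e in J' :\: J1) c' e <= 2 * \sum_(e in O :\: J1) c' e ->
  \sum_(e in J' :\: J0) c e <= 2 * \sum_(e in O :\: J0) c e.
Proof.
move=> unc J1E c0 cE cJ wJ cO le.
have drop (X : {set E}) : \sum_(e in X :\: J1) c' e = \sum_(e in X :\: J0) c' e.
  rewrite big_mkcond [RHS]big_mkcond; apply: eq_bigr => e _; rewrite J1E !inE.
  by have [->|] := eqVneq e e0; rewrite //= c0 if_same.
have dbl (X : {set E}) : X \subset J' :|: O -> 2 * \sum_(e in X :\: J0) c e =
    \sum_(e in X :\: J0) c' e + rho * \sum_(e in X :\: J0) mdeg Fam e.
  move=> /subsetP sX; rewrite !big_distrr /= -big_split /=; apply: eq_bigr => e; rewrite inE => /andP[e0J eX].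
  by rewrite cE // inE e0J sX.
have := mdeg_cover unc cJ wJ cO.
have := dbl J' (subsetUl _ _); have := dbl O (subsetUr _ _); move: le; rewrite !drop.
move: (\sum_(e in J' :\: J0) c e) (\sum_(e in O :\: J0) c e) (\sum_(e in J' :\: J0) c' e)
  (\sum_(e in O :\: J0) c' e) (\sum_(e in J' :\: J0) mdeg Fam e) (\sum_(e in O :\: J0) mdeg Fam e).
clear => x y x' y' p q h1 h2 h3 h4.
have : rho * p <= rho * (2 * q) by rewrite leq_mul2l h4 orbT.
lia.
Qed.

End Cuts.

(** * Violated cuts and feasibility *)

Section Violated.

Variables (V E : finType) (nd : E -> V * V) (k : nat) (H safe : {set E}).
Hypothesis Hk : forall S : {set V}, S != set0 -> S != setT -> k <= #|cut nd H S|.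

Definition viol (J : {set E}) := [set S : {set V} | [&& S != set0, S != setT, #|cut nd H S| == k,
  [exists e in cut nd H S, e \notin safe] & cut nd J S == set0]].

Lemma violP J S : reflect [/\ S != set0, S != setT, #|cut nd H S| = k,
  (exists2 e, e \in cut nd H S & e \notin safe) & cut nd J S = set0] (S \in viol J).
Proof.
rewrite inE; apply: (iffP and5P) => [[h1 h2 /eqP h3 /existsP[e /andP[h4 h5]] /eqP h6]|].
  by split=> //; exists e.
by case=> h1 h2 /eqP h3 [e h4 h5] /eqP h6; split=> //; apply/existsP; exists e; rewrite h4.
Qed.

Lemma sum_leq_eq (A : {set E}) (f g : E -> nat) : (forall e, f e <= g e) ->
  \sum_(e in A) g e <= \sum_(e in A) f e -> forall e, e \in A -> f e = g e.
Proof.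
move=> fg le e eA; apply/eqP; rewrite eqn_leq fg /=; move: le.
rewrite !(big_setD1 e eA) /= => le.
have : \sum_(x in A :\ e) f x <= \sum_(x in A :\ e) g x by apply: leq_sum.
by move: le; clear; lia.
Qed.

(** When no corner is trivial, sub- and posimodularity force all four corner cuts to have size [k],
    with equality edge by edge, which forbids diagonal edges. The unsafe edges of [X] and [Y] then
    lie on two corners each, and in all four cases one of the two pairs has an unsafe edge on both
    members. *)
Lemma viol_uncrossable J : uncrossable (viol J).
Proof.
split; first by rewrite inE eqxx.
  move=> S /violP[h1 h2 h3 h4 h5]; apply/violP; rewrite !cutC; split=> //.
    by apply: contra h2 => /eqP h; rewrite -[S]setCK h setC0.
  by apply: contra h1 => /eqP h; rewrite -[S]setCK h setCT.
move=> X Y XF YF.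
have [X0 XT cX [x xc xs] jX] := violP _ _ XF; have [Y0 YT cY [y yc ys] jY] := violP _ _ YF.
have symF S : S \in viol J -> ~: S \in viol J.
  move=> /violP[h1 h2 h3 h4 h5]; apply/violP; rewrite !cutC; split=> //.
    by apply: contra h2 => /eqP h; rewrite -[S]setCK h setC0.
  by apply: contra h1 => /eqP h; rewrite -[S]setCK h setCT.
(* With a degenerate corner, one of the two pairs consists of [X] and [Y], or of their
   complements. *)
have [I0|I0] := eqVneq (X :&: Y) set0.
  right; have -> : X :\: Y = X by apply/setDidPl; rewrite -setI_eq0 I0.
  by have -> : Y :\: X = Y by apply/setDidPl; rewrite -setI_eq0 setIC I0.
have [UT|UT] := eqVneq (X :|: Y) setT.
  have mem v : (v \in X) || (v \in Y) by rewrite -in_setU UT inE.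
  right; have -> : X :\: Y = ~: Y.
    by apply/setP=> v; rewrite !inE; have := mem v; case: (v \in X); case: (v \in Y).
  have -> : Y :\: X = ~: X.
    by apply/setP=> v; rewrite !inE; have := mem v; case: (v \in X); case: (v \in Y).
  by split; apply: symF.
have [D0|D0] := eqVneq (X :\: Y) set0.
  have sXY : X \subset Y by rewrite -setD_eq0 D0.
  by left; rewrite (setIidPl sXY) (setUidPr sXY).
have [D1|D1] := eqVneq (Y :\: X) set0.
  have sXY : Y \subset X by rewrite -setD_eq0 D1.
  by left; rewrite (setIidPr sXY) (setUidPl sXY).
have IT : X :&: Y != setT by apply: contra XT => /eqP h; rewrite -subTset -h subsetIl.
have U0 : X :|: Y != set0 by apply: contra X0; rewrite setU_eq0 => /andP[].
have DT : X :\: Y != setT by apply: contra XT => /eqP h; rewrite -subTset -h subsetDl.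
have DT1 : Y :\: X != setT by apply: contra YT => /eqP h; rewrite -subTset -h subsetDl.
have s1 := cut_submod nd H X Y; have s2 := cut_posimod nd H X Y; rewrite cX cY in s1 s2.
have k1 := Hk I0 IT; have k2 := Hk U0 UT; have k3 := Hk D0 DT; have k4 := Hk D1 DT1.
have [e1 e2] : #|cut nd H (X :&: Y)| = k /\ #|cut nd H (X :|: Y)| = k.
  by move: s1 k1 k2; clear; lia.
have [e3 e4] : #|cut nd H (X :\: Y)| = k /\ #|cut nd H (Y :\: X)| = k.
  by move: s2 k3 k4; clear; lia.
have pw1 := @sum_leq_eq H (fun e => cr nd (X :&: Y) e + cr nd (X :|: Y) e)
  (fun e => cr nd X e + cr nd Y e).
have pw2 := @sum_leq_eq H (fun e => cr nd (X :\: Y) e + cr nd (Y :\: X) e)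
  (fun e => cr nd X e + cr nd Y e).
have {}pw1 e : e \in H -> cr nd (X :&: Y) e + cr nd (X :|: Y) e = cr nd X e + cr nd Y e.
  apply: pw1 => [f|]; last by rewrite !big_split /= -!cut_sum e1 e2 cX cY.
  rewrite /cr !inE; by case: (_ \in X); case: (_ \in Y); case: (_ \in X); case: (_ \in Y).
have {}pw2 e : e \in H -> cr nd (X :\: Y) e + cr nd (Y :\: X) e = cr nd X e + cr nd Y e.
  apply: pw2 => [f|]; last by rewrite !big_split /= -!cut_sum e3 e4 cX cY.
  rewrite /cr !inE; by case: (_ \in X); case: (_ \in Y); case: (_ \in X); case: (_ \in Y).
have noJ (Z : {set V}) : (forall e, cr nd Z e -> cr nd X e || cr nd Y e) -> cut nd J Z = set0.
  move=> h; apply/setP=> e; rewrite [RHS]inE in_cut; apply/negP=> /andP[eJ /h /orP[] c].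
    by have := in_cut nd J X e; rewrite jX inE eJ c.
  by have := in_cut nd J Y e; rewrite jY inE eJ c.
have j1 : cut nd J (X :&: Y) = set0.
  apply: noJ => e; rewrite /cr !inE; by case: (_ \in X); case: (_ \in Y); case: (_ \in X); case: (_ \in Y).
have j2 : cut nd J (X :|: Y) = set0.
  apply: noJ => e; rewrite /cr !inE; by case: (_ \in X); case: (_ \in Y); case: (_ \in X); case: (_ \in Y).
have j3 : cut nd J (X :\: Y) = set0.
  apply: noJ => e; rewrite /cr !inE; by case: (_ \in X); case: (_ \in Y); case: (_ \in X); case: (_ \in Y).
have j4 : cut nd J (Y :\: X) = set0.
  apply: noJ => e; rewrite /cr !inE; by case: (_ \in X); case: (_ \in Y); case: (_ \in X); case: (_ \in Y).
move: xc yc; rewrite !in_cut => /andP[xH xX] /andP[yH yY].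
have W (Z : {set V}) e : Z != set0 -> Z != setT -> #|cut nd H Z| = k -> cut nd J Z = set0 ->
    e \in H -> e \notin safe -> cr nd Z e -> Z \in viol J.
  by move=> *; apply/violP; split=> //; exists e; rewrite ?in_cut //; apply/andP.
have px1 := pw1 x xH; have px2 := pw2 x xH; have py1 := pw1 y yH; have py2 := pw2 y yH.
have cx : cr nd (X :&: Y) x && cr nd (Y :\: X) x || cr nd (X :\: Y) x && cr nd (X :|: Y) x.
  move: xX px1 px2; rewrite /cr !inE.
  by case: (_ \in X); case: (_ \in Y); case: (_ \in X); case: (_ \in Y).
have cy : cr nd (X :&: Y) y && cr nd (X :\: Y) y || cr nd (Y :\: X) y && cr nd (X :|: Y) y.
  move: yY py1 py2; rewrite /cr !inE.
  by case: (_ \in X); case: (_ \in Y); case: (_ \in X); case: (_ \in Y).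
case/orP: cx => /andP[x1 x2]; case/orP: cy => /andP[y1 y2].
- by right; split; [apply: (W _ y) | apply: (W _ x)].
- by left; split; [apply: (W _ x) | apply: (W _ y)].
- by left; split; [apply: (W _ y) | apply: (W _ x)].
- by right; split; [apply: (W _ x) | apply: (W _ y)].
Qed.

(** A part [X] without such an edge would give two cuts, of [X] and [S :\: X], with at least [k]
    edges each but only the [k] edges of the cut of [S] to share. So [S] is a component of [H] minus
    its cut, which makes violated sets enumerable. *)
Lemma viol_connected J S : 0 < k -> S \in viol J -> forall X : {set V}, X != set0 -> X \proper S ->
  [exists e in H :\: cut nd H S, cr nd X e].
Proof.
move=> k0 /violP[S0 ST cS _ _] X X0 XS; apply/existsPn => h.
have [sXS [v vS vX]] := properP XS.
have SX0 : S :\: X != set0 by apply/set0Pn; exists v; rewrite inE vX.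
have XT : X != setT by apply: contraNneq vX => ->; rewrite inE.
have SXT : S :\: X != setT by apply: contra ST => /eqP h'; rewrite -subTset -h' subsetDl.
have k1 := Hk X0 XT; have k2 := Hk SX0 SXT.
have : #|cut nd H X| + #|cut nd H (S :\: X)| <= #|cut nd H S|.
  rewrite !cut_sum -big_split /=; apply: leq_sum => e eH.
  have := h e; rewrite !inE eH andbT /=; rewrite /cr !inE.
  have s1 := subsetP sXS (nd e).1; have s2 := subsetP sXS (nd e).2.
  case a1 : ((nd e).1 \in X) s1; case a2 : ((nd e).2 \in X) s2;
    case b1 : ((nd e).1 \in S); case b2 : ((nd e).2 \in S) => //= s1 s2 //;
    try (by have := s1 isT); try (by have := s2 isT).
rewrite cS; move: k1 k2 k0; clear; lia.
Qed.

End Violated.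

Lemma feasible_cutP k (I : fgc_instance) (F : {set 'I_(nE I)}) :
  feasible k 1 I F <-> (forall S, S != set0 -> S != setT -> k <= #|cut (ends I) F S| /\
    forall e, e \in cut (ends I) F S -> e \notin safe I -> k < #|cut (ends I) F S|).
Proof.
split=> [fe S S0 ST|h F' Fu F1].
  split=> [|e ec es].
    have /edge_connected_cutP/(_ S S0 ST) := fe set0 (sub0set _) ltac:(by rewrite cards0).
    by rewrite setD0.
  have u1 : [set e] \subset ~: safe I by rewrite sub1set inE.
  have /edge_connected_cutP/(_ S S0 ST) := fe [set e] u1 ltac:(by rewrite cards1).
  have -> : cut (ends I) (F :\ e) S = cut (ends I) F S :\ e.
    by apply/setP=> f; rewrite !inE andbA.
  by rewrite (cardsD1 e (cut _ F S)) ec add1n ltnS.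
apply/edge_connected_cutP => S S0 ST; have [h1 h2] := h S S0 ST.
have [->|/set0Pn[e eF]] := eqVneq F' set0; first by rewrite setD0.
have FE : F' = [set e].
  by apply/eqP; rewrite eq_sym eqEcard sub1set eF cards1.
have es : e \notin safe I by have := subsetP Fu e eF; rewrite inE.
have -> : cut (ends I) (F :\: F') S = cut (ends I) F S :\ e.
  by apply/setP=> f; rewrite FE !inE andbA.
have := cardsD1 e (cut (ends I) F S); case: (boolP (e \in _)) => ec /=.
  by have := h2 e ec es; move=> + E; rewrite E ltnS.
by rewrite add0n => <-.
Qed.

Lemma feasible_union k (I : fgc_instance) (H J : {set 'I_(nE I)}) :
  (forall S, S != set0 -> S != setT -> k <= #|cut (ends I) H S|) ->
  covers (ends I) J (viol (ends I) k H (safe I) set0) -> [disjoint J & H] ->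
  feasible k 1 I (H :|: J).
Proof.
move=> Hk cov dis; apply/feasible_cutP => S S0 ST.
have cE : #|cut (ends I) (H :|: J) S| = #|cut (ends I) H S| + #|cut (ends I) J S|.
  rewrite -cardsUI (_ : _ :&: _ = set0) ?cards0 ?addn0.
    by apply: eq_card => e; rewrite !inE andb_orl.
  apply/setP=> e; rewrite !inE; apply/negP=> /andP[/andP[eH _] /andP[eJ _]].
  by rewrite (disjointFr dis eJ) in eH.
have h := Hk S S0 ST; rewrite cE; split; first by apply: leq_trans h (leq_addr _ _).
move=> e; rewrite in_cut in_setU => /andP[eHJ ce] es.
have [hk|hk] := ltnP k #|cut (ends I) H S|; first by apply: leq_trans hk (leq_addr _ _).
have ek : #|cut (ends I) H S| = k by apply/eqP; rewrite eqn_leq hk h.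
rewrite ek -addn1 leq_add2l card_gt0; case/orP: eHJ => [eH|eJ].
  apply: cov; apply/violP; split=> //; first by exists e; rewrite // in_cut eH.
  by apply/setP=> f; rewrite !inE.
by apply/set0Pn; exists e; rewrite in_cut eJ.
Qed.

(** If [O] had no other edge across a violated [S], its cut would be exactly the [k]-edge cut of
    [H], unsafe edge included, against feasibility. *)
Lemma feasible_covers k (I : fgc_instance) (H O J : {set 'I_(nE I)}) : feasible k 1 I O ->
  covers (ends I) (O :\: H :\: J) (viol (ends I) k H (safe I) J).
Proof.
move=> /feasible_cutP fO S /violP[S0 ST cS [e ec es] jS].
have [h1 h2] := fO S S0 ST; apply/eqP=> c0.
have sub : cut (ends I) O S \subset cut (ends I) H S.
  apply/subsetP=> f; rewrite !in_cut => /andP[fO' fc]; rewrite fc andbT.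
  apply/negPn/negP=> fH; have : f \in cut (ends I) (O :\: H :\: J) S.
    rewrite in_cut !inE fO' fH fc !andbT /=; apply/negP=> fJ.
    by have := in_cut (ends I) J S f; rewrite jS inE fJ fc.
  by rewrite c0 inE.
have E : cut (ends I) O S = cut (ends I) H S by apply/eqP; rewrite eqEcard sub cS.
by have := h2 e; rewrite E ec => /(_ isT es); rewrite cS ltnn.
Qed.

(** * Program idioms: reachability, search, minimum *)

Definition XNot e := XIf e (XN 0) (XN 1).
Definition XAnd e f := XIf e f (XN 0).
Definition XOr e f := XIf e (XN 1) f.
Definition XAdd := XOp OAdd.
Definition XSub := XOp OSub.
Definition XDiv := XOp ODiv.
Definition XEq e f := XNot (XAdd (XSub e f) (XSub f e)).
Definition XLt e f := XSub f e.
Definition XLe e f := XNot (XSub e f).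
Definition XB e := XIf e (XN 1) (XN 0).
Definition XAny x b e := XS x b (XB e).
Definition XBd b := XMB (XN 1) b.
Definition XMod e b := XSub e (XMB (XDiv e (XBd b)) b).
Definition XG0 a := XG a (XN 0).

Definition tv env s e := ev env s e != 0.

Lemma tvNot env s e : tv env s (XNot e) = ~~ tv env s e.
Proof. by rewrite /tv /=; case: (ev env s e != 0). Qed.
Lemma tvAnd env s e f : tv env s (XAnd e f) = tv env s e && tv env s f.
Proof. by rewrite /tv /=; case: (ev env s e != 0). Qed.
Lemma tvOr env s e f : tv env s (XOr e f) = tv env s e || tv env s f.
Proof. by rewrite /tv /=; case: (ev env s e != 0). Qed.
Lemma tvEq env s e f : tv env s (XEq e f) = (ev env s e == ev env s f).
Proof. rewrite /XEq tvNot /tv /=; lia. Qed.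
Lemma tvLt env s e f : tv env s (XLt e f) = (ev env s e < ev env s f).
Proof. rewrite /tv /=; lia. Qed.
Lemma tvLe env s e f : tv env s (XLe e f) = (ev env s e <= ev env s f).
Proof. rewrite /XLe tvNot /tv /=; lia. Qed.
Lemma tvB env s e : tv env s (XB e) = tv env s e.
Proof. by rewrite /tv /=; case: (ev env s e != 0). Qed.
Lemma tvG env s a e : tv env s (XG a e) = (s a (ev env s e) != 0).
Proof. by []. Qed.
Lemma evB env s e : ev env s (XB e) = tv env s e.
Proof. by rewrite /tv /=; case: (ev env s e != 0). Qed.
Lemma evS env s x b e : ev env s (XS x b e) = \sum_(i < bval b s) ev (upd env x i) s e.
Proof. by []. Qed.
Lemma evIf env s e f g : ev env s (XIf e f g) = if tv env s e then ev env s f else ev env s g.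
Proof. by []. Qed.

Lemma sum_nat_neq0 n (f : 'I_n -> nat) : (\sum_(i < n) f i != 0) = [exists i, f i != 0].
Proof.
apply/idP/existsP => [h|[i fi]]; last by rewrite (bigD1 i) //= addn_eq0 (negPf fi).
apply/existsP; apply: contraNT h => /existsPn h.
by rewrite big1 // => i _; apply/eqP; have := h i; rewrite negbK.
Qed.

Lemma tvAny env s x b e :
  tv env s (XAny x b e) = [exists i : 'I_(bval b s), tv (upd env x i) s e].
Proof.
rewrite /tv /XAny evS sum_nat_neq0; apply: eq_existsb => i.
exact: tvB.
Qed.

Definition tvE := (tvNot, tvAnd, tvOr, tvEq, tvLt, tvLe, tvB, tvG, tvAny).

(** * Breadth-first layers by iteration *)

Section Layers.

Variables (N : nat) (srcf : pred 'I_N) (relf : rel 'I_N).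

Definition layer_step (X : {set 'I_N}) := [set j | srcf j || [exists i in X, relf i j]].
Definition layer i := iter i layer_step set0.
(** This is [N] minus the distance from the sources, and 0 for unreachable vertices. Counting the
    rounds in which [j] is already reached lets the program obtain it by adding a bit per round. *)
Definition closeness j := \sum_(i < N) (j \in layer i.+1).

Lemma layer_mono : {homo layer_step : X Y / X \subset Y}.
Proof.
move=> X Y /subsetP s; apply/subsetP=> j; rewrite !inE => /orP[-> //|/existsP[i /andP[iX r]]].
by apply/orP; right; apply/existsP; exists i; rewrite s.
Qed.

Lemma layer_fix : layer_step (layer N) = layer N.
Proof. by have := fixsetK layer_mono; rewrite /fixset card_ord. Qed.

Lemma layerS i : layer i \subset layer i.+1.
Proof. by elim: i => [|i IH]; [apply: sub0set | apply: layer_mono]. Qed.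

Lemma layer_leq i j : i <= j -> layer i \subset layer j.
Proof.
elim: j => [|j IH]; first by rewrite leqn0 => /eqP ->.
by rewrite leq_eqVlt => /orP[/eqP-> //|/IH h]; apply: subset_trans h (layerS j).
Qed.

Lemma layerP j : (j \in layer N) = [exists i, srcf i && connect relf i j].
Proof.
apply/idP/existsP => [|[i /andP[si /connectP[p hp ->]]]].
  suff H m : forall l, l \in layer m -> exists i, srcf i && connect relf i l by apply: H.
  elim: m {j} => [|m IH] j; first by rewrite inE.
  rewrite /layer /= inE => /orP[sj|/existsP[i /andP[/IH[l /andP[sl cl]] r]]].
    by exists j; rewrite sj connect0.
  by exists l; rewrite sl (connect_trans cl (connect1 r)).
have iN : i \in layer N by rewrite -layer_fix inE si.
elim: p i iN hp {si} => //= x p IH i iN /andP[rx hp]; apply: IH hp.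
by rewrite -layer_fix inE; apply/orP; right; apply/existsP; exists i; rewrite iN.
Qed.

Lemma closeness_mem m j : m <= N -> (j \in layer m) = (N - m < closeness j).
Proof.
case: m => [|m] mN.
  rewrite inE subn0; symmetry; apply/negbTE; rewrite -leqNgt /closeness.
  rewrite -[X in _ <= X]card_ord -sum1_card; apply: leq_sum => i _; exact: leq_b1.
rewrite /closeness; apply/idP/idP => h.
  have : \sum_(i < N) (m <= i) <= \sum_(i < N) (j \in layer i.+1).
    apply: leq_sum => i _; case: (boolP (m <= i)) => // mi.
    by have -> : j \in layer i.+1 by apply: (subsetP (layer_leq _) j h); rewrite ltnS.
  apply: leq_trans; rewrite -(big_mkord xpredT (fun i => nat_of_bool (m <= i))).
  rewrite (@big_cat_nat _ _ _ m) //=; last exact: ltnW.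
  rewrite [X in _ < _ + X](eq_big_nat _ _ (F2 := fun=> 1)) => [|i /andP[-> //]].
  by rewrite sum_nat_const_nat muln1; move: mN; clear; lia.
rewrite ltnNge in h *; apply: contraNT h => njm.
have : \sum_(i < N) (j \in layer i.+1) <= \sum_(i < N) (m < i).
  apply: leq_sum => i _; case: (boolP (j \in layer i.+1)) => // ji.
  case: (boolP (m < i)) => //; rewrite -leqNgt => im; case/negP: njm.
  by apply: (subsetP (layer_leq _) j ji); rewrite ltnS.
move/leq_trans; apply; rewrite -(big_mkord xpredT (fun i => nat_of_bool (m < i))).
rewrite (@big_cat_nat _ _ _ m.+1) //=.
rewrite [X in X + _](eq_big_nat _ _ (F2 := fun=> 0)) => [|i /andP[_ h]]; last by rewrite ltnNge -ltnS h.
rewrite [X in _ + X](eq_big_nat _ _ (F2 := fun=> 1)) => [|i /andP[-> //]].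
by rewrite !sum_nat_const_nat muln0 muln1 add0n.
Qed.

Lemma closeness_le j : closeness j <= N.
Proof.
rewrite /closeness -[X in _ <= X]card_ord -sum1_card; apply: leq_sum => i _; exact: leq_b1.
Qed.

Lemma closeness_gt0 j : (0 < closeness j) = (j \in layer N).
Proof. by rewrite closeness_mem // subnn. Qed.

Lemma closeness_src j : srcf j -> closeness j = N.
Proof.
move=> sj; apply/eqP; rewrite eqn_leq closeness_le /=.
case: (posnP N) => [-> //|N0]; have : j \in layer 1 by rewrite /layer /= inE sj.
by rewrite closeness_mem //; move: N0; clear; lia.
Qed.

Lemma closeness_rel i j : relf i j -> closeness i <= (closeness j).+1 /\
  (0 < closeness i -> 0 < closeness j).
Proof.
move=> rij; case: (posnP (closeness i)) => [-> //|q0].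
have qN := closeness_le i; set q := closeness i in q0 qN *.
have st m : i \in layer m -> j \in layer m.+1.
  by move=> im; rewrite /layer /= inE; apply/orP; right; apply/existsP; exists i; rewrite im.
have im : i \in layer (N - q).+1 by rewrite closeness_mem -/q; move: q0 qN; clear; lia.
have jN : 0 < closeness j.
  rewrite closeness_gt0 -layer_fix; apply: st; rewrite -closeness_gt0; exact: q0.
split=> //; have [q1|q1] := leqP q 1; first by move: q1 jN; clear; lia.
have := st _ im; rewrite closeness_mem; move: q0 qN q1 jN; clear; lia.
Qed.

Lemma closeness_pred j : 0 < closeness j -> ~~ srcf j ->
  exists2 i, relf i j & closeness i = (closeness j).+1.
Proof.
move=> q0 nsj; have qN := closeness_le j; set q := closeness j in q0 qN *.
have jm : j \in layer (N - q).+1 by rewrite closeness_mem -/q; move: q0 qN; clear; lia.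
move: jm; rewrite /layer /= inE (negPf nsj) /= => /existsP[i /andP[im rij]].
exists i => //; have [h _] := closeness_rel rij.
have : N - (N - q) < closeness i by rewrite -closeness_mem ?leq_subr.
by move: h qN; rewrite -/q; clear; lia.
Qed.

End Layers.

(** [w] counts rounds, [u] ranges over the updated vertices and [v] over possible predecessors. The
    specification asks that [src] and [rl] not depend on the arrays [R] and [LV]. *)
Definition Reach (R LV w u v : nat) (b : bnd) (src rl : rx) : rs :=
  RSeq (RSeq (RPar u R b (XN 0)) (RPar u LV b (XN 0)))
   (RRep w b (RSeq (RPar u R b (XB (XOr src (XAny v b (XAnd (XG R (XV v)) rl)))))
                   (RPar u LV b (XAdd (XG LV (XV u)) (XG R (XV u)))))).

Lemma bval0 s s' b : (forall i, s' 0 i = s 0 i) -> bval b s' = bval b s.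
Proof. exact: eval_bexpr_ext. Qed.

Lemma rPar_in env x a b e s j : j < bval b s ->
  rrun env (RPar x a b e) s a j = ev (upd env x j) s e.
Proof. by move=> /= ->; rewrite eqxx. Qed.

Lemma rSeq env c1 c2 s : rrun env (RSeq c1 c2) s = rrun env c2 (rrun env c1 s).
Proof. by []. Qed.

Lemma rIf env e c1 c2 s :
  rrun env (RIf e c1 c2) s = if tv env s e then rrun env c1 s else rrun env c2 s.
Proof. by []. Qed.

Lemma rSet env a e1 e2 s : rrun env (RSet a e1 e2) s = update s a (ev env s e1) (ev env s e2).
Proof. by []. Qed.

Lemma Reach_spec (R LV w u v : nat) b (src rl : rx) env (s : store) N (srcf : pred 'I_N) (relf : rel 'I_N) :
  R != LV -> R != 0 -> LV != 0 -> u != v -> bval b s = N ->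
  (forall (s' : store) i (j : 'I_N), (forall a l, a != R -> a != LV -> s' a l = s a l) ->
     tv (upd (upd env w i) u j) s' src = srcf j) ->
  (forall (s' : store) i (j l : 'I_N), (forall a l, a != R -> a != LV -> s' a l = s a l) ->
     tv (upd (upd (upd env w i) u j) v l) s' rl = relf l j) ->
  let s' := rrun env (Reach R LV w u v b src rl) s in
  (forall j : 'I_N, (s' R j != 0) = (j \in layer srcf relf N)) /\
  (forall j : 'I_N, s' LV j = closeness srcf relf j).
Proof.
move=> RL R0 L0 uv bN Hs Hr; rewrite /Reach; set body := RSeq _ (RPar u LV b (XAdd _ _)).
set s1 := rrun env (RSeq (RPar u R b (XN 0)) (RPar u LV b (XN 0))) s.
have ag1 a l : a != R -> a != LV -> s1 a l = s a l.
  by move=> aR aL; rewrite /s1 rframe //= negb_or aR aL.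
have b1 : bval b s1 = N by rewrite -bN; apply: bval0 => i; apply: ag1; rewrite eq_sym.
pose Inv i s' := [/\ forall a l, a != R -> a != LV -> s' a l = s a l,
  forall j : 'I_N, s' R j = (j \in layer srcf relf i) &
  forall j : 'I_N, s' LV j = \sum_(l < i) (j \in layer srcf relf l.+1)].
suff [I1 I2 I3] : Inv N (rrun env (RRep w b body) s1).
  split=> j; last exact: I3.
  by rewrite -[rrun _ _ _]/(rrun env (RRep w b body) s1) I2; case: (_ \in _).
have bE s' : (forall a l, a != R -> a != LV -> s' a l = s a l) -> bval b s' = N.
  by move=> ag; rewrite -bN; apply: bval0 => i; apply: ag; rewrite eq_sym.
rewrite -{1}b1; apply: rep_ind.
  split=> //= j; rewrite /s1 /= ?eqxx /=.
    by rewrite (negPf RL) /= bN ltn_ord inE.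
  by rewrite bE ?ltn_ord ?big_ord0 // => a l aR aL; rewrite /= (negPf aR).
rewrite b1 => i s' iN [ag hR hL]; rewrite /body rSeq.
set s2 := rrun _ (RPar u R _ _) s'.
have ag2 a l : a != R -> a != LV -> s2 a l = s a l.
  by move=> aR aL; rewrite /s2 rframe ?ag.
have R2 (j : 'I_N) : s2 R j = (j \in layer srcf relf i.+1).
  rewrite /s2 rPar_in ?bE // evB tvOr tvAny Hs //.
  rewrite /layer /= inE; congr (nat_of_bool (_ || _)).
  rewrite bE //; apply: eq_existsb => l; rewrite tvAnd tvG Hr //=.
  by rewrite /upd eqxx hR; case: (l \in _).
split.
- by move=> a l aR aL; rewrite rframe ?ag2.
- by move=> j; rewrite rframe ?R2.
- move=> j; rewrite rPar_in ?bE // big_ord_recr /= /upd eqxx R2 /s2.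
  by rewrite rframe ?hL //= eq_sym.
Qed.

(** The index is stored plus one, so that 0 can mean failure; later matches overwrite earlier
    ones. *)
Definition Find (a x : nat) (b : bnd) (P : rx) : rs :=
  RSeq (RSet a (XN 0) (XN 0)) (RRep x b (RIf P (RSet a (XN 0) (XAdd (XV x) (XN 1))) RSkip)).

Inductive find_result (N : nat) (P : pred 'I_N) : nat -> Prop :=
  | Found i of P i : find_result P i.+1
  | NotFound of (forall i, ~~ P i) : find_result P 0.

Lemma Find_spec a x b P env s N (Pf : pred 'I_N) : a != 0 -> bval b s = N ->
  (forall (s' : store) (i : 'I_N), (forall c l, c != a -> s' c l = s c l) -> tv (upd env x i) s' P = Pf i) ->
  find_result Pf (rrun env (Find a x b P) s a 0).
Proof.
move=> a0 bN HP; rewrite /Find; set s1 := rrun env (RSet a (XN 0) (XN 0)) s.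
have ag1 c l : c != a -> s1 c l = s c l by move=> ca; rewrite /s1 /= update_diff.
have b1 : bval b s1 = N by rewrite -bN; apply: bval0 => i; apply: ag1; rewrite eq_sym.
pose Inv i s' := (forall c l, c != a -> s' c l = s c l) /\
  ((exists2 j : 'I_N, Pf j & s' a 0 = j.+1) \/ (s' a 0 = 0 /\ forall j : 'I_N, j < i -> ~~ Pf j)).
rewrite rSeq -/s1; suff [_ [[j Pj ->]|[-> h]]] : Inv N (rrun env (RRep x b (RIf P (RSet a (XN 0) (XAdd (XV x) (XN 1))) RSkip)) s1).
- exact: Found.
- by apply: NotFound => i; apply: h.
rewrite -{1}b1; apply: rep_ind; first by split=> //; right; rewrite /s1 /= update_same.
rewrite b1 => i s' iN [ag h]; rewrite rIf rSet (HP s' (Ordinal iN) ag).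
case: ifP => [Pi|/negbT nPi].
  split=> [c l ca|]; first by rewrite update_diff ?ag.
  by left; exists (Ordinal iN) => //; rewrite update_same /= /upd eqxx addn1.
rewrite /=; split=> //; case: h => [|[-> h]]; [by left | right]; split=> // j.
rewrite ltnS leq_eqVlt => /orP[/eqP ji|]; last exact: h.
by have -> : j = Ordinal iN by apply: val_inj.
Qed.

(** The initial content of the cell takes part in the minimum, which avoids a value for infinity. *)
Definition MinLoop (a x : nat) (b : bnd) (P e : rx) : rs :=
  RRep x b (RIf (XAnd P (XLt e (XG0 a))) (RSet a (XN 0) e) RSkip).

Lemma MinLoop_spec a x b P e env s N (Pf : pred 'I_N) (f : 'I_N -> nat) : a != 0 -> bval b s = N ->
  (forall (s' : store) (i : 'I_N), (forall c l, c != a -> s' c l = s c l) -> tv (upd env x i) s' P = Pf i) ->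
  (forall (s' : store) (i : 'I_N), (forall c l, c != a -> s' c l = s c l) -> ev (upd env x i) s' e = f i) ->
  let d := rrun env (MinLoop a x b P e) s a 0 in
  [/\ d <= s a 0, forall i, Pf i -> d <= f i & d = s a 0 \/ exists2 i, Pf i & d = f i].
Proof.
move=> a0 bN HP He; rewrite /MinLoop.
pose Inv i s' := [/\ forall c l, c != a -> s' c l = s c l, s' a 0 <= s a 0,
  forall j : 'I_N, j < i -> Pf j -> s' a 0 <= f j & s' a 0 = s a 0 \/ exists2 i, Pf i & s' a 0 = f i].
suff [_ h1 h2 h3] : Inv N (rrun env (RRep x b (RIf (XAnd P (XLt e (XG0 a))) (RSet a (XN 0) e) RSkip)) s).
  by split=> // i; apply: h2.
rewrite -{1}bN; apply: rep_ind; first by split=> //; left.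
rewrite bN => i s' iN [ag h1 h2 h3].
have HP' := HP s' (Ordinal iN) ag; have He' := He s' (Ordinal iN) ag; rewrite /= in HP' He'.
rewrite rIf rSet tvAnd tvLt HP' He'.
have below (j : 'I_N) : j < i.+1 -> j < i \/ j = Ordinal iN.
  by rewrite ltnS leq_eqVlt => /orP[/eqP ji|]; [right; apply: val_inj | left].
case: ifP => [/andP[Pi lt]|/negbT nP].
  split.
  - by move=> c l ca; rewrite update_diff ?ag.
  - by rewrite update_same; apply: leq_trans (ltnW lt) h1.
  - move=> j /below[ji Pj|-> _]; rewrite update_same //; apply: leq_trans (ltnW lt) _; exact: h2.
  - by right; exists (Ordinal iN); rewrite ?update_same.
split=> // j /below[ji|->]; first exact: h2.
by move=> Pi; rewrite Pi /= -leqNgt in nP.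
Qed.

(** * The arborescence packing program *)

(** Per element: head, tail, colour, class, true weight, current weight, second part of the
    splitting, membership in the basis. Then: matrices of exchange arcs and slacks, elements reached
    from [e] and their levels, the same for vertices in a forest, amount of a shift, position of the
    trace, and result of a search. *)
Local Notation aHD := 2 (only parsing).
Local Notation aTL := 3 (only parsing).
Local Notation aCO := 4 (only parsing).
Local Notation aCL := 5 (only parsing).
Local Notation aWT := 6 (only parsing).
Local Notation aWC := 7 (only parsing).
Local Notation aW2 := 8 (only parsing).
Local Notation aB := 9 (only parsing).
Local Notation aAR := 10 (only parsing).
Local Notation aSL := 11 (only parsing).
Local Notation aR := 12 (only parsing).
Local Notation aLV := 13 (only parsing).
Local Notation aVR := 16 (only parsing).
Local Notation aVL := 17 (only parsing).
Local Notation aDEL := 18 (only parsing).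
Local Notation aCUR := 19 (only parsing).
Local Notation aFND := 20 (only parsing).

Lemma tvAnyE env s x b e N : bval b s = N ->
  tv env s (XAny x b e) = [exists i : 'I_N, tv (upd env x i) s e].
Proof. by move=> <-; rewrite tvAny. Qed.

Lemma evSE env s x b e N : bval b s = N ->
  ev env s (XS x b e) = \sum_(i < N) ev (upd env x i) s e.
Proof. by move=> <-. Qed.

Section Packing.

Variable k : nat.

(** The ground set has [k] colours for each of the [2 * m] oriented edges and of [n] artificial
    arcs, one per vertex. *)
Definition bM := BM (BC k) (BA (BM (BC 2) BE) BV).
Definition bMM := BM bM bM.
Definition XIx u v := XAdd (XMB u bM) v.

(** Variables 2 and 3 hold the ends of the candidate arc, 5 and 6 are vertices, and 7 runs over
    elements. The forest of the basis without element 3, in the colour of element 2, is searched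
    from the tail of element 2. *)
Definition ArcSrc := XEq (XV 5) (XG aTL (XV 2)).
Definition ArcRel := XAny 7 bM (XAnd (XAnd (XAnd (XG aB (XV 7)) (XNot (XEq (XV 7) (XV 3))))
                         (XEq (XG aCO (XV 7)) (XG aCO (XV 2))))
     (XOr (XAnd (XEq (XG aTL (XV 7)) (XV 6)) (XEq (XG aHD (XV 7)) (XV 5)))
          (XAnd (XEq (XG aTL (XV 7)) (XV 5)) (XEq (XG aHD (XV 7)) (XV 6))))).
Definition ArcReach := Reach aVR aVL 4 5 6 BV ArcSrc ArcRel.

Definition ArcTest2 :=
  XAnd (XNot (XAny 7 bM (XAnd (XAnd (XG aB (XV 7)) (XNot (XEq (XV 7) (XV 2))))
                              (XEq (XG aCL (XV 7)) (XG aCL (XV 3))))))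
       (XLt (XS 7 bM (XB (XAnd (XAnd (XG aB (XV 7)) (XNot (XEq (XV 7) (XV 2))))
                               (XEq (XG aHD (XV 7)) (XG aHD (XV 3))))))
            (XIf (XG aHD (XV 3)) (XN k) (XN 0))).

Definition ArcTest := XIf (XG aB (XV 2)) (XAnd (XNot (XG aB (XV 3))) ArcTest2)
   (XAnd (XG aB (XV 3)) (XNot (XG aVR (XG aHD (XV 2))))).

(** [w1] can be negative and is kept as [aWC] minus [aW2]; in a difference of two values of [w1] the
    subtracted terms are moved across. *)
Definition SlackX := XIf (XG aB (XV 2)) (XSub (XG aW2 (XV 3)) (XG aW2 (XV 2)))
  (XSub (XAdd (XG aWC (XV 2)) (XG aW2 (XV 3))) (XAdd (XG aWC (XV 3)) (XG aW2 (XV 2)))).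

Definition ArcBody := RSeq ArcReach
  (RSeq (RSet aAR (XIx (XV 2) (XV 3)) (XB ArcTest)) (RSet aSL (XIx (XV 2) (XV 3)) SlackX)).
Definition ArcP := RRep 2 bM (RRep 3 bM ArcBody).

Definition XTight u v := XAnd (XG aAR (XIx u v)) (XNot (XG aSL (XIx u v))).
Definition ReachP := Reach aR aLV 4 5 6 bM (XEq (XV 5) (XV 0)) (XTight (XV 6) (XV 5)).
Definition XClosing x := XAnd (XG aR x) (XAnd (XG aB x) (XTight x (XV 0))).
(** Taking a closing element of greatest level, hence nearest to [e], yields a cycle with no earlier
    return to [e]. *)
Definition FindC := Find aFND 3 bM (XAnd (XClosing (XV 3))
  (XNot (XAny 7 bM (XAnd (XClosing (XV 7)) (XLt (XG aLV (XV 3)) (XG aLV (XV 7))))))).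

Definition XCur := XSub (XG0 aCUR) (XN 1).
(** The walk goes back from the closing element to [e] along tight arcs one level apart, toggling
    membership; once [aCUR] is 0 the remaining rounds do nothing. *)
Definition TraceBody := RIf (XG0 aCUR)
  (RSeq (RSet aB XCur (XNot (XG aB XCur)))
  (RSeq (Find aFND 3 bM (XAnd (XTight (XV 3) XCur)
                           (XEq (XG aLV (XV 3)) (XAdd (XG aLV XCur) (XN 1)))))
        (RIf (XEq XCur (XV 0)) (RSet aCUR (XN 0) (XN 0)) (RSet aCUR (XN 0) (XG0 aFND))))) RSkip.
Definition Trace := RSeq (RSet aCUR (XN 0) (XG0 aFND)) (RRep 8 bM TraceBody).

Definition XRow := XDiv (XV 2) (XBd bM).
Definition XCol := XMod (XV 2) bM.
Definition XLeaving := XAnd (XG aR XRow)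
  (XAnd (XOr (XNot (XG aR XCol)) (XEq XCol (XV 0))) (XG aAR (XV 2))).
(** The step is capped by the excess of the current weight of [e] over its target. On the reached
    set, raising [aW2] lowers [w1] with [aWC] unchanged; at [e] it is [aWC] that drops. *)
Definition Shift := RSeq (RSet aDEL (XN 0) (XSub (XG aWC (XV 0)) (XG aWT (XV 0))))
  (RSeq (MinLoop aDEL 2 bMM XLeaving (XG aSL (XV 2)))
  (RSeq (RPar 5 aW2 bM (XIf (XAnd (XG aR (XV 5)) (XNot (XEq (XV 5) (XV 0))))
                            (XAdd (XG aW2 (XV 5)) (XG0 aDEL)) (XG aW2 (XV 5))))
        (RSet aWC (XV 0) (XSub (XG aWC (XV 0)) (XG0 aDEL))))).

Definition StepS := RIf (XG aB (XV 0)) (RSet aWC (XV 0) (XG aWT (XV 0)))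
   (RIf (XLt (XG aWT (XV 0)) (XG aWC (XV 0)))
      (RSeq (RSeq ArcP ReachP) (RSeq FindC (RIf (XG0 aFND) Trace Shift))) RSkip).

Definition PackLoop := RRep 0 bM (RRep 1 (BA bM (BC 2)) StepS).

Variables (n m : nat).
Let M := k * (2 * m + n).
Variables (hdT tlT : 'I_M -> 'I_n) (coT : 'I_M -> 'I_k) (clT wtT : 'I_M -> nat) (r : 'I_n).
Hypothesis r0 : val r = 0.
Hypothesis cl_hd : forall t u, clT t = clT u -> hdT t = hdT u.

Let M1 := forests coT tlT hdT.
Let M2 := indegrees (@root_cap 'I_k 'I_n r) cl_hd.

Definition tables (s : store) := [/\ s 0 0 = n, s 0 1 = m & forall t : 'I_M,
  [/\ s aHD t = hdT t, s aTL t = tlT t, s aCO t = coT t, s aCL t = clT t & s aWT t = wtT t]].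

Definition Bs (s : store) := [set t : 'I_M | s aB t != 0].
Definition w1s (s : store) (t : 'I_M) : int := ((s aWC t)%:Z - (s aW2 t)%:Z)%R.
Definition w2s (s : store) (t : 'I_M) : int := (s aW2 t)%:Z.

Lemma in_Bs s t : (t \in Bs s) = (s aB t != 0).
Proof. by rewrite inE. Qed.

Lemma bval_M s : s 0 0 = n -> s 0 1 = m -> bval bM s = M.
Proof. by rewrite /bval /= => -> ->. Qed.

Lemma ixE (u v : 'I_M) (u' v' : 'I_M) : u * M + v = u' * M + v' -> u = u' /\ v = v'.
Proof.
have M0 : 0 < M by apply: leq_trans (ltn_ord u).
move=> h; have := congr1 (divn^~ M) h; have := congr1 (modn^~ M) h.
rewrite !modnMDl !divnMDl // !modn_small ?divn_small // !addn0 => h1 h2.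
by split; apply: val_inj.
Qed.

Definition slkn (s : store) (y x : nat) := if s aB y != 0 then s aW2 x - s aW2 y
    else (s aWC y + s aW2 x) - (s aWC x + s aW2 y).

Definition arcs_stored (s0 s : store) := forall y x : 'I_M,
  s aAR (y * M + x) = arc M1 M2 (Bs s0) y x /\ s aSL (y * M + x) = slkn s0 y x.

Lemma ArcBody_spec (env : nat -> nat) s (y x : 'I_M) : tables s -> M1 (Bs s) -> M2 (Bs s) ->
  let s' := rrun (upd (upd env 2 y) 3 x) ArcBody s in
  s' aAR (y * M + x) = arc M1 M2 (Bs s) y x /\
  s' aSL (y * M + x) = slkn s y x /\
  (forall a i, a != aAR -> a != aSL -> a != aVR -> a != aVL -> s' a i = s a i) /\
  (forall i, i <> y * M + x -> s' aAR i = s aAR i /\ s' aSL i = s aSL i).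
Proof.
move=> [sn sm tab] m1 m2; rewrite /ArcBody !rSeq.
set env' := upd (upd env 2 y) 3 x; set s1 := rrun env' ArcReach s.
have fr a i : a != aVR -> a != aVL -> s1 a i = s a i.
  by move=> h1 h2; rewrite /s1 rframe //= (negPf h1) (negPf h2).
have VR (j : 'I_n) : (s1 aVR j != 0) = connect (adjc coT tlT hdT (Bs s :\ x) (coT y)) (tlT y) j.
  have Hs s2 i (j' : 'I_n) : (forall a l, a != aVR -> a != aVL -> s2 a l = s a l) ->
      tv (upd (upd env' 4 i) 5 j') s2 ArcSrc = (j' == tlT y).
    by move=> ag; rewrite tvEq /= /upd /= ag //; have [_ -> _ _ _] := tab y.
  have Hr s2 i (j' l : 'I_n) : (forall a l, a != aVR -> a != aVL -> s2 a l = s a l) ->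
      tv (upd (upd (upd env' 4 i) 5 j') 6 l) s2 ArcRel =
      adjc coT tlT hdT (Bs s :\ x) (coT y) l j'.
    move=> ag; rewrite /ArcRel (@tvAnyE _ _ _ _ _ M); last by apply: bval_M; rewrite ag.
    apply: eq_existsb => z; rewrite !tvE /= /upd /= !ag //.
    have [-> -> -> _ _] := tab z; have [_ _ -> _ _] := tab y.
    rewrite !inE !(inj_eq val_inj) -!andbA; case: (s aB z != 0); rewrite ?andbF //=.
  have [h _] := @Reach_spec aVR aVL 4 5 6 BV ArcSrc ArcRel env' s n _ _ isT isT isT isT sn Hs Hr.
  rewrite /s1 h layerP; apply/existsP/idP => [[i /andP[/eqP-> //]]|c].
  by exists (tlT y); rewrite eqxx.
have ix2 (s2 : store) : s2 0 0 = n -> s2 0 1 = m -> ev env' s2 (XIx (XV 2) (XV 3)) = y * M + x.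
  by move=> h1 h2; rewrite /= bval_M.
rewrite !rSet (ix2 s1) ?fr // evB; set s2 := update s1 _ _ _.
rewrite (ix2 s2); [|by rewrite /s2 update_diff // fr|by rewrite /s2 update_diff // fr].
have AT : tv env' s1 ArcTest = arc M1 M2 (Bs s) y x.
  have E2 : env' 2 = y by []. have E3 : env' 3 = x by [].
  rewrite /ArcTest {1}/tv evIf tvG [ev _ _ (XV 2)]/= E2 fr // /arc !in_Bs.
  case: ifP => yB; last first.
    rewrite -/(tv _ _ _) tvAnd tvNot !tvG [ev _ _ (XV 3)]/= E3 [ev _ _ (XG _ _)]/= E2 (fr aB) // (fr aHD) //.
    case: (boolP (s aB x != 0)) => //= xB.
    have [-> _ _ _ _] := tab y; rewrite VR.
    by rewrite [RHS]forests_exch // ?in_Bs // yB.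
  rewrite -/(tv _ _ _) tvAnd tvNot tvG [ev _ _ (XV 3)]/= E3 fr //.
  case: (boolP (s aB x != 0)) => //= xB.
  rewrite /ArcTest2 tvAnd tvNot tvLt (@tvAnyE _ _ _ _ _ M) ?bval_M ?fr //.
  rewrite (@evSE _ _ _ _ _ M) ?bval_M ?fr // evIf tvG [ev _ _ (XV 3)]/= E3 (fr aHD) //.
  rewrite [ev _ _ (XN k)]/= [ev _ _ (XN 0)]/=.
  have sub : capindep clT hdT (@root_cap 'I_k 'I_n r) (Bs s :\ y).
    by apply: capindep_sub m2; apply: subsetDl.
  rewrite [RHS]capindep_add //; last by rewrite in_setD1 in_Bs negb_and xB orbT.
  congr (_ && _).
    rewrite -negb_exists_in; congr (~~ _); apply: eq_existsb => z.
    rewrite !tvE /= /upd /= !fr //; have [_ _ _ -> _] := tab z; have [_ _ _ -> _] := tab x.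
    by rewrite !inE (inj_eq val_inj) [(z != y) && _]andbC.
  have [hx _ _ _ _] := tab x.
  congr (_ < _).
    rewrite /indeg -sum1_card [RHS]big_mkcond; apply: eq_bigr => z _.
    rewrite evB !tvE /= /upd /= !fr // hx; have [-> _ _ _ _] := tab z.
    rewrite !inE !(inj_eq val_inj) [(z != y) && _]andbC; by case: (_ && _ && _).
  by rewrite hx /root_cap -(inj_eq val_inj) r0 card_ord; case: (val (hdT x) == 0).
rewrite /s2 AT; split; first by rewrite update_diff // update_same.
split.
  by rewrite update_same /SlackX evIf tvG /= /upd /= !update_diff // !fr.
split=> [a i h1 h2 h3 h4|i h]; first by rewrite !update_diff ?fr.
by rewrite /update !eqxx /=; case: eqP => //= _; rewrite !fr.
Qed.

Lemma ArcP_spec (env : nat -> nat) s : tables s -> M1 (Bs s) -> M2 (Bs s) ->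
  arcs_stored s (rrun env ArcP s).
Proof.
move=> ts m1 m2; have [sn sm tab] := ts.
pose Ag (s' : store) := forall a i, a != aAR -> a != aSL -> a != aVR -> a != aVL -> s' a i = s a i.
pose Ok (s' : store) (y x : 'I_M) := s' aAR (y * M + x) = arc M1 M2 (Bs s) y x /\
  s' aSL (y * M + x) = slkn s y x.
have bE s' : Ag s' -> bval bM s' = M by move=> ag; rewrite bval_M ?ag.
have tE s' : Ag s' -> [/\ tables s', Bs s' = Bs s & forall t, s' aB t = s aB t].
  move=> ag; split; last by move=> t; rewrite ag.
    by split=> [||t]; rewrite ?ag //; have [h1 h2 h3 h4 h5] := tab t; rewrite !ag.
  by apply/setP=> t; rewrite !in_Bs ag.
pose Inv i s' := Ag s' /\ forall y x : 'I_M, y < i -> Ok s' y x.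
suff [_ h] : Inv M (rrun env ArcP s) by move=> y x; apply: h.
rewrite /ArcP -{1}(bE s) //; apply: rep_ind; first by split.
rewrite bE // => i s1 iM [ag1 ok1]; pose y := Ordinal iM.
pose Inv2 j s' := Ag s' /\ forall y' x' : 'I_M, (y' < i) || (y' == y) && (x' < j) -> Ok s' y' x'.
suff [ag2 ok2] : Inv2 M (rrun (upd env 2 i) (RRep 3 bM ArcBody) s1).
  split=> // y' x; rewrite ltnS leq_eqVlt => /orP[/eqP e|lt]; apply: ok2; last by rewrite lt.
  by rewrite (_ : y' = y) ?eqxx ?ltn_ord ?orbT //; apply: val_inj.
rewrite -{1}(bE s1) //; apply: rep_ind; first by split=> // y' x'; rewrite ltn0 andbF orbF; apply: ok1.
rewrite bE // => j s2 jM [ag2 ok2]; pose x := Ordinal jM.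
have [t2 B2 b2] := tE s2 ag2.
have [||h1 [h2 [h3 h4]]] := @ArcBody_spec env s2 y x t2; try by rewrite B2.
split=> [a l a1 a2 a3 a4|y' x' hyp]; first by rewrite h3 ?ag2.
have [e|ne] := eqVneq (y' * M + x') (y * M + x).
  have [-> ->] := ixE e; rewrite /Ok; split; first by rewrite h1 B2.
  by rewrite h2 /slkn b2 !(ag2 aW2) // !(ag2 aWC).
have [e1 e2] := h4 _ (elimN eqP ne); rewrite /Ok e1 e2; apply: ok2.
case/orP: hyp => [-> //|/andP[/eqP ey]].
rewrite ltnS leq_eqVlt => /orP[/eqP ex|hx]; last by rewrite ey eqxx hx orbT.
by case/negP: ne; rewrite ey ex.
Qed.

(** Slacks of arcs are nonnegative, so the truncated subtractions are exact there. *)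
Lemma slack_nat s (u v : 'I_M) : valid M1 M2 (Bs s) (w1s s) (w2s s) -> arc M1 M2 (Bs s) u v ->
  slack (Bs s) (w1s s) (w2s s) u v = (slkn s u v)%:Z%R.
Proof.
move=> va ar; have := slack_ge0 va ar; rewrite /slack /slkn in_Bs /w1s /w2s.
by case: ifP => _; clear; lia.
Qed.

Definition tgt s (u v : 'I_M) := tight M1 M2 (Bs s) (w1s s) (w2s s) u v.

Lemma tight_stored s s' (u v : 'I_M) : valid M1 M2 (Bs s) (w1s s) (w2s s) -> arcs_stored s s' ->
  (s' aAR (u * M + v) != 0) && (s' aSL (u * M + v) == 0) = tgt s u v.
Proof.
move=> va st; have [-> ->] := st u v; rewrite /tgt /tight.
case: (boolP (arc M1 M2 (Bs s) u v)) => //= ar.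
by rewrite slack_nat.
Qed.

Lemma tv_tight s s' env eu ex (u v : 'I_M) : valid M1 M2 (Bs s) (w1s s) (w2s s) ->
  arcs_stored s s' -> s' 0 0 = n -> s' 0 1 = m -> ev env s' eu = u -> ev env s' ex = v ->
  tv env s' (XTight eu ex) = tgt s u v.
Proof.
move=> va st h1 h2 h3 h4; rewrite /XTight tvAnd tvNot !tvG negbK.
have -> : ev env s' (XIx eu ex) = u * M + v.
  by rewrite [LHS]/= -/(ev env s' eu) -/(ev env s' ex) h3 h4 bval_M.
exact: tight_stored.
Qed.

Definition clos s (e : 'I_M) := closeness (fun j => j == e) (tgt s).

Lemma ReachP_spec (env : nat -> nat) s s1 (e : 'I_M) : valid M1 M2 (Bs s) (w1s s) (w2s s) ->
  arcs_stored s s1 -> s1 0 0 = n -> s1 0 1 = m -> env 0 = e ->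
  let s' := rrun env ReachP s1 in
  (forall j : 'I_M, (s' aR j != 0) = (j \in reach M1 M2 (Bs s) (w1s s) (w2s s) e)) /\
  (forall j : 'I_M, s' aLV j = clos s e j).
Proof.
move=> va st h1 h2 he s'.
have Hs s2 i (j : 'I_M) : (forall a l, a != aR -> a != aLV -> s2 a l = s1 a l) ->
    tv (upd (upd env 4 i) 5 j) s2 (XEq (XV 5) (XV 0)) = (j == e).
  by move=> ag; rewrite tvEq /= /upd /= he.
have Hr s2 i (j l : 'I_M) : (forall a l, a != aR -> a != aLV -> s2 a l = s1 a l) ->
    tv (upd (upd (upd env 4 i) 5 j) 6 l) s2 (XTight (XV 6) (XV 5)) = tgt s l j.
  move=> ag; apply: tv_tight => //; rewrite ?ag //.
  by move=> y x; rewrite !ag //; apply: st.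
have [h3 h4] := @Reach_spec aR aLV 4 5 6 bM _ _ env s1 M _ _ isT isT isT isT (bval_M h1 h2) Hs Hr.
split=> [j|j]; last exact: h4.
rewrite h3 layerP inE; apply/existsP/idP => [[i /andP[/eqP-> //]]|c].
by exists e; rewrite eqxx.
Qed.


Definition scratch := [:: aAR; aSL; aVR; aVL; aR; aLV; aFND].

Definition ready (e : 'I_M) (s s1 : store) := [/\ arcs_stored s s1,
  forall j : 'I_M, (s1 aR j != 0) = (j \in reach M1 M2 (Bs s) (w1s s) (w2s s) e),
  forall j : 'I_M, s1 aLV j = clos s e j &
  forall a i, a \notin scratch -> s1 a i = s a i].

Lemma ready_spec (env : nat -> nat) s (e : 'I_M) : tables s -> valid M1 M2 (Bs s) (w1s s) (w2s s) ->
  env 0 = e -> ready e s (rrun env (RSeq ArcP ReachP) s).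
Proof.
move=> ts va he; have [sn sm _] := ts; have [m1 m2 _ _] := va; rewrite rSeq.
have st := ArcP_spec env ts m1 m2; set s1 := rrun env ArcP s in st *.
have fr a i : a \notin [:: aAR; aSL; aVR; aVL] -> s1 a i = s a i.
  by rewrite !inE !negb_or => /and4P[h1 h2 h3 h4]; rewrite /s1 rframe //= (negPf h1) (negPf h2) (negPf h3) (negPf h4).
have [h1 h2] := ReachP_spec va st (etrans (fr 0 0 isT) sn) (etrans (fr 0 1 isT) sm) he.
split=> //.
- by move=> y x; rewrite !rframe.
- move=> a i; rewrite /scratch !inE !negb_or => /and5P[a1 a2 a3 a4 /and3P[a5 a6 _]].
  rewrite rframe /= ?(negPf a5) ?(negPf a6) // fr // !inE !negb_or a1 a2 a3 a4 //.
Qed.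

Definition clo s (e x : 'I_M) :=
  [&& x \in reach M1 M2 (Bs s) (w1s s) (w2s s) e, x \in Bs s & tgt s x e].

Lemma FindC_spec (env : nat -> nat) s s1 (e : 'I_M) : tables s -> valid M1 M2 (Bs s) (w1s s) (w2s s) ->
  env 0 = e -> ready e s s1 ->
  find_result (fun x => clo s e x && ~~ [exists y, clo s e y && (clos s e x < clos s e y)])
    (rrun env FindC s1 aFND 0).
Proof.
move=> [sn sm tab] va he [st hR hL fr].
have b1 : bval bM s1 = M by rewrite bval_M ?fr.
apply: Find_spec => // s2 i ag.
have st2 : arcs_stored s s2 by move=> y x; rewrite !ag //; apply: st.
have cl2 env' ex (x : 'I_M) : ev env' s2 ex = x -> env' 0 = e -> tv env' s2 (XClosing ex) = clo s e x.
  move=> hx h0; have z0 : s2 0 0 = n by rewrite ag // fr.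
  have z1 : s2 0 1 = m by rewrite ag // fr.
  rewrite /XClosing tvAnd tvG hx tvAnd tvG hx (@tv_tight s s2 env' ex (XV 0) x e va st2 z0 z1 hx h0).
  by rewrite ag // hR ag // fr // /clo in_Bs.
rewrite tvAnd tvNot (cl2 _ _ i) //; congr (_ && ~~ _).
rewrite (@tvAnyE _ _ _ _ _ M); last by rewrite bval_M ?ag ?fr.
apply: eq_existsb => y; rewrite tvAnd tvLt (cl2 _ _ y) //; congr (_ && _).
by rewrite /= /upd /= !ag // !hL.
Qed.

Lemma closing_clo s e : closing M1 M2 (Bs s) (w1s s) (w2s s) e = [exists x, clo s e x].
Proof. by rewrite /closing; apply: eq_existsb => x; rewrite /clo. Qed.

Lemma find_closing s e v :
  find_result (fun x => clo s e x && ~~ [exists y, clo s e y && (clos s e x < clos s e y)]) v ->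
  closing M1 M2 (Bs s) (w1s s) (w2s s) e = (v != 0).
Proof.
rewrite closing_clo; case=> [i /andP[ci _]|no]; first by apply/existsP; exists i.
apply/existsP => -[x cx]; case: (@arg_maxnP _ x (clo s e) (clos s e) cx) => y cy ymax.
have := no y; rewrite cy /= negbK => /existsP[z /andP[cz]].
by rewrite ltnNge => /negP; apply; apply: ymax.
Qed.

Definition tgL s e (a b : 'I_M) := tgt s a b && (clos s e a == (clos s e b).+1).

Lemma path_clos s e a p : path (tgL s e) a p -> clos s e a = clos s e (last a p) + size p /\
  forall t, t \in p -> clos s e t < clos s e a.
Proof.
elim: p a => [|b p IH] a /=; first by rewrite addn0.
case/andP=> /andP[_ /eqP ab] /IH[h1 h2]; split; first by rewrite ab h1 addnS.
by move=> t; rewrite inE ab ltnS => /orP[/eqP-> //|/h2/ltnW].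
Qed.

Lemma Trace_spec (env : nat -> nat) s s1 (e x0 : 'I_M) : tables s -> valid M1 M2 (Bs s) (w1s s) (w2s s) ->
  env 0 = e -> ready e s s1 -> e \notin Bs s -> s1 aFND 0 = x0.+1 -> clo s e x0 ->
  let s' := rrun env Trace s1 in
  exists p, [/\ path (tgL s e) e p, last e p = x0 &
    forall t : 'I_M, (s' aB t != 0) = (t \in Bs s) (+) (t \in e :: p)].
Proof.
move=> [sn sm tab] va he [st hR hL fr] eB hF cx0 s'.
have x0pos : 0 < clos s e x0.
  rewrite closeness_gt0 layerP; case/and3P: cx0; rewrite inE => c _ _.
  by apply/existsP; exists e; rewrite eqxx.
(* Either the walk stands at [cur] with all later elements of the cycle toggled, or it has passed
   [e] and is complete. *)
pose Alt1 (j : nat) (s2 : store) := exists (cur : 'I_M) p, [/\ s2 aCUR 0 = cur.+1, path (tgL s e) cur p,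
  last cur p = x0, size p = j & forall t : 'I_M, (s2 aB t != 0) = (t \in Bs s) (+) (t \in p)].
pose Alt2 (s2 : store) := exists p, [/\ s2 aCUR 0 = 0, path (tgL s e) e p,
  last e p = x0 & forall t : 'I_M, (s2 aB t != 0) = (t \in Bs s) (+) (t \in e :: p)].
pose Inv j (s2 : store) := (forall a i, a \notin [:: aB; aFND; aCUR] -> s2 a i = s1 a i) /\
  (Alt1 j s2 \/ Alt2 s2).
set s0 := rrun env (RSet aCUR (XN 0) (XG0 aFND)) s1.
have bE (s2 : store) : (forall a i, a \notin [:: aB; aFND; aCUR] -> s2 a i = s1 a i) -> bval bM s2 = M.
  by move=> ag; rewrite bval_M ?ag ?fr.
have ag0 a i : a \notin [:: aB; aFND; aCUR] -> s0 a i = s1 a i.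
  by rewrite !inE !negb_or => /and3P[_ _ h]; rewrite /s0 rSet update_diff.
suff [_ [[cur [p [_ hp hl sz _]]]|[p [_ hp hl hB]]]] : Inv M s'.
(* The level rises by one per round and never exceeds [M], so an unfinished walk is impossible after
   [M] rounds. *)
- have [h _] := path_clos hp; rewrite hl sz in h.
  have := closeness_le (fun j => j == e) (tgt s) cur; rewrite -/(clos s e cur) h.
  by move: x0pos; clear; lia.
- by exists p.
rewrite /s' /Trace rSeq -/s0 -{1}(bE s0 ag0); apply: rep_ind.
  have c0 : s0 aCUR 0 = x0.+1 by rewrite /s0 rSet /= update_same.
  split=> //; left; exists x0, [::]; split=> //.
  by move=> t; rewrite /s0 rSet update_diff // fr // addbF in_Bs.
rewrite bE // => j s2 jM [ag [[cur [p [hc hp hl sz hB]]]|[p [hc hp hl hB]]]]; last first.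
  rewrite /TraceBody rIf tvG hc eqxx /=; split=> //; right; by exists p.
rewrite /TraceBody rIf tvG hc /= -/(XNot _) -/XCur.
rewrite -[X in Inv _ X]/(rrun (upd env 8 j) (RSeq (RSet aB XCur (XNot (XG aB XCur)))
  (RSeq (Find aFND 3 bM (XAnd (XTight (XV 3) XCur) (XEq (XG aLV (XV 3)) (XAdd (XG aLV XCur) (XN 1)))))
        (RIf (XEq XCur (XV 0)) (RSet aCUR (XN 0) (XN 0)) (RSet aCUR (XN 0) (XG0 aFND))))) s2).
rewrite rSeq; set s3 := rrun _ (RSet aB _ _) s2; rewrite rSeq.
have cE env' (s4 : store) : s4 aCUR 0 = s2 aCUR 0 -> ev env' s4 XCur = cur.
  by move=> h; rewrite /= h hc subn1.
have s3c a i : a != aB -> s3 a i = s2 a i by move=> h; rewrite /s3 rSet update_diff.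
have [cc lt] := path_clos hp; rewrite hl sz in cc.
have ncur : cur \notin p by apply/negP => /lt; rewrite ltnn.
have B3 (t : 'I_M) : (s3 aB t != 0) = (t \in Bs s) (+) (t \in cur :: p).
  rewrite /s3 rSet cE //; have [->|tc] := eqVneq t cur.
    by rewrite update_same -/(tv _ _ _) tvNot tvG cE // hB (negPf ncur) addbF mem_head addbT.
  by rewrite /update (inj_eq val_inj) (negPf tc) andbF hB in_cons (negPf tc).
have F3 : find_result (fun v => tgL s e v cur) (rrun (upd env 8 j)
   (Find aFND 3 bM (XAnd (XTight (XV 3) XCur) (XEq (XG aLV (XV 3)) (XAdd (XG aLV XCur) (XN 1))))) s3 aFND 0).
  have ag3 a i : a \notin [:: aB; aFND; aCUR] -> s3 a i = s1 a i.
    by move=> h; rewrite s3c ?ag //; move: h; rewrite inE negb_or => /andP[].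
  apply: Find_spec => // [|s4 v ag4]; first exact: bE.
  have st4 : arcs_stored s s4 by move=> y x; rewrite !ag4 // !ag3 //; apply: st.
  have c4 : s4 aCUR 0 = s2 aCUR 0 by rewrite ag4 // s3c.
  rewrite tvAnd tvEq (@tv_tight s s4 _ (XV 3) XCur v cur) ?ag4 ?ag3 ?fr ?cE //.
  rewrite /tgL; congr (_ && _); rewrite [ev _ _ (XG aLV (XV 3))]/= /upd /=.
  by rewrite c4 hc subn1 /= !ag4 // !ag3 // !hL addn1.
set s4 := rrun _ (Find _ _ _ _) s3 in F3 *.
have s4c a i : a != aFND -> s4 a i = s3 a i by move=> h; rewrite /s4 rframe //= !(negPf h).
have c4 : s4 aCUR 0 = s2 aCUR 0 by rewrite s4c // s3c.
rewrite rIf tvEq cE // -[ev _ _ (XV 0)]/(env 0) he.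
have agf (s5 : store) v : s5 = update s4 aCUR 0 v -> forall a i, a \notin [:: aB; aFND; aCUR] -> s5 a i = s1 a i.
  move=> -> a i h; have := h; rewrite !inE !negb_or => /and3P[h1 h2 h3].
  by rewrite update_diff // s4c // s3c // ag.
case: eqP => [/val_inj ce|/eqP ne]; rewrite rSet; split; try by apply: agf.
  right; exists p; split.
  - by rewrite update_same.
  - by move: hp; rewrite ce.
  - by move: hl; rewrite ce.
  - by move=> t; rewrite update_diff // s4c // B3 ce.
left; have := F3; rewrite /=; case=> [v /andP[tv1 tv2]|no]; last first.
  have [||i ti ci] := @closeness_pred M (fun j => j == e) (tgt s) cur.
  - by rewrite -/(clos s e cur) cc; move: x0pos; clear; lia.
  - by apply: contra ne => /eqP ->.
  by have := no i; rewrite /tgL ti /clos ci eqxx.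
exists v, (cur :: p); split.
- by rewrite update_same.
- by rewrite /= /tgL tv1 tv2.
- by [].
- by rewrite /= sz.
- by move=> t; rewrite update_diff // s4c // B3.
Qed.

(** The distance from [e] is [M] minus the level. [closeness_rel] excludes shortcuts ahead, and the
    greatest level of [x0] excludes earlier arcs back to [e]. *)
Lemma augment_path (s s' : store) (e x0 : 'I_M) p : valid M1 M2 (Bs s) (w1s s) (w2s s) -> e \notin Bs s ->
  clo s e x0 -> ~~ [exists y, clo s e y && (clos s e x0 < clos s e y)] ->
  path (tgL s e) e p -> last e p = x0 ->
  (forall t : 'I_M, (s' aB t != 0) = (t \in Bs s) (+) (t \in e :: p)) ->
  [/\ valid M1 M2 (Bs s') (w1s s) (w2s s), #|Bs s'| = #|Bs s| & e \in Bs s'].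
Proof.
move=> va eB cx0 mx hp hl hB.
pose q := size p; pose z i := nth e (e :: p) i.
have ztg i : i < q -> tgL s e (z i) (z i.+1) by move=> iq; apply: (pathP e hp).
have zB i : i <= q -> (z i \in Bs s) = odd i.
  elim: i => [|i IH] iq; first by rewrite /z /= (negPf eB).
  have /andP[/andP[+ _] _] := ztg i iq; rewrite /arc IH ?(ltnW iq) //=.
  by case: (odd i) => /andP[] //; move/negbTE.
have ce : clos s e e = M by apply: closeness_src.
have zc i : i <= q -> clos s e (z i) + i = M.
  elim: i => [|i IH] iq; first by rewrite addn0.
  by have /andP[_ /eqP h] := ztg i iq; rewrite -(IH (ltnW iq)) h addnS.
have zq : z q = x0 by rewrite /z -hl nth_last.
(* The path starts outside the basis and ends inside it, so the cycle has an even number of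
   elements. *)
have oq : odd q by rewrite -zB // zq; case/and3P: cx0.
pose hs := q.+1./2.
have hs2 : hs.*2 = q.+1 by rewrite /hs -[RHS]odd_double_half /= oq.
have lvz i : i < hs.*2 -> M - clos s e (z i) = i.
  by rewrite hs2 ltnS => iq; have := zc i iq; clear; lia.
have h1 : 0 < hs by move: hs2; clear; lia.
have h3 i : i < hs.*2 -> (z i \in Bs s) = odd i by rewrite hs2 ltnS; apply: zB.
have h5 i : i.+1 < hs.*2 -> tight M1 M2 (Bs s) (w1s s) (w2s s) (z i) (z i.+1).
  by rewrite hs2 ltnS => iq; have /andP[] := ztg i iq.
have h6 : tight M1 M2 (Bs s) (w1s s) (w2s s) (z hs.*2.-1) e.
  by rewrite hs2 /= zq; case/and3P: cx0.
have h7 i v : i < hs.*2 -> tight M1 M2 (Bs s) (w1s s) (w2s s) (z i) v -> M - clos s e v <= i.+1.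
  rewrite hs2 ltnS => iq tg; have [h _] := @closeness_rel M (fun j => j == e) (tgt s) _ _ tg.
  by have := zc i iq; rewrite /clos in h *; move: h; clear; lia.
have h8 i : i < hs.*2.-1 -> ~~ tight M1 M2 (Bs s) (w1s s) (w2s s) (z i) e.
  rewrite hs2 /= => iq; apply/negP => tg; case/negP: mx; apply/existsP; exists (z i).
  have zi := zc i (ltnW iq); have zqq := zc q (leqnn q); rewrite zq in zqq.
  apply/andP; split; last by move: zi zqq iq; clear; lia.
  apply/and3P; split.
  - rewrite inE; elim: i iq {tg zi} => [|i IH] iq; first exact: connect0.
    apply: connect_trans (IH (ltnW iq)) (connect1 _).
    by have /andP[] := ztg i (ltnW iq).
  - move: tg; rewrite /tight /arc; case: ifP => // _; by rewrite (negPf eB).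
  - exact: tg.
have BE : Bs s' = toggled (Bs s) hs z.
  apply/setP=> t; rewrite in_Bs hB [RHS]inE; congr (addb _ _).
  rewrite hs2; apply/idP/mapP => [tp|[i]].
    exists (index t (e :: p)); last by rewrite /z nth_index.
    by rewrite mem_iota leq0n add0n; move: tp; rewrite -index_mem.
  by rewrite mem_iota /= add0n => iq ->; rewrite /z mem_nth.
have zlv i : i < hs.*2 -> (fun t => M - clos s e t) (z i) = i by apply: lvz.
rewrite BE; split.
- exact: (@augment_valid _ M1 M2 (Bs s) (w1s s) (w2s s) e (fun t => M - clos s e t) hs z va h1 erefl h3 zlv h5 h6 h7 h8).
- exact: (card_toggled (lv := fun t => M - clos s e t) h1 erefl h3 zlv h6).
- exact: (mem_toggled (lv := fun t => M - clos s e t) h1 erefl h3 zlv h6).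
Qed.


Lemma ready_FindC (env : nat -> nat) e s s1 : ready e s s1 -> ready e s (rrun env FindC s1).
Proof.
case=> st hR hL fr; split.
- by move=> y x; rewrite !rframe.
- by move=> j; rewrite rframe.
- by move=> j; rewrite rframe.
- move=> a i h; rewrite rframe ?fr //.
  by move: h; rewrite /scratch !inE !negb_or /= => /and5P[_ _ _ _ /and3P[_ _ ->]].
Qed.

Lemma Shift_spec (env : nat -> nat) s s1 (e : 'I_M) : tables s ->
  valid M1 M2 (Bs s) (w1s s) (w2s s) -> env 0 = e -> ready e s s1 -> e \notin Bs s ->
  wtT e <= s aWC e ->
  let s' := rrun env Shift s1 in
  exists d, [/\ d <= s aWC e - wtT e,
    (forall u v, leaving M1 M2 (Bs s) (w1s s) (w2s s) e u v -> d <= slkn s u v),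
    d = s aWC e - wtT e \/ (exists u v, leaving M1 M2 (Bs s) (w1s s) (w2s s) e u v /\ d = slkn s u v),
    w1s s' = shift1 M1 M2 (Bs s) (w1s s) (w2s s) e d%:Z%R /\
    w2s s' = shift2 M1 M2 (Bs s) (w1s s) (w2s s) e d%:Z%R &
    s' aWC e = s aWC e - d /\ forall t : 'I_M, t != e -> s' aWC t = s aWC t].
Proof.
move=> ts va he [st hR hL fr] eB le s'; have [sn sm tab] := ts.
have we : s1 aWT e = wtT e by rewrite fr //; have [_ _ _ _ ->] := tab e.
set s2 := rrun env (RSet aDEL (XN 0) (XSub (XG aWC (XV 0)) (XG aWT (XV 0)))) s1.
have D2 : s2 aDEL 0 = s aWC e - wtT e.
  by rewrite /s2 rSet /= update_same he we fr.
have ag2 a i : a != aDEL -> s2 a i = s1 a i by move=> h; rewrite /s2 rSet update_diff.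
have n2 : s2 0 0 = n by rewrite ag2 // fr. have m2 : s2 0 1 = m by rewrite ag2 // fr.
have bMM2 : bval bMM s2 = M * M by rewrite -[LHS]/(bval bM s2 * bval bM s2) bval_M.
have rowP (q : 'I_(M * M)) : q %/ M < M.
  by rewrite ltn_divLR; [exact: ltn_ord | case: (posnP M) q => // ->; case].
have colP (q : 'I_(M * M)) : q %% M < M.
  by rewrite ltn_mod; case: (posnP M) q => // ->; case.
pose row q := Ordinal (rowP q); pose col q := Ordinal (colP q).
have qE (q : 'I_(M * M)) : val q = row q * M + col q by exact: divn_eq.
pose lv := leaving M1 M2 (Bs s) (w1s s) (w2s s) e.
have HP (s3 : store) (q : 'I_(M * M)) : (forall c l, c != aDEL -> s3 c l = s2 c l) ->
    tv (upd env 2 q) s3 XLeaving = lv (row q) (col q).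
  move=> ag; have b3 : bval bM s3 = M by rewrite bval_M ?ag.
  have e1 : ev (upd env 2 q) s3 XRow = row q by rewrite /= /upd /= b3 mul1n.
  have e2 : ev (upd env 2 q) s3 XCol = col q.
    by rewrite /= /upd /= b3 mul1n {1}(divn_eq q M) addnC addnK.
  rewrite /XLeaving tvAnd tvG e1 tvAnd tvOr tvNot tvG e2 tvEq e2 tvG.
  rewrite [ev _ _ (XV 0)]/= [ev _ _ (XV 2)]/= {1}/upd /= he {1}/upd /=.
  rewrite -[q %/ M]/(val (row q)) -[q %% M]/(val (col q)).
  rewrite !(ag aR) // !(ag2 aR) // (ag aAR) // (ag2 aAR) // !hR.
  rewrite qE; have [-> _] := st (row q) (col q).
  by rewrite /lv /leaving (inj_eq val_inj); case: (arc _ _ _ _ _).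
have He (s3 : store) (q : 'I_(M * M)) : (forall c l, c != aDEL -> s3 c l = s2 c l) ->
    ev (upd env 2 q) s3 (XG aSL (XV 2)) = slkn s (row q) (col q).
  move=> ag; rewrite /= /upd /= ag // ag2 //.
  by have [_ <-] := st (row q) (col q); rewrite -qE.
have [d1 d2 d3] := @MinLoop_spec aDEL 2 bMM XLeaving _ env s2 (M * M) _ _ isT bMM2 HP He.
set s3 := rrun env (MinLoop aDEL 2 bMM XLeaving (XG aSL (XV 2))) s2 in d1 d2 d3.
have ag3 a i : a != aDEL -> s3 a i = s2 a i by move=> h; rewrite /s3 rframe //= (negPf h).
set d := s3 aDEL 0 in d1 d2 d3; rewrite D2 in d1 d3.
pose s4 := rrun env (RPar 5 aW2 bM (XIf (XAnd (XG aR (XV 5)) (XNot (XEq (XV 5) (XV 0))))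
                            (XAdd (XG aW2 (XV 5)) (XG0 aDEL)) (XG aW2 (XV 5)))) s3.
have b3 : bval bM s3 = M by rewrite bval_M ?ag3.
have W4 (t : 'I_M) : s4 aW2 t = s aW2 t + (if (t \in reach M1 M2 (Bs s) (w1s s) (w2s s) e) && (t != e) then d else 0).
  rewrite /s4 rPar_in ?b3 // evIf tvAnd tvNot tvEq tvG /= /upd /= he !(ag3 aR, ag2 aR) // hR (inj_eq val_inj).
  by rewrite (ag3 aW2) // (ag2 aW2) // fr //; case: ifP => _; rewrite ?addn0.
have ag4 a i : a != aW2 -> s4 a i = s3 a i by move=> h; rewrite /s4 rframe //= (negPf h).
have s'E : s' = update s4 aWC (env 0) (s4 aWC (env 0) - s4 aDEL 0) by [].
rewrite he in s'E.
have WC4 (t : 'I_M) : s4 aWC t = s aWC t by rewrite ag4 // ag3 // ag2 // fr.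
have D4 : s4 aDEL 0 = d by rewrite ag4.
have C5 : s' aWC e = s aWC e - d by rewrite s'E update_same WC4 D4.
have C6 (t : 'I_M) : t != e -> s' aWC t = s aWC t.
  by move=> te; rewrite s'E /update (inj_eq val_inj) (negPf te) andbF WC4.
have W5 (t : 'I_M) : s' aW2 t = s4 aW2 t by rewrite s'E update_diff.
have eR : e \in reach M1 M2 (Bs s) (w1s s) (w2s s) e by rewrite inE connect0.
exists d; split=> //.
- move=> u v lu; have [q qu qv] : exists2 q : 'I_(M * M), row q = u & col q = v.
    have lt : u * M + v < M * M.
      have := ltn_ord u; have := ltn_ord v; move: (val u) (val v) => a b hb ha.
      by apply: (@leq_trans (a.+1 * M)); [rewrite mulSn addnC ltn_add2r | rewrite leq_mul2r ha orbT].
    have M0 : 0 < M by apply: leq_trans (ltn_ord u).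
    exists (Ordinal lt); apply: val_inj; rewrite /= ?divnMDl ?modnMDl //.
      by rewrite divn_small ?addn0.
    by rewrite modn_small.
  by rewrite -qu -qv; apply: d2; rewrite qu qv.
- by case: d3 => [->|[q lq ->]]; [left | right; exists (row q), (col q)].
- split; apply: functional_extensionality => t; rewrite /shift1 /shift2 /w1s /w2s W5 W4.
    have [->|te] := eqVneq t e.
      by rewrite C5 eR andbF addn0; move: d1 le; clear; lia.
    by rewrite C6 // andbT; case: ifP => _; clear; lia.
  by case: ifP => _; clear; lia.
Qed.

Definition sinv (K : nat) (s : store) := [/\ tables s, valid M1 M2 (Bs s) (w1s s) (w2s s),
  #|Bs s| = K & forall t, wtT t <= s aWC t].

(** Every step raises this measure while [e] is above its target: a shift enlarges the reached set,
    closes a cycle or finishes, an augmentation brings [e] into the basis, and a basis element is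
    finished at once. It starts at 1 or more and its top value is [M + 3], whence the [M + 2] rounds
    per element. *)
Definition prog_measure (e : 'I_M) (s : store) :=
  if s aWC e == wtT e then M + 3 else if e \in Bs s then M + 2 else
  if closing M1 M2 (Bs s) (w1s s) (w2s s) e then M + 1
  else #|reach M1 M2 (Bs s) (w1s s) (w2s s) e|.

Lemma prog_measure_undone (e : 'I_M) (s : store) : s aWC e != wtT e -> prog_measure e s <= M + 2.
Proof.
rewrite /prog_measure => /negPf ->; case: ifP => // _; case: ifP => [_|_]; first by clear; lia.
by apply: leq_trans (max_card _) _; rewrite card_ord leq_addr.
Qed.

Lemma StepS_spec K (env : nat -> nat) s (e : 'I_M) : sinv K s -> env 0 = e ->
  let s' := rrun env StepS s in
  [/\ sinv K s', forall t, t != e -> s' aWC t = s aWC t,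
      s aWC e = wtT e -> s' aWC e = wtT e &
      s aWC e != wtT e -> prog_measure e s < prog_measure e s'].
Proof.
move=> [ts va cB wl] he; have [sn sm tab] := ts.
have tabs' (s' : store) : (forall a i, a \notin [:: aWC; aW2; aB] ++ scratch ++ [:: aDEL; aCUR] -> s' a i = s a i) ->
    tables s'.
  by move=> ag; split=> [||t]; rewrite ?ag //; have [h1 h2 h3 h4 h5] := tab t; rewrite !ag.
have te : s aWT e = wtT e by have [_ _ _ _ ->] := tab e.
rewrite /StepS rIf tvG [ev _ _ (XV 0)]/= he; case: ifP => eB.
  rewrite rSet /= he te; set s' := update _ _ _ _.
  have W2' : w2s s' = w2s s by apply: functional_extensionality => t; rewrite /w2s /s' update_diff.
  have BE : Bs s' = Bs s by apply/setP=> t; rewrite !in_Bs /s' update_diff.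
  have WC (t : 'I_M) : t != e -> s' aWC t = s aWC t.
    by move=> ne; rewrite /s' /update (inj_eq val_inj) (negPf ne) andbF.
  have WE : s' aWC e = wtT e by rewrite /s' update_same.
  split=> //.
  - split; [ | | by rewrite BE | by move=> t; have [->|ne] := eqVneq t e; rewrite ?WE // WC].
    + apply: tabs' => a i h; rewrite /s' update_diff //.
      by move: h; rewrite inE negb_or => /andP[].
    + rewrite BE W2'; apply: (@valid_lower _ M1 M2 (Bs s) (w1s s) (w2s s) (w1s s') e) => //.
      * by rewrite in_Bs.
      * by move=> t ne; rewrite /w1s WC // /s' update_diff.
      * by rewrite /w1s WE /s' update_diff //; have := wl e; clear; lia.
  - move=> ne; apply: leq_ltn_trans (prog_measure_undone ne) _.
    by rewrite /prog_measure WE eqxx; clear; lia.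
rewrite rIf tvLt [ev _ _ (XG aWT _)]/= [ev _ _ (XG aWC _)]/= he te.
have eB' : e \notin Bs s by rewrite in_Bs eB.
case: ifP => [lt|/negbT]; last first.
  rewrite -leqNgt => le; have E : s aWC e = wtT e by apply/eqP; rewrite eqn_leq le wl.
  by split=> //=; rewrite E eqxx.
rewrite rSeq; set s1 := rrun env (RSeq ArcP ReachP) s.
have rd : ready e s s1 by apply: ready_spec.
rewrite rSeq; have fc := FindC_spec ts va he rd; have rd2 := ready_FindC env rd.
set s2 := rrun env FindC s1 in fc rd2 *; have [_ _ _ fr2] := rd2.
have clE := find_closing fc.
rewrite rIf tvG [ev _ _ (XN 0)]/=.
have nd : s aWC e != wtT e by rewrite neq_ltn lt orbT.
have pm0 : prog_measure e s = if s2 aFND 0 != 0 then M + 1 else #|reach M1 M2 (Bs s) (w1s s) (w2s s) e|.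
  by rewrite /prog_measure (negPf nd) (negPf eB') clE.
case: ifP => fnd.
  set s' := rrun env Trace s2.
  have frT a i : a \notin [:: aB; aFND; aCUR] -> s' a i = s2 a i.
    move=> h; rewrite /s' rframe //; move: h; rewrite !inE !negb_or /=.
    by case/and3P=> /negPf -> /negPf -> /negPf ->.
  have fr' a i : a \notin [:: aWC; aW2; aB] ++ scratch ++ [:: aDEL; aCUR] -> s' a i = s a i.
    move=> h; rewrite frT ?fr2 //; apply: contra h => h.
      by rewrite !mem_cat h orbT.
    by move: h; rewrite !mem_cat !inE => /or3P[] /eqP ->.
  have w1E : w1s s' = w1s s by apply: functional_extensionality => t; rewrite /w1s !frT // !fr2.
  have w2E : w2s s' = w2s s by apply: functional_extensionality => t; rewrite /w2s !frT // !fr2.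
  have WC (t : nat) : s' aWC t = s aWC t by rewrite frT // fr2.
  move: fc pm0; case E : (s2 aFND 0) / => [x0 /andP[cx0 mx]|]; last by rewrite E in fnd.
  move=> pm0; have [p [hp hl hB]] := Trace_spec ts va he rd2 eB' E cx0.
  have [va' cB' eB2] := augment_path va eB' cx0 mx hp hl hB.
  split=> //.
  - split; [exact: tabs' | by rewrite w1E w2E | by rewrite cB' | by move=> t; rewrite WC].
  - by move=> h; rewrite WC.
  - by rewrite pm0 /prog_measure WC (negPf nd) eB2 /=; clear; lia.
have [d [d1 d2 d3 [w1E w2E] [C5 C6]]] := Shift_spec ts va he rd2 eB' (wl e).
set s' := rrun env Shift s2 in w1E w2E C5 C6 *.
have frT a i : a \notin [:: aDEL; aW2; aWC] -> s' a i = s2 a i.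
  move=> h; rewrite /s' rframe //; move: h; rewrite !inE !negb_or /=.
  by case/and3P=> /negPf -> /negPf -> /negPf ->.
have fr' a i : a \notin [:: aWC; aW2; aB] ++ scratch ++ [:: aDEL; aCUR] -> s' a i = s a i.
  move=> h; rewrite frT ?fr2 //; apply: contra h => h.
    by rewrite !mem_cat h orbT.
  by move: h; rewrite !mem_cat !inE => /or3P[] /eqP ->.
have BE : Bs s' = Bs s by apply/setP=> t; rewrite !in_Bs frT // fr2.
have dZ u v : leaving M1 M2 (Bs s) (w1s s) (w2s s) e u v -> (d%:Z <= slack (Bs s) (w1s s) (w2s s) u v)%R.
  by move=> lu; rewrite slack_nat // ?lez_nat ?d2 //; case/and3P: lu.
have d0 : (0 <= d%:Z)%R by [].
have va' : valid M1 M2 (Bs s') (w1s s') (w2s s') by rewrite BE w1E w2E; apply: shift_valid.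
split=> //.
- split=> //; [exact: tabs' | by rewrite BE |].
  move=> t; have [->|ne] := eqVneq t e; last by rewrite C6.
  by rewrite C5; move: d1 (wl e); clear; lia.
- by move=> h; rewrite h eqxx in nd.
- move=> _; rewrite pm0 fnd.
  have rM : #|reach M1 M2 (Bs s) (w1s s) (w2s s) e| <= M by rewrite -[X in _ <= X]card_ord max_card.
  rewrite /prog_measure; case: ifP => done; first by move: rM; clear; lia.
  rewrite BE (negPf eB'); case: ifP => cl'; first by move: rM; clear; lia.
  case: d3 => [dE|[u [v [lu dE]]]].
    by move: done; rewrite C5 dE subKn ?wl // eqxx.
  have sl : slack (Bs s) (w1s s) (w2s s) u v = d%:Z%R.
    by rewrite slack_nat // ?dE //; case/and3P: lu.
  case: (shift_grow eB' d0 lu sl) => [c|pr].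
    by rewrite -w1E -w2E cl' in c.
  by rewrite w1E w2E; apply: proper_card.
Qed.

Lemma PackLoop_spec K (env : nat -> nat) s : sinv K s ->
  let s' := rrun env PackLoop s in sinv K s' /\ forall t : 'I_M, s' aWC t = wtT t.
Proof.
move=> si s'; have bE (s2 : store) : sinv K s2 -> bval bM s2 = M.
  by case=> -[h1 h2 _] _ _ _; rewrite bval_M.
pose Inv i (s2 : store) := sinv K s2 /\ forall t : 'I_M, t < i -> s2 aWC t = wtT t.
suff [h1 h2] : Inv M s' by split=> // t; apply: h2.
rewrite /s' /PackLoop -{1}(bE s) //; apply: rep_ind; first by split.
rewrite bE // => i s1 iM [si1 done1]; pose e := Ordinal iM.
have b2 : bval (BA bM (BC 2)) s1 = M + 2 by rewrite -[LHS]/(bval bM s1 + 2) bE.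
pose Inv2 j (s2 : store) := [/\ sinv K s2, forall t : 'I_M, t != e -> s2 aWC t = s1 aWC t &
  (s2 aWC e == wtT e) || (j < prog_measure e s2)].
suff [si2 oth fin] : Inv2 (M + 2) (rrun (upd env 0 i) (RRep 1 (BA bM (BC 2)) StepS) s1).
  split=> // t; rewrite ltnS leq_eqVlt => /orP[/eqP ti|ti]; last first.
    by rewrite oth ?done1 //; apply: contraTneq ti => ->; rewrite /= ltnn.
  have -> : t = e by apply: val_inj.
  case/orP: fin => [/eqP //|]; apply: contraTeq => /prog_measure_undone; clear; lia.
rewrite -{1}b2; apply: rep_ind.
  split=> //; case: (boolP (_ == _)) => //= nd; rewrite /prog_measure (negPf nd).
  case: ifP => _; first by clear; lia.
  case: ifP => _; first by clear; lia.
  by apply/card_gt0P; exists e; rewrite inE connect0.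
move=> j s2 _ [si2 oth fin].
have [si3 o3 d3 p3] := @StepS_spec K (upd (upd env 0 i) 1 j) s2 e si2 erefl.
split=> //; first by move=> t te; rewrite o3 ?oth.
case: (eqVneq (s2 aWC e) (wtT e)) fin => [/d3 -> _|nd]; first by rewrite eqxx.
by rewrite orFb => lt; rewrite (leq_trans _ (p3 nd)) ?orbT.
Qed.

End Packing.

(** * Decoding the input and making costs integral *)

Definition XIn c x := XG 0 (XAdd (XMB x (BC 5)) (XN c)).

Section InputEntries.

Variable I : fgc_instance.
Let m := nE I.

Definition inp i := nth 0 (encode I) i.

Lemma nth_flatten5 (T : Type) (f : T -> seq nat) (s : seq T) (x0 : T) j c :
  (forall x, size (f x) = 5) -> j < size s -> c < 5 ->
  nth 0 (flatten (map f s)) (5 * j + c) = nth 0 (f (nth x0 s j)) c.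
Proof.
move=> sz; elim: s j => //= x s IH [|j] js c5.
  by rewrite muln0 add0n nth_cat sz c5.
rewrite nth_cat sz ifF; last by rewrite mulnS; lia.
by rewrite (_ : 5 * j.+1 + c - 5 = 5 * j + c) ?IH // mulnS; lia.
Qed.

Lemma inp_entry (j : 'I_m) c : c < 5 -> inp (j * 5 + (2 + c)) =
  nth 0 [:: val (ends I j).1; val (ends I j).2; nat_of_bool (j \in safe I);
            absz (numq (ecost I j)); absz (denq (ecost I j))] c.
Proof.
move=> c5; rewrite /inp /encode addnCA add2n [nth _ _ _]/= mulnC.
rewrite (@nth_flatten5 _ _ _ j) //; last by rewrite size_enum_ord.
by rewrite nth_ord_enum.
Qed.

Definition den (j : 'I_m) := absz (denq (ecost I j)).
Definition num (j : 'I_m) := absz (numq (ecost I j)).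
(** A common denominator computed without gcd: each factor of the product is an input entry, as the
    bounded language requires. *)
Definition cden := \prod_(j < m) den j.
Definition cn (j : 'I_m) := cden %/ den j * num j.

Lemma den_gt0 j : 0 < den j.
Proof. by rewrite /den absz_gt0 denq_neq0. Qed.

Lemma cden_gt0 : 0 < cden.
Proof. by apply: prodn_gt0 => j; apply: den_gt0. Qed.

Lemma cnE j : ((cn j)%:R = ecost I j * cden%:R :> rat)%R.
Proof.
have dv : den j %| cden by rewrite /cden (bigD1 j) //= dvdn_mulr.
rewrite /cn natrM natf_div // -[in RHS](divq_num_den (ecost I j)).
have nE : numq (ecost I j) = (num j)%:Z%R by rewrite /num gez0_abs // numq_ge0 ecost_ge0.
have dE : denq (ecost I j) = (den j)%:Z%R by rewrite /den gez0_abs // denq_ge0.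
rewrite nE dE; field.
by rewrite pnatr_eq0 -lt0n den_gt0.
Qed.

End InputEntries.

(** * Initial basis and cost of the packing *)

Section InitProgram.

Variable k : nat.
Local Notation bM := (bM k).

(** Element [t] is arc [t %/ k] in colour [t %% k]. An arc [p] below [2 * m] is edge [p %/ 2] in the
    direction given by the parity of [p]; the others are artificial and go from the root 0 to vertex
    [p - 2 * m]. *)
Definition XP x := XDiv x (XN k).
Definition X2m := XBd (BM (BC 2) BE).
Definition XJ x := XDiv (XP x) (XN 2).
Definition XDir x := XSub (XP x) (XMB (XJ x) (BC 2)).
Definition XReal x := XLt (XP x) X2m.
(** One more than twice the total cost, hence above the weight of any packing of real arcs: an
    optimal basis avoids artificial elements whenever such a packing exists. *)
Definition XHuge := XAdd (XN 1) (XMB (XS 1 BE (XG 14 (XV 1))) (BC 2)).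

Definition InitDen := RSeq (RSet 15 (XN 0) (XN 1))
  (RRep 0 BE (RSet 15 (XN 0) (XMI (XG0 15) (XAdd (XMB (XV 0) (BC 5)) (XN 6))))).
Definition InitCost := RPar 0 14 BE
  (XMI (XDiv (XG0 15) (XIn 6 (XV 0))) (XAdd (XMB (XV 0) (BC 5)) (XN 5))).
(** With equal current weights and [w2] equal to 0, any common basis is valid; here it consists of
    the artificial arcs to all vertices but the root, in all colours. Each artificial element is a
    class of its own, which lets all colours use the same arc. *)
Definition InitTables :=
  RSeq (RPar 0 2 bM (XIf (XReal (XV 0)) (XIf (XDir (XV 0)) (XIn 2 (XJ (XV 0))) (XIn 3 (XJ (XV 0))))
                        (XSub (XP (XV 0)) X2m)))
 (RSeq (RPar 0 3 bM (XIf (XReal (XV 0)) (XIf (XDir (XV 0)) (XIn 3 (XJ (XV 0))) (XIn 2 (XJ (XV 0))))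
                        (XN 0)))
 (RSeq (RPar 0 4 bM (XSub (XV 0) (XMB (XP (XV 0)) (BC k))))
 (RSeq (RPar 0 5 bM (XIf (XReal (XV 0)) (XP (XV 0)) (XAdd X2m (XV 0))))
 (RSeq (RPar 0 6 bM (XIf (XReal (XV 0)) (XG 14 (XJ (XV 0))) XHuge))
 (RSeq (RPar 0 7 bM XHuge)
 (RSeq (RPar 0 8 bM (XN 0))
       (RPar 0 9 bM (XIf (XReal (XV 0)) (XN 0) (XSub (XP (XV 0)) X2m))))))))).
Definition PackEdges := RPar 0 21 BE
  (XB (XAny 1 bM (XAnd (XG 9 (XV 1)) (XAnd (XReal (XV 1)) (XEq (XJ (XV 1)) (XV 0)))))).
Definition Stage1 := RSeq (RSeq (RSeq InitDen InitCost) InitTables) (RSeq (PackLoop k) PackEdges).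

Hypothesis k0 : 0 < k.
Variable I : fgc_instance.
Let n := nV I.
Let m := nE I.
Let M := k * (2 * m + n).

Definition root : 'I_n := Ordinal (nV_gt0 I).
Definition huge := 1 + (\sum_(j < m) cn j) * 2.

Definition hdn (t : nat) := let p := t %/ k in
  if p < 2 * m then (if p - p %/ 2 * 2 != 0 then inp I (p %/ 2 * 5 + 2) else inp I (p %/ 2 * 5 + 3))
  else p - 2 * m.
Definition tln (t : nat) := let p := t %/ k in
  if p < 2 * m then (if p - p %/ 2 * 2 != 0 then inp I (p %/ 2 * 5 + 3) else inp I (p %/ 2 * 5 + 2))
  else 0.
Definition hdT (t : 'I_M) : 'I_n := insubd root (hdn t).
Definition tlT (t : 'I_M) : 'I_n := insubd root (tln t).
Definition coT (t : 'I_M) : 'I_k := Ordinal (ltn_pmod t k0).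
Definition clT (t : 'I_M) : nat := if t %/ k < 2 * m then t %/ k else 2 * m + t.
Definition cnn (j : nat) := if insub j is Some i then @cn I i else 0.
Definition wtT (t : 'I_M) : nat := if t %/ k < 2 * m then cnn (t %/ k %/ 2) else huge.

Lemma pT (t : 'I_M) : t %/ k < 2 * m + n.
Proof. by rewrite ltn_divLR // mulnC. Qed.

Lemma hdTE t : val (hdT t) = hdn t.
Proof.
rewrite val_insubd ifT // /hdn; case: ifP => h; last by have := pT t; lia.
have jm : t %/ k %/ 2 < m by rewrite ltn_divLR // mulnC.
have := @inp_entry I (Ordinal jm) 0 isT; have := @inp_entry I (Ordinal jm) 1 isT.
by rewrite /= => -> ->; case: ifP => _.
Qed.

Lemma tlTE t : val (tlT t) = tln t.
Proof.
rewrite val_insubd ifT // /tln; case: ifP => h; last exact: nV_gt0.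
have jm : t %/ k %/ 2 < m by rewrite ltn_divLR // mulnC.
have := @inp_entry I (Ordinal jm) 0 isT; have := @inp_entry I (Ordinal jm) 1 isT.
by rewrite /= => -> ->; case: ifP => _.
Qed.

Lemma cl_hdT t u : clT t = clT u -> hdT t = hdT u.
Proof.
move=> h; apply: val_inj; rewrite !hdTE /hdn; move: h; rewrite /clT.
case: ifP => h1; case: ifP => h2 h; try (by move: h h1 h2; clear; lia).
  by rewrite h.
by rewrite (addnI h).
Qed.

Lemma cnnE (j : 'I_m) : cnn j = cn j.
Proof. by rewrite /cnn valK. Qed.

Lemma InitDen_spec env s : (forall i, s 0 i = inp I i) ->
  let s' := rrun env InitDen s in s' 15 0 = cden I.
Proof.
move=> hs s'; pose Inv i (s2 : store) := (forall a j, a != 15 -> s2 a j = s a j) /\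
  s2 15 0 = \prod_(j < m | j < i) den j.
have b1 (s2 : store) : (forall a j, a != 15 -> s2 a j = s a j) -> bval BE s2 = m.
  by move=> ag; rewrite /bval /= ag // hs.
set s1 := rrun env (RSet 15 (XN 0) (XN 1)) s.
have a1 a j : a != 15 -> s1 a j = s a j by move=> h; rewrite /s1 rSet update_diff.
suff [_ ->] : Inv m s' by rewrite /cden; apply: eq_bigl => j; rewrite ltn_ord.
rewrite /s' /InitDen rSeq -/s1 -{1}(b1 s1 a1); apply: rep_ind.
  by split=> //; rewrite /s1 rSet /= update_same big1 // => j.
rewrite b1 // => i s2 im [ag h]; rewrite rSet; split; first by move=> a j na; rewrite update_diff ?ag.
rewrite /= /upd /= update_same h ag // hs.
have := @inp_entry I (Ordinal im) 4 isT; rewrite /= => ->.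
rewrite [RHS](bigD1 (Ordinal im)) //= mulnC; congr (_ * _); apply: eq_bigl => j.
rewrite -(inj_eq val_inj) /=; case: (ltngtP j i) => h1; rewrite ?andbF //= ?ltnS ?(ltnW h1) //.
by rewrite leqNgt h1.
Qed.

Lemma InitCost_spec env s : (forall i, s 0 i = inp I i) ->
  let s' := rrun env (RSeq InitDen InitCost) s in forall j : 'I_m, s' 14 j = cn j.
Proof.
move=> hs s' j; rewrite /s' rSeq; have D := InitDen_spec env hs.
set s1 := rrun env InitDen s in D *.
have a1 a l : a != 15 -> s1 a l = s a l by move=> h; rewrite /s1 rframe //= !(negPf h).
rewrite /InitCost rPar_in; last by rewrite /bval /= a1 // hs.
rewrite /= /upd /= D !a1 // !hs.
have := @inp_entry I j 4 isT; have := @inp_entry I j 3 isT; rewrite /= => -> ->.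
by [].
Qed.

Let M1 := forests coT tlT hdT.
Let M2 := indegrees (@root_cap 'I_k 'I_n root) cl_hdT.

Definition art (p : 'I_n * 'I_k) : nat := (2 * m + p.1) * k + p.2.
Lemma art_lt p : art p < M.
Proof.
rewrite /art /M mulnC; have := ltn_ord p.1; have := ltn_ord p.2.
move: (val p.1) (val p.2) => a b hb ha.
apply: (@leq_trans (k * (2 * m + a).+1)); first by rewrite mulnS addnC ltn_add2r.
by rewrite leq_mul2l; apply/orP; right; lia.
Qed.
Definition artT p : 'I_M := Ordinal (art_lt p).

Definition B0 := [set t : 'I_M | ~~ (t %/ k < 2 * m) && (t %/ k - 2 * m != 0)].

Lemma B0E : B0 = [set artT p | p in setX [set~ root] [set: 'I_k]].
Proof.
apply/setP=> t; rewrite inE; apply/andP/imsetP => [[h1 h2]|[p + ->]].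
  have vlt : t %/ k - 2 * m < n by have := pT t; move: h1; clear; lia.
  exists (Ordinal vlt, coT t).
    by rewrite !inE -(inj_eq val_inj) /= h2.
  apply: val_inj; rewrite -[val (artT _)]/((2 * m + (t %/ k - 2 * m)) * k + t %% k).
  by rewrite subnKC -?divn_eq // leqNgt.
rewrite !inE andbT -(inj_eq val_inj) /= => h.
rewrite /art divnMDl // divn_small // addn0; split; first by clear; lia.
by rewrite addKn.
Qed.

Lemma artT_inj : injective artT.
Proof.
move=> [a i] [b j] /(congr1 val) /= ; rewrite /art /= => h.
have := congr1 (divn^~ k) h; have := congr1 (modn^~ k) h.
rewrite !modnMDl !divnMDl // !modn_small // !divn_small // !addn0 => h1 h2.
by congr (_, _); apply: val_inj => //=; apply: (addnI h2).
Qed.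

(** In each colour the arcs form a star at the root, so the head of a removed arc is isolated in
    what remains. *)
Lemma star_forests (J : {set 'I_M}) :
  (forall t, t \in J -> tlT t = root /\ hdT t != root) ->
  (forall t u, t \in J -> u \in J -> coT t = coT u -> hdT t = hdT u -> t = u) -> M1 J.
Proof.
have [N] := ubnP #|J|; elim: N J => // N IH J hN h1 h2.
have [->|[y yJ]] := set_0Vmem J; first exact: forests0.
have s1 t : t \in J :\ y -> t \in J by rewrite !inE => /andP[].
rewrite -(setD1K yJ); apply: forests_add; rewrite ?inE ?eqxx //.
  apply: IH => [|t /s1 //|t u /s1 tJ /s1 uJ]; [|exact: h1|exact: h2].
  by move: hN; rewrite (cardsD1 y J) yJ.
have [ty hy] := h1 y yJ; apply/negP => /adjc_stay => /(_ (~: [set hdT y])).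
rewrite ty !inE eqxx eq_sym hy => H; apply: notF; apply: H => // t; rewrite !inE => /andP[ny tJ] ct.
have [-> ht] := h1 t tJ; rewrite eq_sym hy; symmetry; apply/eqP => e; case/eqP: ny; exact: h2.
Qed.

Lemma B0_valid (s : store) : Bs k n m s = B0 -> (forall t : 'I_M, s 7 t = huge) -> (forall t : 'I_M, s 8 t = 0) ->
  valid M1 M2 (Bs k n m s) (w1s s) (w2s s) /\ #|Bs k n m s| = k * n.-1.
Proof.
move=> BE h7 h8.
have artP t : t \in B0 -> exists v i, [/\ t = artT (v, i), v != root, tlT t = root, hdT t = v & coT t = i].
  rewrite B0E => /imsetP[[v i]]; rewrite !inE andbT /= => vr tE; exists v, i; split=> //.
  - apply: val_inj; rewrite tlTE tE /tln /= /art /= divnMDl // divn_small // addn0.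
    by rewrite ltnNge leq_addr.
  - apply: val_inj; rewrite hdTE tE /hdn /= /art /= divnMDl // divn_small // addn0.
    by rewrite ltnNge leq_addr /= addKn.
  - by apply: val_inj; rewrite tE /= /art /= modnMDl modn_small.
have inj t u : t \in B0 -> u \in B0 -> coT t = coT u -> hdT t = hdT u -> t = u.
  by move=> /artP[v [i [-> _ _ -> ->]]] /artP[w [j [-> _ _ -> ->]]] -> ->.
rewrite BE; split; last first.
  by rewrite B0E card_imset ?cardsX ?cardsC1 ?cardsT ?card_ord 1?mulnC //; apply: artT_inj.
split.
- by apply: star_forests => // t /artP[v [i [_ vr -> -> _]]].
- apply/capindepP; split.
    move=> t u; rewrite !inE /clT => /andP[/negPf -> _] /andP[/negPf -> _] h.
    by apply: val_inj; apply: (addnI h).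
  move=> v; rewrite /root_cap card_ord /indeg; case: eqP => [->|_].
    rewrite leqn0 cards_eq0; apply/eqP/setP=> t; rewrite [RHS]inE inE; apply/negP => /andP[/artP[w [i [_ wr _ -> _]]]].
    by rewrite (negPf wr).
  rewrite -[X in _ <= X]card_ord -(card_in_imset (f := coT)); first exact: max_card.
  move=> t u; rewrite inE => /andP[tB /eqP ht]; rewrite inE => /andP[uB /eqP hu] cc.
  by apply: inj => //; rewrite ht hu.
- by move=> x y _ _ _; rewrite /w1s !h7 !h8.
- by move=> x y _ _ _; rewrite /w2s !h8.
Qed.

Lemma InitTables_spec env s : (forall i, s 0 i = inp I i) -> (forall j : 'I_m, s 14 j = cn j) ->
  let s' := rrun env InitTables s in
  sinv tlT coT wtT root cl_hdT (k * n.-1) s'.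
Proof.
move=> hs hc s'.
have bE (s2 : store) : (forall i, s2 0 i = s 0 i) -> bval bM s2 = M.
  by move=> ag; apply: bval_M; rewrite ag hs.
have hugeE env' (s2 : store) : (forall i, s2 0 i = s 0 i) -> (forall i, s2 14 i = s 14 i) -> ev env' s2 XHuge = huge.
  move=> a0 a14; rewrite /= /upd /= /huge; congr (1 + _ * 2).
  have -> : bval BE s2 = m by rewrite /bval /= a0 hs.
  by apply: eq_bigr => j _; rewrite a14 hc.
have realE env' (s2 : store) x : (forall i, s2 0 i = s 0 i) -> tv env' s2 (XReal (XV x)) = (env' x %/ k < 2 * m).
  by move=> a0; rewrite tvLt /= mul1n /bval /= a0 hs.
have cnnJ (t : 'I_M) : t %/ k < 2 * m -> s 14 (t %/ k %/ 2) = cnn (t %/ k %/ 2).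
  by move=> h; have jm : t %/ k %/ 2 < m by [rewrite ltn_divLR // mulnC]; rewrite -[t %/ k %/ 2]/(val (Ordinal jm)) hc cnnE.
have fr (s2 : store) c a i : ~~ rwr c a -> rrun env c s2 a i = s2 a i by move=> h; rewrite rframe.
rewrite /s' /InitTables !rSeq.
set s1 := rrun env (RPar 0 2 _ _) s; set s2 := rrun env (RPar 0 3 _ _) s1.
set s3 := rrun env (RPar 0 4 _ _) s2; set s4 := rrun env (RPar 0 5 _ _) s3.
set s5 := rrun env (RPar 0 6 _ _) s4; set s6 := rrun env (RPar 0 7 _ _) s5.
set s7 := rrun env (RPar 0 8 _ _) s6; set s8 := rrun env (RPar 0 9 _ _) s7.
have f1 a i : a != 2 -> s1 a i = s a i by move=> h; rewrite /s1 fr.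
have f2 a i : a \notin [:: 2; 3] -> s2 a i = s a i.
  by rewrite !inE negb_or => /andP[h1 h2]; rewrite /s2 fr ?f1.
have f3 a i : a \notin [:: 2; 3; 4] -> s3 a i = s a i.
  by rewrite !inE !negb_or => /and3P[h1 h2 h3]; rewrite /s3 fr ?f2 // !inE negb_or h1.
have f4 a i : a \notin [:: 2; 3; 4; 5] -> s4 a i = s a i.
  by rewrite !inE !negb_or => /and4P[h1 h2 h3 h4]; rewrite /s4 fr ?f3 // !inE !negb_or h1 h2.
have f5 a i : a \notin [:: 2; 3; 4; 5; 6] -> s5 a i = s a i.
  by rewrite !inE !negb_or => /and5P[h1 h2 h3 h4 h5]; rewrite /s5 fr ?f4 // !inE !negb_or h1 h2 h3.
have f6 a i : a \notin [:: 2; 3; 4; 5; 6; 7] -> s6 a i = s a i.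
  by rewrite !inE !negb_or => /and5P[h1 h2 h3 h4 /andP[h5 h6]]; rewrite /s6 fr ?f5 // !inE !negb_or h1 h2 h3 h4.
have f7 a i : a \notin [:: 2; 3; 4; 5; 6; 7; 8] -> s7 a i = s a i.
  by rewrite !inE !negb_or => /and5P[h1 h2 h3 h4 /and3P[h5 h6 h7]]; rewrite /s7 fr ?f6 // !inE !negb_or h1 h2 h3 h4 h5.
have f8 a i : a \notin [:: 2; 3; 4; 5; 6; 7; 8; 9] -> s8 a i = s a i.
  by rewrite !inE !negb_or => /and5P[h1 h2 h3 h4 /and4P[h5 h6 h7 h8]]; rewrite /s8 fr ?f7 // !inE !negb_or h1 h2 h3 h4 h5 h6.
have a1 i : s1 0 i = s 0 i by rewrite f1.
have b1 : bval bM s1 = M by apply: bE.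
have a2 i : s2 0 i = s 0 i by rewrite f2.
have b2 : bval bM s2 = M by apply: bE.
have a3 i : s3 0 i = s 0 i by rewrite f3.
have b3 : bval bM s3 = M by apply: bE.
have a4 i : s4 0 i = s 0 i by rewrite f4.
have b4 : bval bM s4 = M by apply: bE.
have a5 i : s5 0 i = s 0 i by rewrite f5.
have b5 : bval bM s5 = M by apply: bE.
have a6 i : s6 0 i = s 0 i by rewrite f6.
have b6 : bval bM s6 = M by apply: bE.
have a7 i : s7 0 i = s 0 i by rewrite f7.
have b7 : bval bM s7 = M by apply: bE.
have T2 (t : 'I_M) : s8 2 t = hdT t.
  rewrite /s8 fr // /s7 fr // /s6 fr // /s5 fr // /s4 fr // /s3 fr // /s2 fr // /s1 rPar_in ?bE //.
  rewrite evIf realE // hdTE /hdn -[upd _ _ _ _]/(val t); case: ifP => h.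
    by rewrite evIf /tv /= /upd /= !hs.
  by rewrite /= /upd /= mul1n /bval /= hs.
have T3 (t : 'I_M) : s8 3 t = tlT t.
  rewrite /s8 fr // /s7 fr // /s6 fr // /s5 fr // /s4 fr // /s3 fr // /s2 rPar_in ?b1 //.
  rewrite evIf (realE _ _ _ a1).
  rewrite tlTE /tln -[upd _ _ _ _]/(val t); case: ifP => h //.
  by rewrite evIf /tv /= /upd /= !f1 // !hs.
have T4 (t : 'I_M) : s8 4 t = coT t.
  rewrite /s8 fr // /s7 fr // /s6 fr // /s5 fr // /s4 fr // /s3 rPar_in ?b2 //.
  by rewrite /= /upd /= /bval /= {1}(divn_eq t k) addnC addnK.
have T5 (t : 'I_M) : s8 5 t = clT t.
  rewrite /s8 fr // /s7 fr // /s6 fr // /s5 fr // /s4 rPar_in ?b3 //.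
  rewrite evIf (realE _ _ _ a3).
  rewrite /clT -[upd _ _ _ _]/(val t); case: ifP => h //.
  by rewrite /= /upd /= mul1n /bval /= f3 // hs.
have T6 (t : 'I_M) : s8 6 t = wtT t.
  rewrite /s8 fr // /s7 fr // /s6 fr // /s5 rPar_in ?b4 //.
  rewrite evIf (realE _ _ _ a4).
  rewrite /wtT -[upd _ _ _ _]/(val t); case: ifP => h; last by apply: hugeE => i; rewrite f4.
  by rewrite /= /upd /= f4 // cnnJ.
have T7 (t : 'I_M) : s8 7 t = huge.
  rewrite /s8 fr // /s7 fr // /s6 rPar_in ?b5 //.
  by apply: hugeE => i; rewrite f5.
have T8 (t : 'I_M) : s8 8 t = 0.
  by rewrite /s8 fr // /s7 rPar_in ?b6.
have T9 : Bs k n m s8 = B0.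
  apply/setP=> t; rewrite in_Bs [RHS]inE /s8 rPar_in ?b7 //.
  rewrite evIf (realE _ _ _ a7).
  rewrite -[upd _ _ _ _]/(val t); case: ifP => h //=.
  by rewrite /= /upd /= mul1n /bval /= f7 // hs.
have [va cB] := B0_valid T9 T7 T8.
split=> //.
  split; first by rewrite f8 // hs.
    by rewrite f8 // hs.
  by move=> t; split; [exact: T2 | exact: T3 | rewrite -(T4 t) | exact: T5 | exact: T6].
move=> t; rewrite T7 /wtT; case: ifP => // h; rewrite /huge.
have jm : t %/ k %/ 2 < m by rewrite ltn_divLR // (mulnC m).
rewrite -[t %/ k %/ 2]/(val (Ordinal jm)) cnnE (bigD1 (Ordinal jm)) //=.
by clear; lia.
Qed.


Definition emb_nat (a : 'I_m * bool) (i : 'I_k) : nat := (a.1 * 2 + a.2) * k + i.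

Lemma emb_lt a i : emb_nat a i < M.
Proof.
rewrite /emb_nat /M; have := ltn_ord a.1; have := ltn_ord i; have := leq_b1 a.2.
move: (val a.1) (nat_of_bool a.2) (val i) => x b y hb hy hx.
apply: (@leq_trans ((x * 2 + b).+1 * k)); first by rewrite mulSn addnC ltn_add2r.
by rewrite mulnC leq_mul2l; apply/orP; right; move: hb hx; clear; lia.
Qed.

Definition emb a i : 'I_M := Ordinal (emb_lt a i).

Definition tlA (a : 'I_m * bool) := if a.2 then (ends I a.1).2 else (ends I a.1).1.
Definition hdA (a : 'I_m * bool) := if a.2 then (ends I a.1).1 else (ends I a.1).2.

Lemma emb_p a i : emb a i %/ k = a.1 * 2 + a.2.
Proof. by rewrite /= /emb_nat divnMDl // divn_small // addn0. Qed.

Lemma emb_real a i : emb a i %/ k < 2 * m.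
Proof. by rewrite emb_p; have := ltn_ord a.1; have := leq_b1 a.2; move: (val a.1) => x; clear; lia. Qed.

Lemma emb_j a i : emb a i %/ k %/ 2 = a.1.
Proof. by rewrite emb_p divnMDl // divn_small ?addn0 //; case: (a.2). Qed.

Lemma emb_hd a i : hdT (emb a i) = hdA a.
Proof.
apply: val_inj; rewrite hdTE /hdn emb_real emb_j emb_p addKn /hdA.
have := @inp_entry I a.1 0 isT; have := @inp_entry I a.1 1 isT; rewrite /= => -> ->.
by case: (a.2).
Qed.

Lemma emb_tl a i : tlT (emb a i) = tlA a.
Proof.
apply: val_inj; rewrite tlTE /tln emb_real emb_j emb_p addKn /tlA.
have := @inp_entry I a.1 0 isT; have := @inp_entry I a.1 1 isT; rewrite /= => -> ->.
by case: (a.2).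
Qed.

Lemma emb_co a i : coT (emb a i) = i.
Proof. by apply: val_inj; rewrite /= /emb_nat modnMDl modn_small. Qed.

Lemma emb_cl a b i j : clT (emb a i) = clT (emb b j) -> a = b.
Proof.
rewrite /clT !emb_real !emb_p; case: a b => [x p] [y q] /= h.
have e : p = q by case: p q h => [] [] //; move: (val x) (val y); clear; lia.
rewrite e in h *; congr (_, _); apply: val_inj; apply/eqP.
by rewrite -(eqn_pmul2r (isT : 0 < 2)); apply/eqP; apply: (addIn h).
Qed.

Lemma real_emb (t : 'I_M) : t %/ k < 2 * m -> exists a, t = emb a (coT t).
Proof.
move=> h; have jm : t %/ k %/ 2 < m by rewrite ltn_divLR // mulnC.
exists (Ordinal jm, odd (t %/ k)); apply: val_inj.
rewrite -[val (emb _ _)]/((t %/ k %/ 2 * 2 + odd (t %/ k)) * k + t %% k) -modn2 -divn_eq.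
exact: divn_eq.
Qed.

(** Every edge of the cut has an orientation entering [S]. *)
Lemma rooted_bidirected (F : {set 'I_m}) :
  (forall S, S != set0 -> S != setT -> k <= #|cut (ends I) F S|) ->
  rooted tlA hdA root k [set a : 'I_m * bool | a.1 \in F].
Proof.
move=> Fk S S0 rS; have ST : S != setT by apply: contraNneq rS => ->; rewrite inE.
apply: leq_trans (Fk S S0 ST) _.
rewrite -(card_imset _ (f := fun j : 'I_m => (j, (ends I j).1 \in S))); last by move=> i j [].
apply: subset_leq_card; apply/subsetP=> _ /imsetP[j + ->]; rewrite in_cut !inE /cr /hdA /tlA /=.
case/andP=> -> /=; case: ifP => // h; by rewrite ?h //=; case: (_ \in S).
Qed.

Theorem Stage1_spec env s : (forall i, s 0 i = inp I i) ->
  let s' := rrun env Stage1 s in let H := [set j : 'I_m | s' 21 j != 0] in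
  (forall j : 'I_m, s' 14 j = cn j) /\
  forall F : {set 'I_m}, (forall S, S != set0 -> S != setT -> k <= #|cut (ends I) F S|) ->
    (forall S, S != set0 -> S != setT -> k <= #|cut (ends I) H S|) /\
    \sum_(j in H) cn j <= 2 * \sum_(j in F) cn j.
Proof.
move=> hs s' H.
pose s1 := rrun env (RSeq InitDen InitCost) s; pose s2 := rrun env InitTables s1.
pose s3 := rrun env (PackLoop k) s2.
have c1 : forall j : 'I_m, s1 14 j = cn j by apply: InitCost_spec.
have h1 i : s1 0 i = inp I i by rewrite /s1 rframe.
have si := InitTables_spec env h1 c1; rewrite -/s2 in si.
have [[ts va cB _] wc] := PackLoop_spec (erefl : val root = 0) env si; rewrite -/s3 in ts va cB wc.
have s'E : s' = rrun env PackEdges s3 by [].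
have h3 i : s3 0 i = inp I i by rewrite /s3 rframe // /s2 rframe.
set B := Bs k n m s3 in va cB.
have inH (j : 'I_m) : (j \in H) = [exists t : 'I_M, [&& t \in B, t %/ k < 2 * m & t %/ k %/ 2 == j]].
  rewrite inE s'E /PackEdges rPar_in; last by rewrite /bval /= h3.
  rewrite evB (@tvAnyE _ _ _ _ _ M); last by apply: bval_M; rewrite h3.
  rewrite -[X in X = _]/(nat_of_bool _ != 0); case: (boolP [exists i, _]) => [/existsP[t]|/existsPn no].
    rewrite tvAnd tvG tvAnd tvEq /XReal tvLt /= /upd /= mul1n /bval /= h3 => ht.
    by symmetry; apply/existsP; exists t; rewrite in_Bs.
  symmetry; apply/existsP => -[t ht]; have := no t.
  rewrite tvAnd tvG tvAnd tvEq /XReal tvLt /= /upd /= mul1n /bval /= h3 -[inp I 1]/m -/n.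
  by move: ht; rewrite in_Bs => ->.
split.
  by move=> j; rewrite s'E rframe // /s3 rframe // /s2 rframe.
move=> F Fk; have rD := rooted_bidirected Fk.
have wE (t : 'I_M) : (w1s s3 t + w2s s3 t = (wtT t)%:Z)%R by rewrite /w1s /w2s wc subrK.
have wtE (X : {set 'I_M}) : wt (fun t => w1s s3 t + w2s s3 t)%R X = (\sum_(t in X) wtT t)%:Z%R.
  rewrite /wt -natz natr_sum; apply: eq_bigr => t _; by rewrite wE natz.
have wemb a i : wtT (emb a i) = cn a.1 by rewrite /wtT emb_real emb_j cnnE.
have [Bo [fo co cardo _ sumo]] := common_basis_exists emb_tl emb_hd emb_co emb_cl rD wemb.
rewrite card_ord in cardo.
have le1 : \sum_(t in B) wtT t <= \sum_(t in Bo) wtT t.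
  have := valid_min va fo co; rewrite cB cardo => /(_ erefl); by rewrite !wtE.
have sumD : \sum_(a in [set a : 'I_m * bool | a.1 \in F]) cn a.1 = 2 * \sum_(j in F) cn j.
  rewrite (eq_bigl (fun a : 'I_m * bool => (a.1 \in F) && true)); last by move=> a; rewrite inE andbT.
  rewrite -(pair_big (mem F) xpredT (fun j (b : bool) => cn j)) /= big_distrr /=.
  by apply: eq_bigr => j _; rewrite big_bool /= mul2n addnn.
have le2 : \sum_(t in B) wtT t <= 2 * \sum_(j in F) cn j by rewrite -sumD; apply: leq_trans le1 sumo.
(* A single artificial element would outweigh twice the cost of [F]. *)
have realB t : t \in B -> t %/ k < 2 * m.
  move=> tB; apply: contraT => nr; move: le2; rewrite leqNgt; case/negP.
  apply: (@leq_trans huge).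
    rewrite /huge add1n ltnS mulnC leq_mul2r; apply/orP; right.
    by rewrite [X in _ <= X](bigID (mem F)) /= leq_addr.
  by rewrite (bigD1 t) //= {1}/wtT (negPf nr) leq_addr.
have [m1 m2 _ _] := va.
split; last first.
  apply: leq_trans le2.
  (* One basis element is chosen for each edge of [H], so [H] costs no more than the basis. *)
  pose g (j : 'I_m) := [pick t : 'I_M | [&& t \in B, t %/ k < 2 * m & t %/ k %/ 2 == j]].
  have gP j : j \in H -> exists t : 'I_M, [/\ g j = Some t, t \in B, t %/ k < 2 * m & t %/ k %/ 2 = j].
    rewrite inH /g => /existsP[t ht]; case: pickP => [u /and3P[u1 u2 /eqP u3]|no]; first by exists u.
    by have := no t; rewrite ht.
  have [H0|[j0 j0H]] := set_0Vmem H; first by rewrite H0 big_set0.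
  have [t0 _] := gP j0 j0H; pose f j := odflt t0 (g j).
  have fP j : j \in H -> [/\ f j \in B, f j %/ k < 2 * m & f j %/ k %/ 2 = j].
    by move=> /gP[t [gt tB tr tj]]; rewrite /f gt.
  have fI : {in H &, injective f}.
    move=> i j iH jH e; apply: val_inj; have [_ _ e1] := fP i iH; have [_ _ e2] := fP j jH; by rewrite /= -e1 -e2 e.
  have -> : \sum_(j in H) cn j = \sum_(t in f @: H) wtT t.
    rewrite big_imset //; apply: eq_bigr => j jH; have [_ fr fj] := fP j jH.
    by rewrite /wtT fr fj cnnE.
  rewrite [X in _ <= X](bigID (mem (f @: H))) /=.
  have eB t : (t \in f @: H) = (t \in B) && (t \in f @: H).
    by rewrite andb_idl // => /imsetP[j jH ->]; have [] := fP j jH.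
  by rewrite (eq_bigl _ _ eB) leq_addr.
suff enter (S : {set 'I_n}) : S != set0 -> root \notin S -> k <= #|cut (ends I) H S|.
  move=> S S0 ST; case: (boolP (root \in S)) => rS; last exact: enter.
  rewrite -cutC; apply: enter; last by rewrite inE rS.
  by apply: contra ST => /eqP h; rewrite -[S]setCK h setC0.
move=> S0 rS; have := @common_basis_enters _ _ _ _ _ _ _ _ _ B S m1 m2; rewrite !card_ord => /(_ cB S0 rS) /leq_trans; apply.
set X := [set t in B | _].
have XP t : t \in X -> exists a, [/\ t = emb a (coT t), t \in B, hdA a \in S & tlA a \notin S].
  rewrite inE => /and3P[tB hS tS]; have [a ta] := real_emb (realB t tB).
  by exists a; rewrite -(emb_hd a (coT t)) -(emb_tl a (coT t)) -ta.
(* Basis elements entering [S] come from distinct edges: the two directions of an edge cannot both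
   enter [S], and an arc occurs in one colour only. *)
pose f (t : 'I_M) : option 'I_m := insub (t %/ k %/ 2).
have fE a i : f (emb a i) = Some a.1 by rewrite /f emb_j valK.
rewrite -(card_in_imset (f := f) (D := mem X)).
  rewrite -(card_imset (mem (cut (ends I) H S)) (@Some_inj _)); apply: subset_leq_card.
  apply/subsetP=> _ /imsetP[t tX ->]; have [a [ta tB hS tS]] := XP t tX.
  rewrite ta fE; apply: imset_f; rewrite in_cut inH; apply/andP; split.
    by apply/existsP; exists t; rewrite tB realB //= ta emb_j.
  by move: hS tS; rewrite /hdA /tlA /cr; case: (a.2) => [-> /negPf ->|-> /negPf ->].
move=> t u tX uX; have [a [ta tB hS tS]] := XP t tX; have [b [ub uB hS2 tS2]] := XP u uX.
rewrite {1}ta {1}ub !fE => -[ab].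
have ab2 : a = b.
  case: a b ab hS tS hS2 tS2 {ta ub} => [x p] [y q] /= ->; rewrite /hdA /tlA /=.
  by case: p; case: q => // h1' h2' h3' h4'; rewrite ?h1' ?h3' in h2' h4'.
have /capindepP[inj _] := m2; apply: inj => //.
by rewrite ta ub ab2 /clT !emb_real !emb_p.
Qed.

End InitProgram.

Ltac notwritten h := apply: contra h => /=; rewrite ?inE;
  repeat (match goal with
  | |- is_true (_ || _) -> _ => case/orP
  | |- is_true (_ == _) -> _ => move/eqP->
  | |- is_true false -> _ => by [] end); by [].

(** * The augmentation program *)

Fixpoint bpow (k : nat) : bnd := if k is k'.+1 then BM BE (bpow k') else BC 1.

Lemma bval_pow k s : bval (bpow k) s = (s 0 1) ^ k.
Proof. by elim: k => //= k IH; rewrite expnS -IH. Qed.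

Section Augmentation.

Variable k : nat.

(* Arrays: 14 costs, 21 H, 22 chosen edges J, 23 order of choice (edge + 1), 24
   reduced costs, 25 edges removed from H, 27 component of H minus 25, 29 is it
   violated, 30 least size of a violated set at a vertex, 31 minimal violated set
   at a vertex (least member + 1), 33 edge picked (+ 1), 34 is any set violated. *)
Definition XU x := XIn 2 x.
Definition XW x := XIn 3 x.
Definition XCr x := XNot (XEq (XB (XG 27 (XU x))) (XB (XG 27 (XW x)))).
(** The [k] digits in base [m] of the counter name the edges to remove from [H], so [m ^ k] rounds
    run through every choice of [k] edges. *)
Definition Digits := RSeq (RSeq (RPar 8 25 BE (XN 0)) (RSet 26 (XN 0) (XV 1)))
  (RRep 3 (BC k) (RSeq (RSet 25 (XMod (XG0 26) BE) (XN 1)) (RSet 26 (XN 0) (XDiv (XG0 26) (XBd BE))))).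
Definition CompSrc := XEq (XV 5) (XV 2).
Definition CompRel := XAny 7 BE (XAnd (XAnd (XG 21 (XV 7)) (XNot (XG 25 (XV 7))))
  (XOr (XAnd (XEq (XU (XV 7)) (XV 6)) (XEq (XW (XV 7)) (XV 5)))
       (XAnd (XEq (XU (XV 7)) (XV 5)) (XEq (XW (XV 7)) (XV 6))))).
(** The set is a component, hence nonempty, and the full vertex set fails the first test, as its cut
    is empty and [k] is positive. *)
Definition XViol := XAnd (XEq (XS 7 BE (XB (XAnd (XG 21 (XV 7)) (XCr (XV 7))))) (XN k))
  (XAnd (XAny 7 BE (XAnd (XG 21 (XV 7)) (XAnd (XCr (XV 7)) (XNot (XIn 4 (XV 7))))))
        (XNot (XAny 7 BE (XAnd (XG 22 (XV 7)) (XCr (XV 7)))))).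
Definition CompS := RSeq (RSeq Digits (Reach 27 28 4 5 6 BV CompSrc CompRel))
                         (RSet 29 (XN 0) (XB XViol)).
Definition AllSets c := RRep 1 (bpow k) (RRep 2 BV (RSeq CompS c)).

Definition XSize x := XS x BV (XB (XG 27 (XV x))).
Definition Pass1 := RSeq (RPar 5 30 BV (XAdd (XBd BV) (XN 1)))
  (AllSets (RIf (XAnd (XG0 29) (XLt (XSize 7) (XG 30 (XV 2)))) (RSet 30 (XV 2) (XSize 7)) RSkip)).
(** A violated set is minimal when its size is least at each of its vertices. The last conjunct
    makes the start vertex its least member, which serves as label. *)
Definition XMinTest := XAnd (XG0 29)
  (XAnd (XNot (XAny 7 BV (XAnd (XG 27 (XV 7)) (XLt (XG 30 (XV 7)) (XSize 8)))))
        (XNot (XAny 7 BV (XAnd (XG 27 (XV 7)) (XLt (XV 7) (XV 2)))))).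
Definition Pass2 := RSeq (RPar 5 31 BV (XN 0))
  (AllSets (RIf XMinTest (RPar 5 31 BV (XIf (XG 27 (XV 5)) (XAdd (XV 2) (XN 1)) (XG 31 (XV 5)))) RSkip)).
Definition MinSets := RSeq Pass1 Pass2.
Definition AnyViol := RSeq (RSet 34 (XN 0) (XN 0)) (AllSets (RIf (XG0 29) (RSet 34 (XN 0) (XN 1)) RSkip)).

Definition XDeg x := XIf (XEq (XG 31 (XU x)) (XG 31 (XW x))) (XN 0)
  (XAdd (XB (XG 31 (XU x))) (XB (XG 31 (XW x)))).
Definition XCand x := XAnd (XNot (XG 21 x)) (XAnd (XNot (XG 22 x)) (XDeg x)).
(** Twice the cost divided by the degree, which is 1 or 2 for a candidate: doubling the costs avoids
    a fraction here. *)
Definition XRho x := XIf (XEq (XDeg x) (XN 1)) (XAdd (XG 24 x) (XG 24 x)) (XG 24 x).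
Definition XBest := XAnd (XCand (XV 3))
  (XNot (XAny 7 BE (XAnd (XCand (XV 7)) (XLt (XRho (XV 7)) (XRho (XV 3)))))).
Definition Pick := Find 33 3 BE XBest.
Definition XE0 := XSub (XG0 33) (XN 1).
(** [rho] times the degree, by cases, since the language has no product of two computed values. *)
Definition XDrop := XIf (XDeg (XV 8))
  (XIf (XEq (XDeg (XV 8)) (XN 1)) (XG0 32) (XAdd (XG0 32) (XG0 32))) (XN 0).
Definition Grow := RSeq (RSeq (RSet 32 (XN 0) (XRho XE0))
    (RPar 8 24 BE (XSub (XAdd (XG 24 (XV 8)) (XG 24 (XV 8))) XDrop)))
  (RSeq (RSet 22 XE0 (XN 1)) (RSet 23 (XV 0) (XG0 33))).
Definition Iter := RSeq (RSeq MinSets Pick) (RIf (XG0 33) Grow (RSet 23 (XV 0) (XN 0))).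
Definition Forward := RSeq (RSeq (RPar 8 22 BE (XN 0)) (RPar 8 24 BE (XG 14 (XV 8)))) (RRep 0 BE Iter).
(** Deletion runs through the chosen edges from the last to the first. *)
Definition XE1 := XG 23 (XSub (XBd BE) (XAdd (XV 0) (XN 1))).
Definition Shrink := RIf XE1
  (RSeq (RSeq (RSet 22 (XSub XE1 (XN 1)) (XN 0)) AnyViol)
        (RIf (XG0 34) (RSet 22 (XSub XE1 (XN 1)) (XN 1)) RSkip)) RSkip.
Definition Stage2 := RSeq (RSeq Forward (RRep 0 BE Shrink))
  (RPar 8 1 BE (XB (XOr (XG 21 (XV 8)) (XG 22 (XV 8))))).

Hypothesis k0 : 0 < k.
Variable I : fgc_instance.
Let n := nV I.
Let m := nE I.
Variable Hs : {set 'I_m}.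
Hypothesis Hk : forall S, S != set0 -> S != setT -> k <= #|cut (ends I) Hs S|.

Definition base (s : store) := (forall i, s 0 i = inp I i) /\ forall j : 'I_m, (s 21 j != 0) = (j \in Hs).
Definition Js (s : store) := [set j : 'I_m | s 22 j != 0].
Definition vio s := viol (ends I) k Hs (safe I) (Js s).

Definition digset t := [set j : 'I_m | has (fun q => val j == t %/ m ^ q %% m) (iota 0 k)].
Definition compset t v := [set u | connect (adjacent (ends I) (Hs :\: digset t)) v u].

Lemma digits_exist (l : seq nat) : all (fun x => x < m) l ->
  exists2 t, t < m ^ size l & forall q, q < size l -> t %/ m ^ q %% m = nth 0 l q.
Proof.
elim: l => [|x l IH] /=; first by move=> _; exists 0.
case/andP=> xm /IH[t tl ht]; have m0 : 0 < m by apply: leq_trans xm.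
exists (x + t * m).
  apply: (@leq_trans (t.+1 * m)); first by rewrite mulSn ltn_add2r.
  by rewrite expnS mulnC leq_mul2l tl orbT.
case=> [|q] ql; first by rewrite expn0 divn1 addnC modnMDl modn_small.
by rewrite expnS divnMA addnC divnMDl // (divn_small xm) addn0 ht.
Qed.

(** The digits are the [k] edges of the cut of [S]: the component of [v] cannot leave [S], and by
    [viol_connected] it fills [S]. *)
Lemma compset_viol J S (v : 'I_n) : S \in viol (ends I) k Hs (safe I) J -> v \in S ->
  exists2 t, t < m ^ k & compset t v = S.
Proof.
move=> SF vS; have [S0 ST cS _ _] := violP _ _ _ _ _ _ SF.
pose l := [seq val j | j <- enum (cut (ends I) Hs S)].
have sl : size l = k by rewrite size_map -cardE.
have [|t tl ht] := @digits_exist l; first by apply/allP=> _ /mapP[j _ ->]; apply: ltn_ord.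
rewrite sl in tl ht; exists t => //.
have dE : digset t = cut (ends I) Hs S.
  apply/setP=> j; rewrite inE; apply/hasP/idP => [[q]|jc].
    rewrite mem_iota add0n => /= qk; rewrite ht // => /eqP jq.
    have : nth 0 l q \in l by rewrite mem_nth ?sl.
    by rewrite -jq mem_map ?mem_enum //; apply: val_inj.
  have jl : val j \in l by rewrite mem_map ?mem_enum //; apply: val_inj.
  exists (index (val j) l); first by rewrite mem_iota add0n leq0n -sl index_mem.
  by rewrite ht -?sl ?index_mem // nth_index.
have stay u w : adjacent (ends I) (Hs :\: digset t) u w -> (u \in S) = (w \in S).
  case/existsP=> e /andP[]; rewrite dE in_setD in_cut => /andP[nc eH] he.
  move: nc; rewrite eH /= /cr; case/orP: he => /eqP -> /=.
    by case: (u \in S); case: (w \in S).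
  by case: (u \in S); case: (w \in S).
have sub : compset t v \subset S.
  by apply/subsetP=> u; rewrite inE => c; rewrite -(closed_connect stay c).
apply/eqP; rewrite eqEproper sub; apply/negP=> pr.
have C0 : compset t v != set0 by apply/set0Pn; exists v; rewrite inE connect0.
have /existsP[e /andP[eH ec]] := viol_connected Hk k0 SF C0 pr.
rewrite -dE in eH; move: ec; rewrite /cr !inE; case E1 : (ends I e) => [p q] /=.
have pq : adjacent (ends I) (Hs :\: digset t) p q by apply/existsP; exists e; rewrite eH E1 eqxx.
have qp : adjacent (ends I) (Hs :\: digset t) q p by apply/existsP; exists e; rewrite eH E1 eqxx orbT.
case: (boolP (connect _ v p)) => [cp|ncp]; case: (boolP (connect _ v q)) => [cq|ncq] //= _.
  by rewrite (connect_trans cp (connect1 pq)) in ncq.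
by rewrite (connect_trans cq (connect1 qp)) in ncp.
Qed.

Lemma inU (s : store) env x (j : 'I_m) : (forall i, s 0 i = inp I i) -> ev env s x = j ->
  [/\ ev env s (XU x) = (ends I j).1, ev env s (XW x) = (ends I j).2 & ev env s (XIn 4 x) = (j \in safe I)].
Proof.
move=> hs hx; have := @inp_entry I j 0 isT; have := @inp_entry I j 1 isT; have := @inp_entry I j 2 isT.
have ex c : ev env s (XIn c x) = inp I (j * 5 + c).
  by rewrite -[LHS]/(s 0 (ev env s x * 5 + c)) hx hs.
by rewrite /XU /XW !ex /= => -> -> ->.
Qed.

Lemma Digits_spec env s t : (forall i, s 0 i = inp I i) -> env 1 = t ->
  let s' := rrun env Digits s in forall j : 'I_m, (s' 25 j != 0) = (j \in digset t).
Proof.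
move=> hs ht s' j; rewrite inE.
set s1 := rrun env (RSeq (RPar 8 25 BE (XN 0)) (RSet 26 (XN 0) (XV 1))) s.
have h1 i : s1 0 i = inp I i by rewrite /s1 rframe.
pose Inv i (s2 : store) := [/\ forall l, s2 0 l = inp I l, s2 26 0 = t %/ m ^ i &
  forall j : 'I_m, (s2 25 j != 0) = has (fun q => val j == t %/ m ^ q %% m) (iota 0 i)].
suff [_ _ ->] : Inv k s' by [].
rewrite /s' /Digits rSeq -/s1; have {1}-> : k = bval (BC k) s1 by []. apply: rep_ind.
  split=> //; first by rewrite /s1 rSeq rSet /= update_same expn0 divn1.
  by move=> l; rewrite /s1 rSeq rSet update_diff // rPar_in //= /bval /= hs.
move=> i s2 _ [z0 q0 mk]; rewrite rSeq !rSet.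
have bE (s4 : store) : (forall l, s4 0 l = inp I l) -> bval BE s4 = m by move=> h; rewrite /bval /= h.
have E1 env' : ev env' s2 (XMod (XG0 26) BE) = t %/ m ^ i %% m.
  by rewrite /= bE // mul1n q0 {1}(divn_eq (t %/ m ^ i) m) addnC addnK.
split.
- by move=> l; rewrite !update_diff.
- rewrite /= update_same update_diff // bE ?mul1n; last by move=> l; rewrite update_diff.
  by rewrite q0 -divnMA -expnSr.
- move=> l; have iE : iota 0 i.+1 = iota 0 i ++ [:: i] by rewrite -addn1 iotaD.
  rewrite update_diff // E1 iE has_cat -mk /= orbF.
  by rewrite /update eqxx /=; case: (nat_of_ord l == _ %% _); rewrite ?orbT ?orbF.
Qed.

Lemma CompS_spec (env : nat -> nat) s (t : nat) (v : 'I_n) : base s -> env 1 = t -> env 2 = v ->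
  let s' := rrun env CompS s in
  (forall u : 'I_n, (s' 27 u != 0) = (u \in compset t v)) /\
  (s' 29 0 != 0) = (compset t v \in vio s) /\
  (forall a i, a \notin [:: 25; 26; 27; 28; 29] -> s' a i = s a i).
Proof.
move=> [hs hH] ht hv s'.
pose s1 := rrun env Digits s; pose s2 := rrun env (Reach 27 28 4 5 6 BV CompSrc CompRel) s1.
have s'E : s' = rrun env (RSet 29 (XN 0) (XB XViol)) s2 by [].
have dg := Digits_spec hs ht; rewrite -/s1 in dg.
have f1 a i : a \notin [:: 25; 26] -> s1 a i = s a i.
  by rewrite !inE negb_or => /andP[h1 h2]; rewrite /s1 rframe //= !(negPf h1) !(negPf h2).
have f2 a i : a \notin [:: 27; 28] -> s2 a i = s1 a i.
  by rewrite !inE negb_or => /andP[h1 h2]; rewrite /s2 rframe //= !(negPf h1) !(negPf h2).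
have n1 : bval BV s1 = n by rewrite /bval /= f1 // hs.
have Hs1 (s3 : store) i (j : 'I_n) : (forall a l, a != 27 -> a != 28 -> s3 a l = s1 a l) ->
    tv (upd (upd env 4 i) 5 j) s3 CompSrc = (j == v).
  by move=> ag; rewrite tvEq /= /upd /= hv.
have Hr1 (s3 : store) i (j l : 'I_n) : (forall a l, a != 27 -> a != 28 -> s3 a l = s1 a l) ->
    tv (upd (upd (upd env 4 i) 5 j) 6 l) s3 CompRel = adjacent (ends I) (Hs :\: digset t) l j.
  move=> ag; have z3 i' : s3 0 i' = inp I i' by rewrite ag // f1.
  rewrite /CompRel (@tvAnyE _ _ _ _ _ m); last by rewrite /bval /= z3.
  apply: eq_existsb => h.
  have [e1 e2 _] := @inU s3 (upd (upd (upd (upd env 4 i) 5 j) 6 l) 7 h) (XV 7) h z3 erefl.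
  rewrite !tvAnd tvOr !tvAnd tvNot !tvG !tvEq e1 e2 [ev _ _ (XV 7)]/= [ev _ _ (XV 6)]/= [ev _ _ (XV 5)]/=.
  rewrite /upd /= !ag // dg f1 // hH in_setD [in RHS]andbC -andbA.
  by case: (ends I h) => p q; rewrite !xpair_eqE !(inj_eq val_inj) /= andbC -andbA andbCA.
have [R1 _] := @Reach_spec 27 28 4 5 6 BV CompSrc CompRel env s1 n _ _ isT isT isT isT n1 Hs1 Hr1.
have R2 (u : 'I_n) : (s2 27 u != 0) = (u \in compset t v).
  rewrite R1 layerP inE; apply/existsP/idP => [[i /andP[/eqP-> //]]|c].
  by exists v; rewrite eqxx.
have z2 i : s2 0 i = inp I i by rewrite f2 // f1.
have m2 : bval BE s2 = m by rewrite /bval /= z2.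
have crE (env' : nat -> nat) (h : 'I_m) : env' 7 = h -> tv env' s2 (XCr (XV 7)) = cr (ends I) (compset t v) h.
  move=> e7; have [e1 e2 _] := @inU s2 env' (XV 7) h z2 e7.
  rewrite /XCr tvNot tvEq !evB !tvG e1 e2 !R2 /cr.
  by case: (_ \in compset t v); case: (_ \in compset t v).
split; first by move=> u; rewrite s'E rSet update_diff // R2.
split; last first.
  move=> a i; rewrite !inE !negb_or => /and5P[h1 h2 h3 h4 h5].
  by rewrite s'E rSet update_diff // f2 ?f1 // !inE ?negb_or ?h1 ?h2 ?h3 ?h4.
rewrite s'E rSet [ev _ _ (XN 0)]/= update_same -/(tv _ _ _) tvB /XViol !tvAnd tvEq tvNot.
have H2 (h : 'I_m) : (s2 21 h != 0) = (h \in Hs) by rewrite f2 // f1 // hH.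
have J2 (h : 'I_m) : (s2 22 h != 0) = (h \in Js s) by rewrite f2 // f1 // inE.
rewrite (@evSE _ _ _ _ _ m) // !(@tvAnyE _ _ _ _ _ m) // [ev _ _ (XN k)]/=.
have -> : \sum_(i < m) ev (upd env 7 i) s2 (XB (XAnd (XG 21 (XV 7)) (XCr (XV 7)))) =
    #|cut (ends I) Hs (compset t v)|.
  rewrite cut_sum [RHS]big_mkcond; apply: eq_bigr => h _.
  by rewrite evB tvAnd tvG (crE _ h) // [ev _ _ (XV 7)]/= /upd /= H2; case: (h \in Hs).
have -> : [exists i : 'I_m, tv (upd env 7 i) s2 (XAnd (XG 21 (XV 7)) (XAnd (XCr (XV 7)) (XNot (XIn 4 (XV 7)))))] =
   [exists e in cut (ends I) Hs (compset t v), e \notin safe I].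
  apply: eq_existsb => h; have [_ _ e3] := @inU s2 (upd env 7 h) (XV 7) h z2 erefl.
  rewrite tvAnd tvG tvAnd (crE _ h) // tvNot /tv e3 [ev _ _ (XV 7)]/= {1}/upd /= H2 in_cut.
  by case: (h \in Hs); case: (h \in safe I); rewrite /= ?andbT ?andbF.
have -> : [exists i : 'I_m, tv (upd env 7 i) s2 (XAnd (XG 22 (XV 7)) (XCr (XV 7)))] =
   (cut (ends I) (Js s) (compset t v) != set0).
  apply/existsP/set0Pn => -[h hh]; exists h; move: hh; rewrite tvAnd tvG (crE _ h) // in_cut [ev _ _ (XV 7)]/= {1}/upd /= J2 //.
rewrite negbK /vio inE; set S := compset t v.
have -> : S != set0 by apply/set0Pn; exists v; rewrite inE connect0.
have [ck|] := eqVneq #|cut (ends I) Hs S| k; last by rewrite /= andbF.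
have -> // : S != setT.
apply: contraTneq k0 => ST; rewrite -ck ST (_ : cut _ _ _ = set0) ?cards0 //.
by apply/setP=> e; rewrite in_cut /cr !inE andbF.
Qed.

(** [P] is an invariant of the enumeration, and [Q t v] a fact established at the visit of [(t, v)]
    and preserved by later visits. *)
Lemma AllSets_ind env c s (P : store -> Prop) (Q : nat -> 'I_n -> store -> Prop) :
  (forall s', P s' -> forall i, s' 0 i = inp I i) -> P s ->
  (forall t (v : 'I_n) s', t < m ^ k -> P s' ->
     [/\ P (rrun (upd (upd env 1 t) 2 v) (RSeq CompS c) s'),
         Q t v (rrun (upd (upd env 1 t) 2 v) (RSeq CompS c) s') &
         forall t' v', Q t' v' s' -> Q t' v' (rrun (upd (upd env 1 t) 2 v) (RSeq CompS c) s')]) ->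
  let s' := rrun env (AllSets c) s in P s' /\ forall t (v : 'I_n), t < m ^ k -> Q t v s'.
Proof.
move=> P0 Ps step s'.
have bT (s2 : store) : P s2 -> bval (bpow k) s2 = m ^ k by move=> /P0 h; rewrite bval_pow h.
have bN (s2 : store) : P s2 -> bval BV s2 = n by move=> /P0 h; rewrite /bval /= h.
pose Inv i (s2 : store) := P s2 /\ forall t (v : 'I_n), t < i -> Q t v s2.
suff [h1 h2] : Inv (m ^ k) s' by [].
rewrite /s' /AllSets -{1}(bT s) //; apply: rep_ind; first by split.
rewrite bT // => t s1 tT [P1 Q1].
pose Inv2 j (s2 : store) := P s2 /\ forall t' (v : 'I_n), (t' < t) || (t' == t) && (v < j) -> Q t' v s2.
suff [P2 Q2] : Inv2 n (rrun (upd env 1 t) (RRep 2 BV (RSeq CompS c)) s1).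
  by split=> // t' v; rewrite ltnS leq_eqVlt orbC => h; apply: Q2; rewrite ltn_ord andbT.
rewrite -{1}(bN s1) //; apply: rep_ind; first by split=> // t' v; rewrite ltn0 andbF orbF; apply: Q1.
rewrite bN // => j s2 jn [P2 Q2]; have [P3 Q3 Q4] := step t (Ordinal jn) s2 tT P2.
split=> // t' v /orP[lt|/andP[/eqP-> ]]; first by apply: Q4; apply: Q2; rewrite lt.
rewrite ltnS leq_eqVlt => /orP[/eqP vj|vj]; last by apply: Q4; apply: Q2; rewrite eqxx vj orbT.
by have -> : v = Ordinal jn by apply: val_inj.
Qed.

Definition setscr := [:: 25; 26; 27; 28; 29].

Lemma base_ext s s' : base s -> (forall i, s' 0 i = s 0 i) -> (forall i, s' 21 i = s 21 i) -> base s'.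
Proof. by move=> [h1 h2] a0 a1; split=> [i|j]; rewrite ?a0 ?a1. Qed.

Lemma AnyViol_spec env s : base s ->
  (rrun env AnyViol s 34 0 != 0) = (vio s != set0).
Proof.
move=> bs; rewrite /AnyViol rSeq; set s0 := rrun env (RSet 34 _ _) s.
pose P (s2 : store) := (forall a i, a \notin 34 :: setscr -> s2 a i = s a i) /\ (s2 34 0 != 0 -> vio s != set0).
pose Q t (v : 'I_n) (s2 : store) := compset t v \in vio s -> s2 34 0 != 0.
have J2 (s2 : store) : P s2 -> base s2 /\ vio s2 = vio s.
  move=> [ag _]; split; first by apply: (base_ext bs) => i; rewrite ag.
  by rewrite /vio; congr (viol _ _ _ _ _); apply/setP=> j; rewrite !inE ag.
have [|||P' Q'] := @AllSets_ind env (RIf (XG0 29) (RSet 34 (XN 0) (XN 1)) RSkip) s0 P Q.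
- by move=> s2 /J2[[]].
- split=> [a i|]; last by rewrite /s0 rSet /update /=.
  by rewrite inE negb_or => /andP[h _]; rewrite /s0 rSet update_diff.
- move=> t v s2 tT P2; have [b2 v2] := J2 s2 P2; have [ag2 nv2] := P2; rewrite rSeq.
  have [_ [vf fr]] := @CompS_spec (upd (upd env 1 t) 2 v) s2 t v b2 erefl erefl.
  rewrite rIf tvG -[ev _ _ (XN 0)]/0 vf v2; case: ifP => vi.
    rewrite rSet; split=> //.
    split; last by move=> _; apply/set0Pn; exists (compset t v).
    move=> a i h; have := h; rewrite inE negb_or => /andP[h1 h2].
    by rewrite update_diff // fr // ag2.
  change (rrun (upd (upd env 1 t) 2 v) RSkip (rrun (upd (upd env 1 t) 2 v) CompS s2)) with (rrun (upd (upd env 1 t) 2 v) CompS s2); split.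
  + split=> [a i h|]; last by rewrite fr.
    by have := h; rewrite inE negb_or => /andP[h1 h2]; rewrite fr // ag2.
  + by rewrite /Q vi.
  + by move=> t' v' q /q; rewrite fr.
apply/idP/idP; first exact: P'.2.
case/set0Pn=> S SF; have [S0 _ _ _ _] := violP _ _ _ _ _ _ SF; have [v vS] := set0Pn _ S0.
by have [t tT cE] := compset_viol SF vS; apply: (Q' t v tT); rewrite /Q cE.
Qed.

Local Notation vl := (viol (ends I) k Hs (safe I)).

Lemma in_Js s j : (j \in Js s) = (s 22 j != 0).
Proof. by rewrite inE. Qed.

Lemma base_agree (ex : seq nat) s s2 : base s -> [&& 0 \notin ex, 21 \notin ex & 22 \notin ex] ->
  (forall a i, a \notin ex -> s2 a i = s a i) -> base s2 /\ vio s2 = vio s.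
Proof.
move=> bs /and3P[h0 h1 h2] ag; split; first by apply: (base_ext bs) => i; rewrite ag.
by rewrite /vio; congr (viol _ _ _ _ _); apply/setP=> j; rewrite !in_Js ag.
Qed.

Lemma XSize_ev env (s : store) x (S : {set 'I_n}) : s 0 0 = n ->
  (forall u : 'I_n, (s 27 u != 0) = (u \in S)) -> ev env s (XSize x) = #|S|.
Proof.
move=> h0 h; rewrite /XSize (@evSE _ _ _ _ _ n) // -sum1_card [RHS]big_mkcond.
by apply: eq_bigr => u _; rewrite evB tvG /= /upd eqxx h; case: (u \in S).
Qed.

(** The value [n.+1] marks vertices that lie in no member. *)
Definition min_sizes (Fam : {set {set 'I_n}}) (sz : nat -> nat) := forall v : 'I_n,
  (forall S : {set 'I_n}, S \in Fam -> v \in S -> sz v <= #|S|) /\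
  (sz v = n.+1 \/ exists S : {set 'I_n}, [/\ S \in Fam, v \in S & #|S| = sz v]).

(** By [mins_side] a minimal member is contained in every member it meets, so its size is least at
    all its vertices. Conversely, a smaller member inside would lower the value at its own
    vertices. *)
Lemma mins_size (Fam : {set {set 'I_n}}) sz S : uncrossable Fam -> min_sizes Fam sz ->
  S \in Fam -> (S \in mins Fam) = [forall u in S, #|S| <= sz (val u)].
Proof.
move=> unc h SF; apply/idP/forall_inP => [Sm u uS|h2].
  have [_ [->|[T [TF uT <-]]]] := h u.
    by apply: leqW; rewrite -[X in _ <= X]card_ord max_card.
  case: (mins_side unc Sm TF) => [|/subsetP/(_ u uS)]; first exact: subset_leq_card.
  by rewrite inE uT.
apply/minsP; split=> // T TF TS; apply/eqP; rewrite eqEcard TS /=.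
have [F0 _ _] := unc; have [T0|[u uT]] := set_0Vmem T; first by rewrite -T0 TF in F0.
by apply: leq_trans (h2 u (subsetP TS u uT)) _; apply: (h u).1.
Qed.

Lemma Pass1_spec env (s : store) : base s ->
  let s' := rrun env Pass1 s in
  (forall a i, a \notin 30 :: setscr -> s' a i = s a i) /\ min_sizes (vio s) (s' 30).
Proof.
move=> bs; rewrite /Pass1 rSeq; set s0 := rrun env (RPar _ _ _ _) s; set c := RIf _ _ _.
pose P (s2 : store) := (forall a i, a \notin 30 :: setscr -> s2 a i = s a i) /\
  forall v : 'I_n, s2 30 v = n.+1 \/ exists S : {set 'I_n}, [/\ S \in vio s, v \in S & #|S| = s2 30 v].
pose Q t (v : 'I_n) (s2 : store) := compset t v \in vio s -> s2 30 v <= #|compset t v|.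
have J2 (s2 : store) : P s2 -> base s2 /\ vio s2 = vio s.
  by move=> [ag _]; apply: base_agree ag.
have [|||P' Q'] := @AllSets_ind env c s0 P Q.
- by move=> s2 /J2[[]].
- split=> [a i|v]; first by rewrite inE negb_or => /andP[h _]; rewrite /s0 rframe.
  have bn : bval BV s = n by rewrite /bval /= bs.1.
  by left; rewrite /s0 rPar_in ?bn // -[LHS]/(1 * bval BV s + 1) bn mul1n addn1.
- move=> t v s2 tT P2; have [b2 v2] := J2 s2 P2; have [ag2 sz2] := P2; rewrite rSeq.
  set env' := upd (upd env 1 t) 2 v.
  have [cs [vf fr]] := @CompS_spec env' s2 t v b2 erefl erefl.
  set s3 := rrun env' CompS s2 in cs vf fr *.
  have n3 : s3 0 0 = n by rewrite fr // b2.1.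
  have E : ev env' s3 (XSize 7) = #|compset t v| := XSize_ev env' 7 n3 cs.
  have E2 : ev env' s3 (XG 30 (XV 2)) = s2 30 v by rewrite -[LHS]/(s3 30 v) fr.
  have vC : v \in compset t v by rewrite inE connect0.
  rewrite /c rIf tvAnd tvG -[ev _ _ (XN 0)]/0 vf v2 tvLt E E2; case: ifP => [/andP[vi lt]|/negbT nv].
    rewrite rSet E -[ev _ _ (XV 2)]/(val v); split.
    + split=> [a i h|u].
        by have := h; rewrite inE negb_or => /andP[h1 h2]; rewrite update_diff // fr // ag2.
      rewrite /update eqxx /=; case: eqP => [uv|_]; last by rewrite !fr //; apply: sz2.
      by right; exists (compset t v); split=> //; have -> : u = v by apply: val_inj.
    + by move=> _; rewrite update_same.
    + move=> t' v' q vi'; have := q vi'; rewrite /update eqxx /=; case: eqP => [vv|_]; last by rewrite fr.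
      have -> : v' = v by apply: val_inj.
      by apply: leq_trans; apply: ltnW.
  rewrite -[rrun _ RSkip _]/s3; split.
  + split=> [a i h|u]; last by rewrite !fr //; apply: sz2.
    by have := h; rewrite inE negb_or => /andP[h1 h2]; rewrite fr // ag2.
  + by move=> vi; move: nv; rewrite vi /= -leqNgt fr.
  + by move=> t' v' q /q; rewrite fr.
split; first exact: P'.1.
move=> v; split; last exact: P'.2.
move=> S SF vS; have [t tT cE] := compset_viol SF vS.
by have := Q' t v tT; rewrite /Q cE; apply.
Qed.

Lemma Pass2_spec env (s : store) : base s -> min_sizes (vio s) (s 30) ->
  let s' := rrun env Pass2 s in
  (forall a i, a \notin 31 :: setscr -> s' a i = s a i) /\
  (forall v : 'I_n, s' 31 v != 0 <-> exists2 C, C \in mins (vio s) & v \in C) /\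
  (forall C (u v : 'I_n), C \in mins (vio s) -> u \in C -> s' 31 u = s' 31 v <-> v \in C).
Proof.
move=> bs hz; rewrite /Pass2 rSeq; set s0 := rrun env (RPar _ _ _ _) s; set c := RIf _ _ _.
have unc : uncrossable (vio s) by apply: viol_uncrossable.
(* [lead C v] singles out the least vertex of [C], whose visit labels [C]. *)
pose lead (C : {set 'I_n}) (v : 'I_n) := [/\ C \in mins (vio s), v \in C & forall w : 'I_n, w \in C -> v <= w].
pose P (s2 : store) := (forall a i, a \notin 31 :: setscr -> s2 a i = s a i) /\
  forall u : 'I_n, s2 31 u != 0 -> exists C v, [/\ lead C v, u \in C & s2 31 u = v.+1].
pose Q t (v : 'I_n) (s2 : store) := lead (compset t v) v ->
  forall u : 'I_n, u \in compset t v -> s2 31 u != 0.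
have J2 (s2 : store) : P s2 -> base s2 /\ vio s2 = vio s.
  by move=> [ag _]; apply: base_agree ag.
have [|||P' Q'] := @AllSets_ind env c s0 P Q.
- by move=> s2 /J2[[]].
- split=> [a i|v]; first by rewrite inE negb_or => /andP[h _]; rewrite /s0 rframe.
  by rewrite /s0 rPar_in // /bval /= bs.1.
- move=> t v s2 tT P2; have [b2 v2] := J2 s2 P2; have [ag2 mid2] := P2; rewrite rSeq.
  set env' := upd (upd env 1 t) 2 v.
  have [cs [vf fr]] := @CompS_spec env' s2 t v b2 erefl erefl.
  set s3 := rrun env' CompS s2 in cs vf fr *.
  have n3 : s3 0 0 = n by rewrite fr // b2.1.
  have n3' : bval BV s3 = n by [].
  set C := compset t v in cs vf.
  have z3 (u : 'I_n) : s3 30 u = s 30 u by rewrite fr // ag2.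
  have tE : tv env' s3 XMinTest =
      (C \in vio s) && ([forall u in C, #|C| <= s 30 (val u)] && [forall u in C, v <= val u]).
    rewrite /XMinTest tvAnd tvG -[ev _ _ (XN 0)]/0 vf v2 tvAnd !tvNot !(@tvAnyE _ _ _ _ _ n n3').
    congr (_ && (_ && _)); rewrite negb_exists; apply: eq_forallb => u.
      rewrite tvAnd tvG tvLt (XSize_ev _ 8 n3 cs) -[ev _ _ (XV 7)]/(val u) cs.
      by rewrite -[ev _ _ (XG 30 (XV 7))]/(s3 30 u) z3 negb_and -implybE -leqNgt.
    rewrite tvAnd tvG tvLt -[ev _ _ (XV 7)]/(val u) cs -[ev _ _ (XV 2)]/(val v).
    by rewrite negb_and -implybE -leqNgt.
  rewrite /c rIf tE; case: ifP => [/and3P[Cv Cs lv]|nt].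
    have Cl : lead C v.
      split; [by rewrite (mins_size unc hz) | by rewrite inE connect0 | by move=> w /(forall_inP lv)].
    set s4 := rrun _ _ s3.
    have s4E (u : 'I_n) : s4 31 u = if u \in C then v.+1 else s2 31 u.
      rewrite /s4 rPar_in ?n3' // evIf tvG -[ev _ _ (XV 5)]/(val u) cs; case: ifP => _.
        by rewrite -[LHS]/(val v + 1) addn1.
      by rewrite -[LHS]/(s3 31 u) fr.
    split.
    + split=> [a i h|u].
        by have := h; rewrite inE negb_or => /andP[h1 h2]; rewrite /s4 rframe // fr // ag2.
      by rewrite s4E; case: ifP => [uC _|_]; [exists C, v | apply: mid2].
    + by move=> _ u uC; rewrite s4E uC.
    + by move=> t' v' q l u uC; rewrite s4E; case: ifP => // _; apply: q l u uC.
  rewrite -[rrun _ RSkip _]/s3; split.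
  + split=> [a i h|u]; last by rewrite !fr //; apply: mid2.
    by have := h; rewrite inE negb_or => /andP[h1 h2]; rewrite fr // ag2.
  + move=> [Cm vC lv]; have [CF _] := minsP _ _ Cm.
    move: nt; rewrite CF -(mins_size unc hz CF) Cm /= => /negP[].
    by apply/forall_inP.
  + by move=> t' v' q l u uC; rewrite fr //; apply: q l u uC.
set s' := rrun env (AllSets c) s0 in P' Q' *; have [P1 P2] := P'.
have hasl (C : {set 'I_n}) : C \in mins (vio s) -> exists v, lead C v.
  move=> Cm; have [CF _] := minsP _ _ Cm; have [C0 _ _ _ _] := violP _ _ _ _ _ _ CF.
  have [u uC] := set0Pn _ C0.
  by case: (arg_minnP (fun v : 'I_n => val v) uC) => v vC vm; exists v.
have nz (C : {set 'I_n}) (u : 'I_n) : C \in mins (vio s) -> u \in C -> s' 31 u != 0.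
  move=> Cm uC; have [v l] := hasl C Cm; have [_ vC _] := l; have [CF _] := minsP _ _ Cm.
  by have [t tT tE] := compset_viol CF vC; apply: (Q' t v tT); rewrite tE.
split=> //; split.
  by move=> v; split=> [/P2[C [w [[Cm _ _] vC _]]]|[C Cm vC]]; [exists C | apply: nz vC].
move=> C u v Cm uC; have [D [w [[Dm wD wl] uD uE]]] := P2 u (nz C u Cm uC).
have DC : D = C := mins_disjoint unc Dm Cm uD uC.
rewrite uE; split=> [vE|vC].
  have vnz : s' 31 v != 0 by rewrite -vE.
  have [D' [w' [[Dm' wD' _] vD' vE']]] := P2 v vnz.
  have ww : w = w' by apply: val_inj; move: vE; rewrite vE' => -[].
  by rewrite -DC (mins_disjoint unc Dm Dm' wD) // ww.
have [D' [w' [[Dm' wD' wl'] vD' vE']]] := P2 v (nz C v Cm vC).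
have DC' : D' = C := mins_disjoint unc Dm' Cm vD' vC.
by rewrite vE'; apply/eqP; rewrite eqSS eqn_leq wl ?wl' // ?DC ?DC' -?DC // DC -DC'.
Qed.

Lemma MinSets_spec env (s : store) : base s -> let s' := rrun env MinSets s in
  (forall a i, a \notin [:: 30, 31 & setscr] -> s' a i = s a i) /\
  forall (env' : nat -> nat) (s2 : store) x (j : 'I_m), (forall i, s2 0 i = inp I i) ->
    (forall i, s2 31 i = s' 31 i) -> ev env' s2 x = j ->
    ev env' s2 (XDeg x) = mdeg (ends I) (vio s) j.
Proof.
move=> bs; rewrite /MinSets rSeq; have [ag1 sz] := Pass1_spec env bs.
set s1 := rrun env Pass1 s in ag1 sz *.
have [b1 v1] : base s1 /\ vio s1 = vio s by apply: base_agree ag1.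
rewrite -v1 in sz; have [ag2 [m1 m2]] := Pass2_spec env b1 sz.
set s' := rrun env Pass2 s1 in ag2 m1 m2 *; split.
  move=> a i; rewrite !inE !negb_or => /andP[h30 /andP[h31 h]].
  by rewrite ag2 ?ag1 // !inE !negb_or ?h30 ?h31.
move=> env' s2 x j z2 h31 hx; have [e1 e2 _] := inU z2 hx.
have unc : uncrossable (vio s1) by apply: viol_uncrossable.
rewrite -v1 (@mdegE _ _ (ends I) _ (fun v : 'I_n => s' 31 v) j unc (fun v => iffP idP (m1 v).1 (m1 v).2) m2).
have E1 : ev env' s2 (XG 31 (XU x)) = s' 31 (ends I j).1 by rewrite -h31 -e1.
have E2 : ev env' s2 (XG 31 (XW x)) = s' 31 (ends I j).2 by rewrite -h31 -e2.
rewrite /XDeg evIf tvEq E1 E2; case: ifP => // _.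
by rewrite -[LHS]/(ev env' s2 (XB (XG 31 (XU x))) + ev env' s2 (XB (XG 31 (XW x)))) !evB /tv E1 E2.
Qed.

Definition iterscr := [:: 22; 23; 24; 25; 26; 27; 28; 29; 30; 31; 32; 33].

(** The equation for reduced costs is exact because [rho] is least among the candidates, so no
    subtraction is truncated. If nothing can be picked, no edge outside [H] and [J] crosses a
    minimal set. *)
Lemma Iter_spec (env : nat -> nat) (s : store) i : base s -> env 0 = i ->
  let s' := rrun env Iter s in
  (forall a l, a \notin iterscr -> s' a l = s a l) /\ (forall l, l != i -> s' 23 l = s 23 l) /\
  ((s' 23 i = 0 /\ Js s' = Js s /\ (forall j : 'I_m, s' 24 j = s 24 j) /\
      forall j, j \notin Hs -> j \notin Js s -> mdeg (ends I) (vio s) j = 0) \/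
   exists (e0 : 'I_m) rho, [/\ s' 23 i = e0.+1, e0 \notin Hs,
     e0 \notin Js s /\ mdeg (ends I) (vio s) e0 != 0, Js s' = e0 |: Js s &
     s' 24 e0 = 0 /\ forall e : 'I_m, e \notin Hs -> e \notin Js s ->
       s' 24 e + rho * mdeg (ends I) (vio s) e = 2 * s 24 e]).
Proof.
move=> bs iE s'; pose s1 := rrun env MinSets s; pose s2 := rrun env Pick s1.
have s'E : s' = rrun env (RIf (XG0 33) Grow (RSet 23 (XV 0) (XN 0))) s2 by [].
have [ag1 dg1] := MinSets_spec env bs; rewrite -/s1 in ag1 dg1.
have ag2 a l : a != 33 -> s2 a l = s1 a l.
  by move=> h; rewrite /s2 rframe //; notwritten h.
have sub : {subset [:: 30, 31 & setscr] <= iterscr} by apply/allP.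
have agS a l : a \notin iterscr -> s2 a l = s a l.
  move=> h; rewrite ag2 ?ag1 //; first exact: (contra (sub a) h).
  by apply: contraNneq h => ->.
pose d := mdeg (ends I) (vio s).
pose cand (j : 'I_m) := [&& j \notin Hs, j \notin Js s & d j != 0].
pose rho (j : 'I_m) := if d j == 1 then 2 * s 24 j else s 24 j.
have cE (env' : nat -> nat) (s3 : store) x (j : 'I_m) : (forall a l, a != 33 -> s3 a l = s1 a l) ->
    ev env' s3 x = j -> [/\ ev env' s3 (XDeg x) = d j, tv env' s3 (XCand x) = cand j & ev env' s3 (XRho x) = rho j].
  move=> ag hx.
  have dE : ev env' s3 (XDeg x) = d j by apply: dg1 => // l; rewrite ag // ag1 // bs.1.
  split=> //.
    by rewrite /XCand tvAnd tvNot tvG tvAnd tvNot tvG hx /tv dE !ag // !ag1 // bs.2 -in_Js.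
  have g : ev env' s3 (XG 24 x) = s 24 j by rewrite -[LHS]/(s3 24 (ev env' s3 x)) hx ag // ag1.
  rewrite /XRho evIf tvEq dE -[ev _ _ (XN 1)]/(1) /rho; case: ifP => _; last exact: g.
  by rewrite -[LHS]/(ev env' s3 (XG 24 x) + ev env' s3 (XG 24 x)) g mul2n addnn.
pose best j := cand j && [forall h, cand h ==> (rho j <= rho h)].
have FS : find_result best (s2 33 0).
  apply: Find_spec => //; first by rewrite /bval /= ag1 // bs.1.
  move=> s3 j ag; have [_ c1 r1] := cE (upd env 3 j) s3 (XV 3) j ag erefl.
  have m3 : bval BE s3 = m by rewrite /bval /= ag // ag1 // bs.1.
  rewrite /XBest tvAnd tvNot c1 (@tvAnyE _ _ _ _ _ m m3).
  congr (_ && _); rewrite negb_exists; apply: eq_forallb => h.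
  have [_ c2 r2] := cE (upd (upd env 3 j) 7 h) s3 (XV 7) h ag erefl.
  have [_ _ r3] := cE (upd (upd env 3 j) 7 h) s3 (XV 3) j ag erefl.
  by rewrite tvAnd tvLt c2 r2 r3 negb_and -implybE -leqNgt.
have {FS} [[e0 be E0]|[E0 no]] : (exists2 e0, best e0 & s2 33 0 = e0.+1) \/ (s2 33 0 = 0 /\ forall j, ~~ best j).
  by case: FS => [j bj|nb]; [left; exists j | right].
  pose r := rho e0; pose s3 := update s2 32 0 r.
  pose s4 := rrun env (RPar 8 24 BE (XSub (XAdd (XG 24 (XV 8)) (XG 24 (XV 8))) XDrop)) s3.
  have x0 (env' : nat -> nat) (s5 : store) : s5 33 0 = e0.+1 -> ev env' s5 XE0 = e0.
    by move=> h; rewrite -[LHS]/(s5 33 0 - 1) h subn1.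
  have s3f a l : a != 32 -> s3 a l = s2 a l by move=> h; rewrite /s3 update_diff.
  have s4f a l : a != 24 -> s4 a l = s3 a l by move=> h; rewrite /s4 rframe.
  have [_ _ rE] := cE env s2 XE0 e0 ag2 (x0 env s2 E0).
  have s'E2 : s' = update (update s4 22 e0 1) 23 i e0.+1.
    have g3 : rrun env (RSet 32 (XN 0) (XRho XE0)) s2 = s3 by rewrite rSet rE.
    have g5 : rrun env (RSet 22 XE0 (XN 1)) s4 = update s4 22 e0 1.
      by rewrite rSet x0 // s4f // s3f.
    have g6 : rrun env (RSet 23 (XV 0) (XG0 33)) (update s4 22 e0 1) = update (update s4 22 e0 1) 23 i e0.+1.
      rewrite rSet -[ev _ _ (XG0 33)]/(update s4 22 e0 1 33 0) update_diff // s4f // s3f // E0.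
      by rewrite -[ev _ _ (XV 0)]/(env 0) iE.
    rewrite s'E rIf tvG -[ev _ _ (XN 0)]/0 E0 -[LHS]/(rrun env Grow s2) /Grow rSeq.
    by rewrite [rrun env (RSeq (RSet 32 _ _) _) s2]rSeq g3 -/s4 rSeq g5.
  have dE (j : 'I_m) : ev (upd env 8 j) s3 (XDeg (XV 8)) = d j.
    apply: dg1 => // l; first by rewrite s3f // ag2 // ag1 // bs.1.
    by rewrite s3f // ag2.
  have m3 : bval BE s3 = m by rewrite /bval /= s3f // ag2 // ag1 // bs.1.
  have v24 (j : 'I_m) : s4 24 j = (s 24 j + s 24 j) -
      (if d j != 0 then (if d j == 1 then r else r + r) else 0).
    have g1 : ev (upd env 8 j) s3 (XG0 32) = r by [].
    have g2 : ev (upd env 8 j) s3 (XAdd (XG0 32) (XG0 32)) = r + r by [].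
    have yE : ev (upd env 8 j) s3 XDrop = if d j != 0 then (if d j == 1 then r else r + r) else 0.
      by rewrite /XDrop evIf /tv dE evIf tvEq dE -[ev _ _ (XN 1)]/(1) g1 g2.
    rewrite /s4 rPar_in ?m3 // -[LHS]/(s3 24 j + s3 24 j - ev (upd env 8 j) s3 XDrop) yE.
    by rewrite s3f // ag2 // ag1.
  have [ce /forallP bmin] := andP be; have /and3P[eH eJ de] := ce.
  have s'24 (j : 'I_m) : s' 24 j = s4 24 j by rewrite s'E2 !update_diff.
  split; [|split; [|right; exists e0, r; split=> //]].
  - move=> a l h; have hn b : b \in iterscr -> a != b by move=> hb; apply: contraNneq h => ->.
    by rewrite s'E2 !update_diff ?hn // s4f ?hn // s3f ?hn // agS.
  - move=> l li; rewrite s'E2 {1}/update eqxx (negPf li) /= update_diff // s4f // s3f // ag2 // ag1 //.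
  - by rewrite s'E2 update_same.
  - apply/setP=> j; rewrite in_Js s'E2 update_diff // in_setU1 in_Js /update eqxx /= -val_eqE /=.
    case: (nat_of_ord j == e0) => //=; by rewrite s4f // s3f // ag2 // ag1.
  - have unc : uncrossable (vio s) by apply: viol_uncrossable.
    have le2 e : d e <= 2 by apply: mdeg_le2.
    split.
      rewrite s'24 v24 /r /rho; move: (le2 e0) de; case: (d e0) => [|[|[|?]]] //= _ _; clear; lia.
    move=> e nH nJ; have := bmin e; rewrite /cand nH nJ /= -/r s'24 v24 -/(d e) /rho.
    move: (le2 e); case: (d e) => [|[|[|?]]] //= _; clear; lia.
have s'E2 : s' = update s2 23 i 0.
  by rewrite s'E rIf tvG -[ev _ _ (XN 0)]/0 E0 -iE.
split; [|split; [|left; split; [|split; [|split]]]].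
- move=> a l h; have hn b : b \in iterscr -> a != b by move=> hb; apply: contraNneq h => ->.
  by rewrite s'E2 update_diff ?hn // agS.
- by move=> l li; rewrite s'E2 /update eqxx (negPf li) /= ag2 // ag1.
- by rewrite s'E2 update_same.
- by apply/setP=> j; rewrite !in_Js s'E2 update_diff // ag2 // ag1.
- by move=> j; rewrite s'E2 update_diff // ag2 // ag1.
- move=> j jH jJ; apply/eqP; apply: contraT => dj; have cj : cand j by rewrite /cand jH jJ.
  case: (arg_minnP rho cj) => h ch hm; case/negP: (no h); rewrite /best ch /=.
  by apply/forallP=> l; apply/implyP; apply: hm.
Qed.

Definition Jp (sq : nat -> nat) i := [set j : 'I_m | has (fun q => sq q == j.+1) (iota 0 i)].

Lemma in_JpS sq i (j : 'I_m) : (j \in Jp sq i.+1) = (j \in Jp sq i) || (sq i == j.+1).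
Proof.
have iE : iota 0 i.+1 = iota 0 i ++ [:: i] by rewrite -addn1 iotaD.
by rewrite !inE iE has_cat /= orbF.
Qed.

Lemma Jp_ext sq sq' i : (forall q, q < i -> sq q = sq' q) -> Jp sq i = Jp sq' i.
Proof.
move=> h; apply/setP=> j; rewrite !inE; apply: eq_in_has => q.
by rewrite mem_iota => /andP[_ qi]; rewrite h.
Qed.

Lemma Jp_mono sq i j : i <= j -> Jp sq i \subset Jp sq j.
Proof.
move=> ij; apply/subsetP=> e; rewrite !inE => /hasP[q]; rewrite mem_iota => /andP[_ qi] h.
by apply/hasP; exists q => //; rewrite mem_iota /= (leq_trans qi).
Qed.

Lemma viol_sub (J J' : {set 'I_m}) : J \subset J' -> vl J' \subset vl J.
Proof.
move=> s; apply/subsetP=> S /violP[h1 h2 h3 h4 h5]; apply/violP; split=> //.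
apply/eqP; rewrite -subset0 -h5; apply/subsetP=> e; rewrite !in_cut => /andP[eJ ->].
by rewrite (subsetP s).
Qed.

(** The cost bound is conditional on a cover [J'] that stays witnessed at every stage; the deletion
    phase will supply one. *)
Lemma Forward_spec env (s : store) (c0 : 'I_m -> nat) (O : {set 'I_m}) : base s -> feasible k 1 I O ->
  (forall j : 'I_m, s 14 j = c0 j) ->
  let s' := rrun env Forward s in let sq := s' 23 in
  [/\ base s', Js s' = Jp sq m, vio s' = set0,
      (forall j, j \in Js s' -> j \notin Hs) /\
      (forall q, q < m -> sq q = 0 \/ exists2 e : 'I_m, sq q = e.+1 & e \notin Jp sq q) &
      forall J' : {set 'I_m}, J' \subset Js s' -> covers (ends I) J' (vl set0) ->
        (forall j, j < m -> witnessed (ends I) (J' :\: Jp sq j) (vl (Jp sq j))) ->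
        \sum_(e in J') c0 e <= 2 * \sum_(e in O :\: Hs) c0 e].
Proof.
move=> bs fO cs s' sq.
pose s1 := rrun env (RSeq (RPar 8 22 BE (XN 0)) (RPar 8 24 BE (XG 14 (XV 8)))) s.
have bm : bval BE s = m by rewrite /bval /= bs.1.
have f1 a l : a \notin [:: 22; 24] -> s1 a l = s a l.
  by move=> h; rewrite /s1 rframe //; notwritten h.
have b1 : base s1 by apply: (base_ext bs) => l; rewrite f1.
have J1 : Js s1 = set0.
  by apply/setP=> j; rewrite in_Js in_set0 /s1 rSeq rframe // rPar_in ?bm.
have c1 (j : 'I_m) : s1 24 j = c0 j.
  have bm2 : bval BE (rrun env (RPar 8 22 BE (XN 0)) s) = m.
    by rewrite -bm; apply: bval0 => l; rewrite rframe.
  rewrite /s1 rSeq rPar_in ?bm2 // -[LHS]/(rrun env (RPar 8 22 BE (XN 0)) s 14 j) rframe //.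
pose Oh := O :\: Hs.
(* The cost clause goes backwards: a bound for the current reduced costs implies the one for the
   original costs, so each round composes it with one [local_ratio_step]. As a round adds an edge
   while something is violated, [m] rounds suffice. *)
pose Inv i (s2 : store) := [/\ base s2, Js s2 = Jp (s2 23) i, (i <= #|Js s2|) || (vio s2 == set0),
  (forall j, j \in Js s2 -> j \notin Hs) /\
  (forall q, q < i -> s2 23 q = 0 \/ exists2 e : 'I_m, s2 23 q = e.+1 & e \notin Jp (s2 23) q) &
  forall J' : {set 'I_m}, (forall j, j \in J' -> j \notin Hs) -> covers (ends I) J' (vl set0) ->
    (forall j, j < i -> witnessed (ends I) (J' :\: Jp (s2 23) j) (vl (Jp (s2 23) j))) ->
    \sum_(e in J' :\: Js s2) s2 24 e <= 2 * \sum_(e in Oh :\: Js s2) s2 24 e ->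
    \sum_(e in J') c0 e <= 2 * \sum_(e in Oh) c0 e].
suff [i1 i2 i3 i4 i5] : Inv m s'.
  split=> //.
    case/orP: i3 => [full|/eqP //].
    have JT : Js s' = setT by apply/eqP; rewrite eqEcard subsetT cardsT card_ord.
    apply/eqP; apply: contraT => /set0Pn[S SF].
    have := @feasible_covers k I Hs O (Js s') fO S SF.
    by case/set0Pn=> e; rewrite in_cut in_setD JT in_setT.
  move=> J' sub cov wit; apply: i5 => //; first by move=> j /(subsetP sub)/i4.1.
  have -> : J' :\: Js s' = set0 by apply/eqP; rewrite setD_eq0.
  by rewrite big_set0.
have bs1 : bval BE s1 = m by rewrite /bval /= b1.1.
rewrite /s' /Forward rSeq -/s1 -{1}bs1; apply: rep_ind.
  split=> //.
  - by split=> // j; rewrite J1 inE.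
  - have E (A : {set 'I_m}) : \sum_(e in A) s1 24 e = \sum_(e in A) c0 e.
      by apply: eq_bigr => e _; apply: c1.
    by move=> J' _ _ _; rewrite J1 !setD0 !E.
rewrite bs1 => i s2 im [b2 j2 n2 [d2 q2] p2].
have [ag [s23 alt]] := @Iter_spec (upd env 0 i) s2 i b2 erefl.
set s3 := rrun _ Iter s2 in ag s23 alt *.
have b3 : base s3 by apply: (base_ext b2) => l; rewrite ag.
have pre q : q < i -> s3 23 q = s2 23 q by move=> qi; apply: s23; rewrite neq_ltn qi.
have preJ q : q <= i -> Jp (s3 23) q = Jp (s2 23) q.
  by move=> qi; apply: Jp_ext => l lq; apply: pre; apply: leq_trans lq qi.
have covO : covers (ends I) (Oh :\: Js s2) (vio s2) := @feasible_covers k I Hs O (Js s2) fO.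
have unc : uncrossable (vio s2) by apply: viol_uncrossable.
have q3 q : q < i -> s3 23 q = 0 \/ exists2 e : 'I_m, s3 23 q = e.+1 & e \notin Jp (s3 23) q.
  by move=> qi; rewrite pre // preJ ?(ltnW qi) //; apply: q2.
case: alt => [[z [JE [cE nod]]]|[e0 [rho [zE eH [eJ d0] JE [c0E cE]]]]].
  have v0 : vio s2 = set0.
    apply/eqP; apply: contraT => /set0Pn[S SF]; have [C Cm _] := mins_below SF; have [CF _] := minsP _ _ Cm.
    have [e] := set0Pn _ (covO C CF); rewrite in_cut !in_setD => /andP[/and3P[eJ eH _] ec].
    have /eqP := nod e eH eJ; rewrite /mdeg cards_eq0 => /eqP/setP/(_ C).
    by rewrite in_set Cm ec in_set0.
  have JE3 : Jp (s3 23) i.+1 = Jp (s3 23) i by apply/setP=> j; rewrite in_JpS z /= orbF.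
  split=> //.
  - by rewrite JE j2 JE3 preJ.
  - by rewrite /vio JE -/(vio s2) v0 eqxx orbT.
  - rewrite JE; split=> // q; rewrite ltnS leq_eqVlt => /orP[/eqP->|]; [by left | exact: q3].
  - move=> J' dJ cov wit le; apply: (p2 J') => //.
      by move=> j ji; rewrite -preJ ?(ltnW ji) //; apply: wit; apply: leqW.
    have E (A : {set 'I_m}) : \sum_(e in A) s3 24 e = \sum_(e in A) s2 24 e.
      by apply: eq_bigr => e _; apply: cE.
    by move: le; rewrite JE !E.
have JE3 : Jp (s3 23) i.+1 = e0 |: Js s2.
  apply/setP=> j; rewrite in_JpS zE preJ // -j2 in_setU1 orbC; congr (_ || _).
  by rewrite eqSS eq_sym -[RHS]val_eqE.
split=> //.
- by rewrite JE JE3.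
- apply/orP; left; rewrite JE cardsU1 eJ /= add1n ltnS; case/orP: n2 => // /eqP v0.
  move: d0; rewrite /mdeg cards_eq0 => /set0Pn[C]; rewrite in_set => /andP[/minsP[]].
  by rewrite v0 in_set0.
- rewrite JE; split=> [j|q]; first by rewrite in_setU1 => /orP[/eqP->|/d2].
  rewrite ltnS leq_eqVlt => /orP[/eqP->|]; last exact: q3.
  by right; exists e0 => //; rewrite preJ // -j2.
- move=> J' dJ cov wit le; apply: (p2 J') => //.
    by move=> j ji; rewrite -preJ ?(ltnW ji) //; apply: wit; apply: leqW.
  have wi := wit i (ltnSn i); rewrite preJ // -j2 in wi.
  apply: (local_ratio_step (c := fun e : 'I_m => s2 24 e) (c' := fun e : 'I_m => s3 24 e)
            (rho := rho) unc JE c0E _ _ wi covO le).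
    move=> e; rewrite in_setD in_setU => /andP[eJ' eo]; apply: cE => //.
    by case/orP: eo => [/dJ //|]; rewrite in_setD => /andP[].
  move=> S SF; have S0 : S \in vl set0 := subsetP (viol_sub (sub0set _)) S SF.
  have [e] := set0Pn _ (cov S S0); rewrite in_cut => /andP[eJ' ec].
  apply/set0Pn; exists e; rewrite in_cut in_setD eJ' ec !andbT.
  have [_ _ _ _ cz] := violP _ _ _ _ _ _ SF; apply/negP=> eb.
  by have : e \in set0 by [rewrite -cz in_cut eb ec]; rewrite inE.
Qed.

(** An edge kept by its test is the only one left to cover some set violated before it was chosen.
    Later deletions remove other edges only, so this persists to the end. *)
Lemma Shrink_spec env (s : store) : base s -> let sq := s 23 in Js s = Jp sq m -> vio s = set0 ->
  (forall q, q < m -> sq q = 0 \/ exists2 e : 'I_m, sq q = e.+1 & e \notin Jp sq q) ->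
  let s' := rrun env (RRep 0 BE Shrink) s in
  [/\ base s', Js s' \subset Js s, vio s' = set0 &
      forall j, j < m -> witnessed (ends I) (Js s' :\: Jp sq j) (vl (Jp sq j))].
Proof.
move=> bs sq jE v0 fresh s'; have bm : bval BE s = m by rewrite /bval /= bs.1.
(* After [r] tests the choices of the first [m - r] rounds are intact, and each surviving later
   choice carries its witness. *)
pose Inv r (s2 : store) := [/\ (forall a l, a \notin [:: 22, 34 & setscr] -> s2 a l = s a l),
  Js s2 \subset Js s, vio s2 = set0, Jp sq (m - r) \subset Js s2 &
  forall e, e \in Js s2 -> e \notin Jp sq (m - r) -> exists j S, [/\ sq j = e.+1, S \in vl (Jp sq j) &
    cut (ends I) (Js s2) S = [set e]]].
suff [i1 i2 i3 _ i5] : Inv m s'.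
  split=> //; first by apply: (base_ext bs) => l; rewrite i1.
  move=> j jm e; rewrite in_setD => /andP[ej eJ].
  have e0 : e \notin Jp sq (m - m) by rewrite subnn inE.
  have [l [S [le SF cS]]] := i5 e eJ e0.
  (* A set violated at stage [l] is also violated at any earlier stage [j]. *)
  have jl : j <= l.
    rewrite leqNgt; apply/negP=> lj; case/negP: ej; rewrite inE; apply/hasP.
    by exists l; [rewrite mem_iota | rewrite le].
  exists S; first exact: (subsetP (viol_sub (Jp_mono sq jl))).
  apply/setP=> f; have cf : (f \in Js s') && cr (ends I) S f = (f == e) by rewrite -in_cut cS in_set1.
  rewrite in_cut in_setD -andbA cf in_set1; case: eqP => [->|_]; by rewrite ?ej ?andbF.
rewrite /s' -{1}bm; apply: rep_ind.
  by split=> //; rewrite subn0 -?jE // => e ->.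
rewrite bm => r s2 rm [ag sub v2 pre wit].
have b2 : base s2 by apply: (base_ext bs) => l; rewrite ag.
have qE : m - r = (m - r.+1).+1 by rewrite subnSK.
have qm : m - r.+1 < m by move: rm; clear; lia.
rewrite /Inv; rewrite {}qE in pre wit; set q := m - r.+1 in pre wit qm *; set env' := upd env 0 r.
have ev1 (s3 : store) : s3 0 1 = m -> (forall l, s3 23 l = sq l) -> ev env' s3 XE1 = sq q.
  by move=> h0 h; rewrite -[LHS]/(s3 23 (1 * s3 0 1 - (r + 1))) h h0 mul1n addn1.
have e2 : ev env' s2 XE1 = sq q by apply: ev1 => [|l]; rewrite ag // bs.1.
rewrite /Shrink rIf /tv e2; have [z|[e eE ef]] := fresh q qm.
  have JE : Jp sq q.+1 = Jp sq q by apply/setP=> j; rewrite in_JpS z /= orbF.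
  rewrite ifF; last by rewrite z.
  by change (rrun env' RSkip s2) with s2; split=> //; rewrite -JE.
have eK : e \in Js s2 by apply: (subsetP pre); rewrite in_JpS eE eqxx orbT.
have preq : Jp sq q \subset Js s2 := subset_trans (Jp_mono sq (leqnSn q)) pre.
have notq (f : 'I_m) : f != e -> f \notin Jp sq q -> f \notin Jp sq q.+1.
  by move=> fe fq; rewrite in_JpS negb_or fq eE eqSS eq_sym.
rewrite ifT ?eE //.
pose s3 := update s2 22 e 0; pose s4 := rrun env' AnyViol s3.
have g3 : rrun env' (RSet 22 (XSub XE1 (XN 1)) (XN 0)) s2 = s3.
  by rewrite rSet -[ev _ _ (XSub _ _)]/(ev env' s2 XE1 - 1) e2 eE subn1.
rewrite rSeq [rrun env' (RSeq _ AnyViol) s2]rSeq g3 -/s4 rIf tvG -[ev _ _ (XN 0)]/0.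
have b3 : base s3 by apply: (base_ext b2) => l; rewrite /s3 update_diff.
have J3 : Js s3 = Js s2 :\ e.
  apply/setP=> j; rewrite in_setD1 !in_Js /s3 /update eqxx /= -val_eqE /=.
  by case: (nat_of_ord j == e).
have vE := AnyViol_spec env' b3; rewrite -/s4 in vE.
have f4 a l : a \notin 34 :: setscr -> s4 a l = s3 a l.
  by move=> h; rewrite /s4 rframe //; notwritten h.
have ag4 a l : a \notin [:: 22, 34 & setscr] -> s4 a l = s a l.
  move=> h; have [h1 h2] : a != 22 /\ a \notin 34 :: setscr by move: h; rewrite inE negb_or => /andP[].
  by rewrite f4 // /s3 update_diff // ag.
rewrite vE; case: ifP => [|/negbFE/eqP v3].
  case/set0Pn=> S SF.
  have g5 : rrun env' (RSet 22 (XSub XE1 (XN 1)) (XN 1)) s4 = update s4 22 e 1.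
    rewrite rSet -[ev _ _ (XSub _ _)]/(ev env' s4 XE1 - 1) ev1 ?eE ?subn1 // => [|l]; by rewrite ag4 // bs.1.
  rewrite g5; set s5 := update s4 22 e 1.
  have J5 : Js s5 = Js s2.
    apply/setP=> j; rewrite !in_Js /s5 {1}/update eqxx /=; case: (nat_of_ord j =P e) => [je|ne].
      by have -> : j = e by [apply: val_inj]; rewrite -in_Js eK.
    by rewrite f4 // /s3 /update eqxx /=; case: (nat_of_ord j =P e) ne.
  split.
  - move=> a l h; have h1 : a != 22 by move: h; rewrite inE negb_or => /andP[].
    by rewrite /s5 update_diff // ag4.
  - by rewrite J5.
  - by rewrite /vio J5.
  - by rewrite J5.
  - move=> f; rewrite J5 => fK fq; have [fe|fe] := eqVneq f e; last by apply: wit => //; apply: notq.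
    rewrite fe; exists q, S; split=> //.
      by apply: (subsetP (viol_sub _)) SF; rewrite J3 subsetD1 preq.
    move/violP: SF => [S0 ST cS ex]; rewrite J3 => c0.
    have cn0 : cut (ends I) (Js s2) S != set0.
      apply/eqP=> cz; have : S \in vio s2 by apply/violP.
      by rewrite v2 in_set0.
    have sub1 : cut (ends I) (Js s2) S \subset [set e].
      apply/subsetP=> g; rewrite in_cut in_set1 => /andP[gK gc]; apply: contraT => ge.
      have : g \in cut (ends I) (Js s2 :\ e) S by rewrite in_cut in_setD1 ge gK.
      by rewrite c0 in_set0.
    by move: sub1; rewrite subset1 (negPf cn0) orbF => /eqP.
rewrite -[rrun _ RSkip _]/s4.
have J4 : Js s4 = Js s2 :\ e by rewrite -J3; apply/setP=> j; rewrite !in_Js f4.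
split=> //.
- by rewrite J4; apply: subset_trans sub; apply: subD1set.
- by rewrite /vio J4 -J3 -/(vio s3).
- by rewrite J4 subsetD1 preq.
- move=> f; rewrite J4 in_setD1 => /andP[fe fK] fq; have [j [S [h1 h2 h3]]] := wit f fK (notq f fe fq).
  exists j, S; split=> //; apply/setP=> g.
  have cg : (g \in Js s2) && cr (ends I) S g = (g == f) by rewrite -in_cut h3 in_set1.
  by rewrite in_cut in_setD1 -andbA cg in_set1 andbC; case: eqP => // ->; rewrite fe.
Qed.

Theorem Stage2_spec env (s : store) (c0 : 'I_m -> nat) (O : {set 'I_m}) : base s -> feasible k 1 I O ->
  (forall j : 'I_m, s 14 j = c0 j) ->
  let s' := rrun env Stage2 s in let F := [set j : 'I_m | s' 1 j != 0] in
  feasible k 1 I F /\ \sum_(e in F) c0 e <= \sum_(e in Hs) c0 e + 2 * \sum_(e in O) c0 e.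
Proof.
move=> bs fO cs s' F.
pose s1 := rrun env Forward s; pose s2 := rrun env (RRep 0 BE Shrink) s1.
have s'E : s' = rrun env (RPar 8 1 BE (XB (XOr (XG 21 (XV 8)) (XG 22 (XV 8))))) s2 by [].
have [b1 j1 v1 [dH fr] le] := Forward_spec env bs fO cs; rewrite -/s1 in b1 j1 v1 dH fr le.
have [b2 sub v2 wit] := Shrink_spec env b1 j1 v1 fr; rewrite -/s2 in b2 sub v2 wit.
have FE : F = Hs :|: Js s2.
  apply/setP=> j; rewrite inE in_setU s'E rPar_in; last by rewrite /bval /= b2.1.
  by rewrite -/(tv _ _ _) tvB tvOr !tvG -[ev _ _ (XV 8)]/(val j) b2.2 in_Js.
have cov : covers (ends I) (Js s2) (vl set0).
  move=> S /violP[S0 ST cS ex _]; apply/eqP=> cz; have : S \in vio s2 by apply/violP.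
  by rewrite v2 in_set0.
have dis : [disjoint Js s2 & Hs].
  rewrite -setI_eq0 -subset0; apply/subsetP=> j; rewrite in_setI => /andP[/(subsetP sub)/dH jn jH].
  by rewrite jH in jn.
rewrite FE; split; first exact: feasible_union.
apply: (@leq_trans (\sum_(e in Hs) c0 e + \sum_(e in Js s2) c0 e)).
  rewrite big_mkcond [X in _ <= X + _]big_mkcond [X in _ <= _ + X]big_mkcond -big_split /=.
  apply: leq_sum => e _; rewrite in_setU.
  by case: (e \in Hs); case: (e \in Js s2); rewrite /= ?leq_addr ?addn0 ?add0n.
rewrite leq_add2l; apply: leq_trans (le (Js s2) sub cov wit) _; rewrite leq_mul2l /=.
rewrite big_mkcond [X in _ <= X]big_mkcond; apply: leq_sum => e _; rewrite in_setD.
by case: (e \in O); case: (e \in Hs).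
Qed.

End Augmentation.

(** * Assembly of the two stages *)

Lemma wfs_algorithm k : wfs [::] (RSeq (Stage1 k) (Stage2 k)).
Proof. by []. Qed.

Lemma cost_numerators I (X : {set 'I_(nE I)}) :
  (cost I X * (cden I)%:R = (\sum_(j in X) cn j)%:R)%R.
Proof. by rewrite /cost mulr_suml natr_sum; apply: eq_bigr => j _; rewrite cnE. Qed.

Theorem theorem4 (k : nat) (hk : 0 < k) :
  exists A : prog, polytime_approximation 4%:R%R k 1 A.
Proof.
have [A [cc [d H]]] := compiled_program (wfs_algorithm k).
exists A, cc, d => I; have [t [s [ex tm out]]] := H I.
exists t, s; split=> // -[F0 fF0].
pose s1 := rrun env0 (Stage1 k) (input_store I).
have hin i : input_store I 0 i = inp I i by [].
have [c1 st1] := Stage1_spec hk env0 hin; rewrite -/s1 in c1 st1.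
set Hs := [set j : 'I_(nE I) | s1 21 j != 0] in st1.
have Fk F : feasible k 1 I F -> forall S, S != set0 -> S != setT -> k <= #|cut (ends I) F S|.
  by move=> /feasible_cutP h S S0 ST; have [] := h S S0 ST.
have [Hk _] := st1 F0 (Fk F0 fF0).
have bs : base Hs s1 by split=> [i|j]; [rewrite /s1 rframe | rewrite inE].
have oE : output I s = [set j : 'I_(nE I) | rrun env0 (Stage2 k) s1 1 j != 0].
  by apply/setP=> j; rewrite !inE out.
have S2 O (fO : feasible k 1 I O) := Stage2_spec hk Hk env0 bs fO c1.
rewrite oE; split; first by have [] := S2 F0 fF0.
move=> Fo [fFo _]; have [_ le2] := S2 Fo fFo; have [_ le1] := st1 Fo (Fk Fo fFo).
have dpos : (0 < (cden I)%:R :> rat)%R by rewrite ltr0n cden_gt0.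
(* Multiplication by the common denominator leaves integers, where packing and cover contribute
   twice the optimum each. *)
rewrite -(ler_pM2r dpos) -mulrA !cost_numerators -natrM ler_nat.
apply: leq_trans le2 _; apply: leq_trans (leq_add le1 (leqnn _)) _.
by rewrite -mulnDl.
Qed.
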